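(* Let $d\ge2$, let $\beta$ and $X$ be independent random vectors in $\mathbb S^{d-1}$, where $\beta$ has a probability density $f_\beta\in\mathrm L^2(\mathbb S^{d-1})$ with respect to $\sigma$ and $X$ has a density $f_X$ with respect to $\sigma$ that is positive $\sigma$-a.e. on $H^+$ and zero outside $H^+$. Let $Y=\mathbb I\{X'\beta\ge0\}$, $r(x)=\mathbb P(Y=1\mid X=x)$ for $x\in H^+$, and $R(x)=r(x)$ for $x_1\ge0$, $R(x)=1-r(-x)$ for $x_1<0$. Then for each $p$ the expectation $\mathbb E\big[\frac{(2Y-1)}{f_X(X)}q_{2p+1,d}(X,x)\big]$ equals $Q_{2p+1,d}R(x)$, and $$R(x)=\frac12+\sum_{p=0}^\infty\mathbb E\Big[\frac{(2Y-1)}{f_X(X)}\,q_{2p+1,d}(X,x)\Big],$$ the series converging in $\mathrm L^2(\mathbb S^{d-1})$.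
   Context: $\mathbb S^{d-1}$ is the unit sphere in $\mathbb R^d$ with surface measure $\sigma$, $|\mathbb S^{d-1}|=2\pi^{d/2}/\Gamma(d/2)$; $H^+=\{x\in\mathbb S^{d-1}:x_1\ge0\}$. $H^{n,d}$ is the space of restrictions to $\mathbb S^{d-1}$ of homogeneous harmonic polynomials of degree $n$ on $\mathbb R^d$, of dimension $h(n,d)=\frac{(2n+d-2)(n+d-2)!}{n!(d-2)!(n+d-2)}$ ($h(0,d)=1$, $h(n,2)=2$ for $n\ge1$); $Q_{n,d}$ is the orthogonal projector of $\mathrm L^2(\mathbb S^{d-1})$ onto $H^{n,d}$, the integral operator with kernel $q_{n,d}(x,y)=\frac{h(n,d)C_n^{\nu(d)}(x'y)}{|\mathbb S^{d-1}|C_n^{\nu(d)}(1)}$, $\nu(d)=(d-2)/2$, where $C_n^\nu$ are the Gegenbauer polynomials ($C_n^\nu(t)=\sum_{l=0}^{\lfloor n/2\rfloor}\frac{(-1)^l(\nu)_{n-l}}{l!(n-2l)!}(2t)^{n-2l}$ for $\nu>0$; $C_0^0=1$, $C_n^0(t)=\frac2n\cos(n\arccos t)$ for $n\ge1$). *)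

(* Defs.v *)
From HB Require Import structures.
From mathcomp Require Import all_boot all_order all_algebra.
From mathcomp Require Import all_classical all_reals all_analysis.
Set Implicit Arguments. Unset Strict Implicit. Unset Printing Implicit Defensive.
Import Order.TTheory GRing.Theory Num.Theory.
Import numFieldNormedType.Exports.
Local Open Scope classical_set_scope.
Local Open Scope ring_scope.

Section defs.
Variable R : realType.

(* Points of R^d are d-tuples of reals; [d.-tuple R] carries the product
   (= Borel) sigma-algebra generated by the coordinate projections. *)

Definition dotp (d : nat) (x y : d.-tuple R) : R :=
  \sum_(i < d) tnth x i * tnth y i.

Definition enorm (d : nat) (x : d.-tuple R) : R := Num.sqrt (dotp x x).

Definition coord1 (d : nat) (x : d.-tuple R) : R := nth 0 (tval x) 0.

Definition oppt (d : nat) (x : d.-tuple R) : d.-tuple R := map_tuple (fun a => - a) x.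

Definition scalet (d : nat) (c : R) (x : d.-tuple R) : d.-tuple R :=
  map_tuple (fun a => c * a) x.

Definition sphere (d : nat) : set (d.-tuple R) := [set x | enorm x = 1].

Definition Hplus (d : nat) : set (d.-tuple R) :=
  [set x | enorm x = 1 /\ 0 <= coord1 x].

Fixpoint iint (n : nat) : (n.-tuple R -> \bar R) -> \bar R :=
  match n with
  | 0 => fun F => F [tuple]
  | n'.+1 => fun F =>
      (\int[@lebesgue_measure R]_(t in [set: R]) iint (fun v => F (cons_tuple t v)))%E
  end.

(* Surface integral on S^{d-1} of a nonnegative function, via the cone
   formula  \int_S g d sigma = d * \int_{0 < |x| <= 1} g(x/|x|) dx. *)
Definition sphere_int (d : nat) (g : d.-tuple R -> \bar R) : \bar R :=
  (d%:R%:E * iint (fun x : d.-tuple R =>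
     if ((0 < enorm x) && (enorm x <= 1))%R then g (scalet (enorm x)^-1 x)
     else 0%E))%E.

Definition sphere_intR (d : nat) (g : d.-tuple R -> R) : R :=
  fine (sphere_int (fun x => (Num.max (g x) 0)%:E)) -
  fine (sphere_int (fun x => (Num.max (- g x) 0)%:E)).

Definition poch (a : R) (k : nat) : R := \prod_(j < k) (a + j%:R).

Definition gegenbauer (nu : R) (n : nat) (t : R) : R :=
  if nu == 0 then
    (if n == 0%N then 1 else 2 / n%:R * cos (n%:R * acos t))
  else
    \sum_(l < (n./2).+1)
      (-1) ^+ l * poch nu (n - l) / ((l`!)%:R * ((n - 2 * l)`!)%:R)
        * (2 * t) ^+ (n - 2 * l).

Definition nu_of (d : nat) : R := (d%:R - 2) / 2.

(* h(n,d) = dim H^{n,d} *)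
Definition hdim (n d : nat) : R :=
  if n == 0%N then 1 else
  ((2 * n + d - 2)%N%:R * ((n + d - 2)`!)%:R) /
  ((n`!)%:R * ((d - 2)`!)%:R * (n + d - 2)%N%:R).

(* Gamma(m/2) for m >= 1:  Gamma(k) = (k-1)!,  Gamma(k+1/2) = (2k)!/(4^k k!) sqrt(pi) *)
Definition gamma_half (m : nat) : R :=
  if ~~ odd m then ((m./2).-1`!)%:R
  else ((2 * m./2)`!)%:R / (4 ^+ m./2 * (m./2)`!%:R) * Num.sqrt pi.

Definition sphere_area (d : nat) : R := 2 * powR pi (d%:R / 2) / gamma_half d.

(* the reproducing kernel q_{n,d}(x,y) of H^{n,d} *)
Definition qker (n d : nat) (x y : d.-tuple R) : R :=
  hdim n d * gegenbauer (nu_of d) n (dotp x y) /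
  (sphere_area d * gegenbauer (nu_of d) n 1).

Definition Qproj (n d : nat) (F : d.-tuple R -> R) (x : d.-tuple R) : R :=
  sphere_intR (fun y => @qker n d x y * F y).

End defs.
Arguments qker {R} n d x y.
Arguments Qproj {R} n d F x.

Section defs2.
Variable R : realType.

Definition Rext (d : nat) (r : d.-tuple R -> R) (x : d.-tuple R) : R :=
  if 0 <= coord1 x then r x else 1 - r (oppt x).

Definition Yind {T : Type} (d : nat) (beta X : T -> d.-tuple R) (w : T) : R :=
  (if 0 <= dotp (X w) (beta w) then 1 else 0).

Definition projcoef {dO} {T : measurableType dO} (P : probability T R) (d : nat)
  (beta X : T -> d.-tuple R) (fX : d.-tuple R -> R) (n : nat) (x : d.-tuple R)
  : \bar R :=
  (\int[P]_w ((2 * Yind beta X w - 1) / fX (X w) * qker n d (X w) x)%:E)%E.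

End defs2.

(* Main.v *)
(** Let mu be the law of G/|G| for a standard Gaussian vector G. Polar
coordinates give sigma = |S^{d-1}| mu, and Gaussian integration by parts
becomes an integration by parts for zonal functions on the sphere. Write
q_{n,d}(x,y) = Z_n(x'y)/|S^{d-1}|. The operator of the Gegenbauer equation is
symmetric for the pairing of f(x'y) with g(z'y) in L^2(mu), so the Z_n are
orthogonal. The pairing of Z_n(x'y) with Z_n(z'y) is a polynomial in x'z of
degree at most n, with the leading coefficient of Z_n and orthogonal to Z_m
for m < n, hence it is Z_n(x'z), and the Q_n are orthogonal projections.

For completeness, expand ((1+t)/2)^m = sum_n a_n Z_n(t) and let kappa_m be the
mu-mass of ((1+x'y)/2)^m. Positivity of
E_m(F) = int int ((1+x'y)/2)^m (F(x)-F(y))^2 gives a_n <= kappa_m, and then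
2 kappa_m |F - sum_(n<=m) Q_n F|^2 <= E_m(F). Now E_m(F) = o(kappa_m) for
Lipschitz functions of a coordinate, and this property is stable under bounded
products and L^2 limits, so it holds for all bounded measurable F.

For odd n, dividing by the density of X turns the expectation into an integral
of (2r-1) q_{n,d} over the hemisphere, which equals Q_n R since R - 1/2 is odd
up to a null set. Oddness also makes the even projections of R - 1/2 vanish. *)

Require Import Defs.
From HB Require Import structures.
From mathcomp Require Import all_boot all_order all_algebra.
From mathcomp Require Import all_classical all_reals all_analysis.
From mathcomp Require Import measurable_realfun.
From mathcomp Require Import ring lra zify.
Import Order.TTheory GRing.Theory Num.Theory.
Import numFieldNormedType.Exports.
Set Implicit Arguments. Unset Strict Implicit. Unset Printing Implicit Defensive.
Local Open Scope classical_set_scope.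
Local Open Scope ring_scope.

(** * Gegenbauer polynomials and their differential equation *)

(** [sphere_int] is an iterated Lebesgue integral over the unit ball, and its rotational symmetry is
    not visible in that form. The Gaussian is the bridge: it is a product, so Tonelli and
    integration by parts are done one coordinate at a time, and its density depends on |x| only, so
    homogeneous functions factor into a radial moment and a spherical mean. That zonal pairings
    depend on x'z alone is read off from a recursion on the moments of (x'y)^j (z'y)^k. The passage
    to all bounded measurable functions rests on a sigma-algebra argument: the measurable sets whose
    indicator F satisfies E_m(F) = o(kappa_m) form a sigma-algebra, and it contains the coordinate
    half-spaces. The conditional probability r is determined only up to null sets of the law of X
    and is arbitrary on them, so it need not be bounded. All estimates are made for its clipping to
    [0, 1]; positivity of the density on the hemisphere turns the null sets of the law of X there
    into null sets of sigma, which allows r and its clipping to be exchanged under the integrals. *)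

Section gegenbauer_ode.
Variable R : realFieldType.
Implicit Types (c : R) (f : {poly R}).

(** The Gegenbauer operator. With [c = d - 1] it is the spherical Laplacian acting on functions of
    [x'y], and [- legeig c n] is its eigenvalue [- n (n + d - 2)]. *)
Definition legop c f : {poly R} := (1 - 'X^2) * f^`()^`() - c *: ('X * f^`()).
Definition legeig c (n : nat) : R := n%:R * (n%:R + c - 1).

(** The k-th derivative solves an equation of the same type with [c] raised by [2 k]: each
    differentiation of [1 - t^2] feeds the first-order term. *)
Lemma legop_derivn c f n (k : nat) : legop c f = - legeig c n *: f ->
  (1 - 'X^2) * f^`(k.+2) - (k%:R * 2 + c) *: ('X * f^`(k.+1)) =
  - (legeig c n - legeig c k) *: f^`(k).
Proof.
move=> e; elim: k => [|k IH].
  by rewrite mul0r add0r [legeig c 0]/legeig mul0r subr0 -e /legop /derivn /=.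
move: IH; rewrite ![f^`(_.+1)]derivnS; set g := f^`(k) => IH.
have [a ea] : exists a, a = k%:R * 2 + c by exists (k%:R * 2 + c).
have [b eb] : exists b, b = - (legeig c n - legeig c k).
  by exists (- (legeig c n - legeig c k)).
have -> : - (legeig c n - legeig c k.+1) = b + a.
  by rewrite eb ea /legeig -natr1; ring.
have -> : k.+1%:R * 2 + c = a + 2 by rewrite ea -natr1; ring.
rewrite -ea -eb in IH; have := congr1 (@deriv R) IH.
rewrite derivB derivM !derivZ derivM derivB derivXn derivX.
rewrite -[1]/(1%:P) derivC polyC1 /= expr1 -!mul_polyC !polyCD => {}IH.
rewrite !polyC1.
transitivity (b%:P * g^`() + a%:P * g^`()); last by ring.
by rewrite -IH; ring.
Qed.

(** At [t = 1] the second-order term vanishes, so each derivative at 1 determines the next. *)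
Lemma legop_horner1 c f n (k : nat) : legop c f = - legeig c n *: f ->
  (k%:R * 2 + c) * f^`(k.+1).[1] = (legeig c n - legeig c k) * f^`(k).[1].
Proof.
move=> /(@legop_derivn _ _ _ k) /(congr1 (fun p => p.[1])).
by rewrite !hornerE /= ?expr1n subrr => h; lra.
Qed.

Lemma legeigB c n k : legeig c n - legeig c k = (n%:R - k%:R) * (n%:R + k%:R + c - 1).
Proof. by rewrite /legeig; ring. Qed.

Lemma legop_derivn1 c f n (k : nat) : 0 < c -> legop c f = - legeig c n *: f ->
  f^`(k).[1] = \prod_(i < k) ((n%:R - i%:R) * (n%:R + i%:R + c - 1) / (i%:R * 2 + c)) * f.[1].
Proof.
move=> c0 e; elim: k => [|k IH]; first by rewrite big_ord0 mul1r.
have H : k%:R * 2 + c != 0 by rewrite gt_eqF// ltr_wpDl// mulr_ge0.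
apply: (mulfI H); rewrite (@legop_horner1 c f n k e) IH legeigB big_ord_recr /=.
by field.
Qed.

Lemma derivn_size f n : (size f <= n.+1)%N -> f^`(n) = (f`_n *+ n`!)%:P.
Proof.
move=> sf; apply/polyP => i; rewrite coef_derivn coefC.
case: i => [|i]; first by rewrite addn0 ffactnn.
by rewrite nth_default ?mul0rn //= (leq_trans sf)// addnS ltnS leq_addr.
Qed.

(** The n-th derivative is constant, so the leading coefficient is fixed by the value at 1 and the
    explicit coefficients can be bypassed. *)
Lemma legop_lead c f n : 0 < c -> legop c f = - legeig c n *: f -> (size f <= n.+1)%N ->
  f`_n *+ n`! =
  \prod_(i < n) ((n%:R - i%:R) * (n%:R + i%:R + c - 1) / (i%:R * 2 + c)) * f.[1].
Proof.
by move=> c0 e sf; rewrite -(@legop_derivn1 _ _ _ n c0 e) derivn_size// hornerC.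
Qed.

Lemma coef_legop c f m : (legop c f)`_m =
  f`_m.+2 *+ (m.+2 * m.+1) - m%:R * (m%:R + c - 1) * f`_m.
Proof.
rewrite /legop mulrBl mul1r !coefB coefZ coefXM coefXnM !coef_deriv.
case: m => [|[|m]] /=.
- by rewrite muln1 mulr1n; ring.
- by rewrite -mulrnA mulr1n; ring.
rewrite subSS subn1 /= -!mulrnA.
have -> : f`_m.+2 *+ (m.+2 * m.+1) = (m%:R + 2) * (m%:R + 1) * f`_m.+2.
  by rewrite -[LHS]mulr_natl natrM -!natr1; ring.
by rewrite -[f`_m.+2 *+ m.+2]mulr_natl -!natr1; ring.
Qed.

(** The coefficient equation ties index [m] to [m + 2], and [legeig c n - legeig c m] is nonzero for
    [m < n]; descent from above the degree kills the coefficients of the wrong parity. *)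
Lemma legop_parity c f n : 0 < c -> legop c f = - legeig c n *: f -> (size f <= n.+1)%N ->
  forall m, odd (n + m) -> f`_m = 0.
Proof.
move=> c0 e sf m.
have [k] := ubnP (n.+1 - m); elim: k m => // k IH m.
rewrite ltnS => hk om.
have [nm|mn] := ltnP n m; first by rewrite nth_default// (leq_trans sf).
have := congr1 (fun p : {poly R} => p`_m) e.
rewrite /= coef_legop coefZ IH; last 2 first.
- by apply: leq_trans hk; rewrite subnS subSn //; lia.
- by rewrite !addnS /= negbK.
rewrite mul0rn sub0r mulNr => /eqP; rewrite eqr_opp -subr_eq0 -mulrBl mulf_eq0.
rewrite -opprB oppr_eq0 -/(legeig c m) legeigB mulf_eq0 => /orP[/orP[]|/eqP//].
  by rewrite subr_eq0 eqr_nat => /eqP nm; rewrite nm addnn odd_double in om.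
have n0 : (1 <= n)%N.
  by case: (n) mn om => // ; rewrite leqn0 => /eqP ->.
rewrite gt_eqF//.
have : (1 : R) <= n%:R by rewrite ler1n.
have : (0 : R) <= m%:R by [].
lra.
Qed.

Lemma legop_hornerN c f n t : 0 < c -> legop c f = - legeig c n *: f -> (size f <= n.+1)%N ->
  f.[- t] = (-1) ^+ n * f.[t].
Proof.
move=> c0 e sf; rewrite !horner_coef mulr_sumr; apply: eq_bigr => i _.
have [oi|] := boolP (odd (n + i)); first by rewrite (legop_parity c0 e sf)// !mul0r mulr0.
rewrite oddD => oi; rewrite [(- t) ^+ i]exprNn mulrCA; congr (_ * _)%R.
rewrite -signr_odd -[RHS]signr_odd; congr (_ ^+ _).
by case: (odd n) oi; case: (odd i).
Qed.

Lemma legop1_neq0 c f n : 0 < c -> legop c f = - legeig c n *: f -> (size f <= n.+1)%N ->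
  f`_n != 0 -> f.[1] != 0.
Proof.
move=> c0 e sf; apply: contra_neq => f1.
have := legop_lead c0 e sf; rewrite f1 mulr0 => /eqP.
by rewrite mulrn_eq0 eqn0Ngt fact_gt0 /= => /eqP.
Qed.

End gegenbauer_ode.

Section gegenbauer_poly.
Variable R : realType.
Implicit Types (nu : R).

Definition gegc nu (n l : nat) : R :=
  (-1) ^+ l * poch nu (n - l) / ((l`!)%:R * ((n - 2 * l)`!)%:R) * 2 ^+ (n - 2 * l).

Definition gegp nu n : {poly R} := \sum_(l < (n./2).+1) gegc nu n l *: 'X^(n - 2 * l).

Lemma gegpE nu n t : nu != 0 -> gegenbauer nu n t = (gegp nu n).[t].
Proof.
move=> /negbTE nu0; rewrite /gegenbauer nu0 /gegp horner_sum; apply: eq_bigr => l _.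
by rewrite !hornerE /gegc exprMn mulrA.
Qed.

Lemma pochS nu n : poch nu n.+1 = poch nu n * (nu + n%:R).
Proof. by rewrite /poch big_ord_recr. Qed.

Lemma poch_gt0 nu n : 0 < nu -> 0 < poch nu n.
Proof. by move=> nu0; apply: prodr_gt0 => i _; rewrite ltr_pwDl. Qed.

(** The ratio of consecutive coefficients, in the form in which neighbouring monomials cancel in the
    Gegenbauer equation. *)
Lemma gegcS nu n l : (l.+1 <= n./2)%N ->
  gegc nu n l * ((n - 2 * l)%N%:R * (n - 2 * l)%N.-1%:R) =
  - gegc nu n l.+1 * ((l.+1)%:R * 2 * (2 * n%:R - 2 * l.+1%:R + 2 * nu)).
Proof.
move=> ln; have [k nE] : exists k, n = (2 * l + k.+2)%N.
  exists (n - 2 * l.+1)%N; lia.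
rewrite /gegc.
have -> : (n - 2 * l.+1 = k)%N by lia.
have -> : (n - 2 * l = k.+2)%N by lia.
have -> : (n - l.+1 = l + k.+1)%N by lia.
have -> : (n - l = (l + k.+1).+1)%N by lia.
have -> : n%:R = 2 * l%:R + k%:R + 2 :> R by rewrite nE natrD natrM -!natr1; ring.
rewrite pochS !factS !exprS /= natrD.
rewrite ![((_ * _)%N)%:R]natrM -!natr1.
have h1 : (k`!)%:R != 0 :> R by rewrite pnatr_eq0 -lt0n fact_gt0.
have h2 : (l`!)%:R != 0 :> R by rewrite pnatr_eq0 -lt0n fact_gt0.
have h3 : 0 <= l%:R :> R by [].
have h4 : 0 <= k%:R :> R by [].
field; rewrite h1 h2 /= !gt_eqF//; lra.
Qed.

Lemma legop_sum c I (r : seq I) (F : I -> {poly R}) :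
  legop c (\sum_(i <- r) F i) = \sum_(i <- r) legop c (F i).
Proof.
elim: r => [|i r IH]; first by rewrite !big_nil /legop !linear0 !(mulr0, scaler0) subr0.
rewrite !big_cons -IH /legop !derivD !mulrDr scalerDr; ring.
Qed.

Lemma legopZXn c a k : legop c (a *: 'X^k : {poly R}) =
  (a * (k%:R * k.-1%:R)) *: 'X^(k.-2) - (a * legeig c k) *: 'X^k.
Proof.
apply/polyP => m; rewrite coef_legop coefB !coefZ !coefXn.
case: k => [|[|k]] /=.
- rewrite !mulr0 mul0r add0r.
  case: m => [|m]; rewrite ?mulr0 ?mul0rn ?mul0r ?subr0 ?sub0r /legeig ?mulr0 ?oppr0 //.
  by rewrite !mul0r !mulr0 mul0r oppr0.
- rewrite /= !mulr0 mul0r mul0rn !add0r /legeig.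
  by case: m => [|[|m]] /=; rewrite ?(mulr0,mul0r,oppr0,mulr1,mul1r)//; ring.
rewrite !eqSS; have [->|mk] := eqVneq m k.
  have -> : (k == k.+2) = false by apply/eqP; lia.
  by rewrite !mulr0 -[X in X - _]mulr_natl natrM -!natr1 /=; ring.
rewrite mulr0 mul0rn mulr0 !sub0r /legeig; have [->|] := eqVneq m k.+2; first ring.
by rewrite !mulr0.
Qed.

Lemma legop_gegp nu n : legop (2 * nu + 1) (gegp nu n) = - legeig (2 * nu + 1) n *: gegp nu n.
Proof.
rewrite /gegp legop_sum.
under eq_bigr do rewrite legopZXn.
rewrite sumrB scaler_sumr; apply/eqP; rewrite subr_eq -big_split /=; apply/eqP.
(* The two sums match after a shift by one: the lowest monomial has degree 0 or 1 and is killed by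
   the second derivative, and the top one cancels against the eigenvalue. *)
rewrite big_ord_recr /= [X in _ + X](_ : _ = 0) ?addr0; last first.
  suff -> : (n - 2 * n./2)%:R * (n - 2 * n./2).-1%:R = 0 :> R by rewrite mulr0 scale0r.
  have [->|->] : (n - 2 * n./2 = 0)%N \/ (n - 2 * n./2 = 1)%N by lia.
    by rewrite mul0r.
  by rewrite mulr0.
rewrite big_ord_recl /= [X in _ = X + _](_ : _ = 0) ?add0r; last first.
  by rewrite /= muln0 subn0 scalerA -scalerDl mulNr mulrC addNr scale0r.
apply: eq_bigr => i _; rewrite /bump /= add1n scalerA -scalerDl gegcS; last exact: ltn_ord.
have -> : (n - 2 * i).-2 = (n - 2 * i.+1)%N by lia.
congr (_ *: _); rewrite /legeig natrB; last by have := ltn_ord i; lia.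
by rewrite natrM; ring.
Qed.

Lemma size_gegp nu n : (size (gegp nu n) <= n.+1)%N.
Proof.
apply: (leq_trans (size_sum _ _ _)); apply/bigmax_leqP => i _.
by rewrite (leq_trans (size_scale_leq _ _))// size_polyXn ltnS leq_subr.
Qed.

Lemma lead_gegp nu n : 0 < nu -> (gegp nu n)`_n != 0.
Proof.
move=> nu0; rewrite /gegp coef_sum big_ord_recl /= muln0 subn0 coefZ coefXn eqxx mulr1.
rewrite big1 ?addr0 => [|i _]; last first.
  rewrite coefZ coefXn /bump /= add1n.
  have -> : (n == (n - 2 * i.+1)%N) = false by apply/eqP; have := ltn_ord i; lia.
  by rewrite mulr0.
rewrite /gegc muln0 !subn0 expr0 mul1r fact0 mul1r.
by rewrite !mulf_neq0// ?gt_eqF ?poch_gt0// ?invr_gt0 ?ltr0n ?fact_gt0// exprn_gt0.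
Qed.

(* [chebT n] and [chebU n] are the Chebyshev polynomials T_n and U_(n-1). *)
Fixpoint chebTU (n : nat) : {poly R} * {poly R} :=
  if n is m.+1 then
    let: (t, u) := chebTU m in ('X * t - (1 - 'X^2) * u, 'X * u + t)
  else (1, 0).
Definition chebT n := (chebTU n).1.
Definition chebU n := (chebTU n).2.

Lemma chebTS n : chebT n.+1 = 'X * chebT n - (1 - 'X^2) * chebU n.
Proof. by rewrite /chebT /chebU /=; case: (chebTU n). Qed.
Lemma chebUS n : chebU n.+1 = 'X * chebU n + chebT n.
Proof. by rewrite /chebT /chebU /=; case: (chebTU n). Qed.

Lemma cheb_trig n (x : R) : cos (n%:R * x) = (chebT n).[cos x] /\
  sin (n%:R * x) = sin x * (chebU n).[cos x].
Proof.
elim: n => [|n [IH1 IH2]].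
  by rewrite mul0r cos0 sin0 /chebT /chebU /= !hornerE.
rewrite chebTS chebUS !hornerE -natr1 mulrDl mul1r cosD sinD IH1 IH2.
by rewrite -sin2cos2; split; ring.
Qed.

(** The two identities need each other in the induction; combined they give the Chebyshev equation,
    which is [legop] with [c = 1]. *)
Lemma deriv_cheb n : (chebT n)^`() = n%:R *: chebU n /\
  (1 - 'X^2) * (chebU n)^`() = 'X * chebU n - n%:R *: chebT n.
Proof.
elim: n => [|n [IH1 IH2]].
  by rewrite /chebT /chebU /= -polyC1 derivC deriv0 !scale0r mulr0 !mulr0 subr0.
have d1 : (1 : {poly R})^`() = 0 by rewrite -[1]/(1%:P) derivC.
rewrite chebTS chebUS !(derivD, derivB, derivN, derivM, derivX, derivXn) d1.
rewrite IH1 -!mul_polyC in IH2 *; rewrite -natr1 polyCD polyC1 /= expr1.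
split.
  rewrite mulrDr.
  have -> : (1 - 'X^2) * (chebU n)^`() = 'X * chebU n - n%:R%:P * chebT n by [].
  ring.
rewrite !mulrDr.
have -> : (1 - 'X^2) * ('X * (chebU n)^`()) = 'X * ('X * chebU n - n%:R%:P * chebT n).
  by rewrite -IH2; ring.
ring.
Qed.

Lemma legop_chebT n : legop 1 (chebT n) = - legeig 1 n *: chebT n.
Proof.
have [e1 e2] := deriv_cheb n.
rewrite /legop e1 derivZ -scalerAr e2 /legeig scale1r -!mul_polyC.
rewrite polyCN polyCM !polyCD polyCN polyC1; ring.
Qed.

Lemma size_cheb n : (size (chebT n) <= n.+1)%N /\ (size (chebU n) <= n)%N.
Proof.
elim: n => [|n [IH1 IH2]]; first by rewrite /chebT /chebU /= size_poly1 size_poly0.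
rewrite chebTS chebUS.
have s1 (p : {poly R}) k : (size p <= k)%N -> (size ('X * p)%R <= k.+1)%N.
  move=> h; rewrite mulrC; have [->|p0] := eqVneq p 0; first by rewrite mul0r size_poly0.
  by rewrite size_mulX.
split; last first.
  by rewrite (leq_trans (size_polyD _ _))// geq_max IH1 s1.
rewrite (leq_trans (size_polyD _ _))// geq_max s1//= size_polyN.
rewrite mulrBl mul1r expr2 -mulrA (leq_trans (size_polyD _ _))// geq_max.
by rewrite size_polyN s1 ?s1// (leq_trans IH2)// ltnW.
Qed.

Lemma hdim_gt0 n d : (2 <= d)%N -> 0 < hdim R n d.
Proof.
move=> d2; rewrite /hdim; case: eqP => // /eqP; rewrite -lt0n => n0.
by rewrite divr_gt0// !mulr_gt0// ?ltr0n ?fact_gt0//; lia.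
Qed.

(** The polynomial Z_n. Scaling it to the value [hdim] at 1 makes it a reproducing kernel for the
    uniform probability and cancels the factor 2/n of C_n^0. The case [d = 2] is apart because
    [gegp] degenerates at [nu = 0]. *)
Definition gegq (n d : nat) : {poly R} :=
  let p := if d == 2%N then chebT n else gegp (nu_of R d) n in
  (hdim R n d / p.[1]) *: p.

Let gegq_base (n d : nat) : {poly R} := if d == 2%N then chebT n else gegp (nu_of R d) n.

Let gegq_baseP n d : (2 <= d)%N ->
  [/\ legop (d%:R - 1) (gegq_base n d) = - legeig (d%:R - 1) n *: gegq_base n d,
   (size (gegq_base n d) <= n.+1)%N & (gegq_base n d).[1] != 0].
Proof.
move=> d2; rewrite /gegq_base; have [->|dn2] := eqVneq d 2%N.
  have -> : 2 - 1 = 1 :> R by ring.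
  split; [exact: legop_chebT|by have [] := size_cheb n|].
  by have [+ _] := cheb_trig n 0; rewrite mulr0 cos0 => <-; rewrite oner_neq0.
have d3 : 3 <= d%:R :> R by rewrite (ler_nat R 3); lia.
have -> : d%:R - 1 = 2 * nu_of R d + 1 by rewrite /nu_of; field.
have nu0 : 0 < nu_of R d by rewrite /nu_of; lra.
split; [exact: legop_gegp|exact: size_gegp|].
apply: (legop1_neq0 _ (legop_gegp _ _)); [lra|exact: size_gegp|exact: lead_gegp].
Qed.

Lemma gegq1 n d : (2 <= d)%N -> (gegq n d).[1] = hdim R n d.
Proof. by move=> /(gegq_baseP n)[_ _ p1]; rewrite hornerZ divfK. Qed.

Lemma legop_gegq n d : (2 <= d)%N ->
  legop (d%:R - 1) (gegq n d) = - legeig (d%:R - 1) n *: gegq n d.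
Proof.
move=> /(gegq_baseP n)[e _ _]; rewrite /gegq -/(gegq_base n d).
set a := hdim _ _ _ / _.
have -> : legop (d%:R - 1) (a *: gegq_base n d) = a *: legop (d%:R - 1) (gegq_base n d).
  by rewrite /legop !derivZ -!scalerAr scalerBr !scalerA [a * _]mulrC.
by rewrite e !scalerA mulrC.
Qed.

Lemma size_gegq n d : (2 <= d)%N -> (size (gegq n d) <= n.+1)%N.
Proof.
by move=> /(gegq_baseP n)[_ s _]; apply: leq_trans s; exact: size_scale_leq.
Qed.

Lemma prod_nB n : \prod_(i < n) (n%:R - i%:R) = (n`!)%:R :> R.
Proof.
rewrite fact_prod natr_prod -(big_mkord xpredT (fun i => n%:R - i%:R)) big_nat_rev /= add0n big_add1 /=.
apply: eq_big_nat => i /andP[_ hi]; rewrite -natrB; last by lia.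
by congr (_%:R); lia.
Qed.

Lemma prod_rising m k : \prod_(i < k) (m%:R + 1 + i%:R) * (m`!)%:R = ((m + k)`!)%:R :> R.
Proof.
elim: k => [|k IH]; first by rewrite big_ord0 mul1r addn0.
by rewrite big_ord_recr /= mulrAC IH addnS factS natrM -natr1 natrD; ring.
Qed.

(** The factors of [(2 n + e)! / e!], sorted into the two parity classes. *)
Lemma prod_rising2 n e : \prod_(i < n) (i%:R * 2 + (e%:R + 2)) *
  \prod_(i < n) (i%:R * 2 + (e%:R + 1)) * (e`!)%:R = ((2 * n + e)`!)%:R :> R.
Proof.
elim: n => [|n IH]; first by rewrite !big_ord0 !mul1r.
rewrite !big_ord_recr /=.
have -> : (2 * n.+1 + e = (2 * n + e).+2)%N by lia.
rewrite !factS !natrM -IH -!natr1 natrD natrM; ring.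
Qed.

(** This product is the reciprocal of the top coefficient of the mean of [(x'y)^n (z'y)^n] as a
    polynomial in [x'z], which is why the reproducing property holds with constant 1. *)
Lemma lead_gegq n d : (2 <= d)%N ->
  (gegq n d)`_n = \prod_(i < n) ((i%:R * 2 + d%:R) / (i%:R + 1)).
Proof.
move=> d2.
have d2R : (2 : R) <= d%:R by rewrite (ler_nat R 2).
have c0 : (0 : R) < d%:R - 1 by lra.
have := legop_lead c0 (legop_gegq n d2) (size_gegq n d2).
rewrite gegq1// -[_ *+ n`!]mulr_natr => h.
have fn0 : (n`!)%:R != 0 :> R by rewrite pnatr_eq0 -lt0n fact_gt0.
apply: (mulIf fn0); rewrite h.
rewrite !prodf_div big_split /= prod_nB.
have -> : \prod_(i < n) (i%:R + 1) = (n`!)%:R :> R.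
  by rewrite fact_prod natr_prod big_add1 /= big_mkord; apply: eq_bigr => i _; rewrite natr1.
rewrite divfK//.
have p0 : \prod_(i < n) (i%:R * 2 + (d%:R - 1)) != 0 :> R.
  by apply/prodf_neq0 => i _; rewrite gt_eqF// ltr_wpDl// mulr_ge0.
apply: (mulIf p0).
have cancel_p a b p g : p != 0 -> a * b / p * g * p = a * (b * g) :> R by move=> ?; field.
rewrite cancel_p//.
(* The case [n = 0] is apart: [hdim] has its own clause there, and the number [n + d - 3] used below
   would be truncated when [d = 2]. *)
have [->|n0] := eqVneq n 0%N.
  by rewrite !big_ord0 /hdim eqxx fact0 !mul1r.
rewrite /hdim (negbTE n0).
have nd0 : (n + d - 2)%N%:R != 0 :> R by rewrite pnatr_eq0; lia.
have d20 : ((d - 2)`!)%:R != 0 :> R by rewrite pnatr_eq0 -lt0n fact_gt0.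
have e : n`!%:R * (\prod_(i < n) (n%:R + i%:R + (d%:R - 1) - 1) *
     ((2 * n + d - 2)%:R * (n + d - 2)`!%:R / (n`!%:R * (d - 2)`!%:R * (n + d - 2)%:R))) =
   (\prod_(i < n) (n%:R + i%:R + (d%:R - 1) - 1) * (n + d - 3)`!%:R) * (2 * n + d - 2)%:R / (d - 2)`!%:R :> R.
  have -> : (n + d - 2)`! = ((n + d - 2) * (n + d - 3)`!)%N.
    by have -> : (n + d - 2 = (n + d - 3).+1)%N by lia.
  by rewrite natrM; field; rewrite nd0 d20 fn0.
have {}e := e.
rewrite [LHS]e -!mulrA; have := prod_rising (n + d - 3) n.
have -> : \prod_(i < n) ((n + d - 3)%:R + 1 + i%:R) = \prod_(i < n) (n%:R + i%:R + (d%:R - 1) - 1) :> R.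
  apply: eq_bigr => i _.
  have -> : (n + d - 3)%:R = n%:R + d%:R - 3 :> R by rewrite natrB ?natrD//; lia.
  by ring.
rewrite !mulrA => ->; have := prod_rising2 n (d - 2).
have -> : (d - 2)%:R + 2 = d%:R :> R by rewrite natrB// subrK.
have -> : (d - 2)%:R + 1 = d%:R - 1 :> R by rewrite natrB//; ring.
have -> : (2 * n + (d - 2) = (n + d - 3 + n).+1)%N by lia.
have -> : (2 * n + d - 2 = (n + d - 3 + n).+1)%N by lia.
rewrite factS natrM => e2.
apply: (mulIf d20); rewrite divfK// mulrC -e2; ring.
Qed.

Lemma sphere_area_gt0 d : 0 < sphere_area R d.
Proof.
rewrite /sphere_area divr_gt0 ?mulr_gt0 ?powR_gt0 ?pi_gt0// /gamma_half.
case: ifP => _; first by rewrite ltr0n fact_gt0.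
rewrite mulr_gt0 ?sqrtr_gt0 ?pi_gt0// divr_gt0 ?ltr0n ?fact_gt0//.
Qed.

Lemma qkerE n d (x y : d.-tuple R) : (2 <= d)%N -> -1 <= dotp x y <= 1 ->
  qker n d x y = (gegq n d).[dotp x y] / sphere_area R d.
Proof.
move=> d2 xy; have a0 := lt0r_neq0 (sphere_area_gt0 d); have [_ _] := gegq_baseP n d2.
rewrite /qker /gegq /gegq_base hornerZ; have [de|dn2] := eqVneq d 2%N.
  have -> : nu_of R d = 0 by rewrite /nu_of de subrr mul0r.
  rewrite /gegenbauer eqxx.
  have hc t : -1 <= t <= 1 -> cos (n%:R * acos t) = (chebT n).[t].
    by move=> t1; have [-> _] := cheb_trig n (acos t); rewrite acosK// in_itv.
  rewrite !hc//; last by rewrite lexx andbT; lra.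
  case: (eqVneq n 0%N) => [->|n0] T1.
    by rewrite /chebT /= !hornerE; field; rewrite a0.
  have h : n%:R != 0 :> R by rewrite pnatr_eq0.
  by field; rewrite h T1 a0.
have d3 : 3 <= d%:R :> R by rewrite (ler_nat R 3); lia.
have nu0 : nu_of R d != 0 by rewrite /nu_of; apply: lt0r_neq0; lra.
by rewrite !gegpE// => p1; field; rewrite a0 p1.
Qed.

End gegenbauer_poly.

(** * Gaussian vectors and polar coordinates *)

Section inv.
Variable R : realType.
Lemma measurable_inv : measurable_fun [set: R] (@GRing.inv R).
Proof.
(* This form also holds at 0, where the inverse is 0 by convention, and each factor is known to be
   measurable. *)
have -> : @GRing.inv R = (fun x => x * powR (x ^+ 2) (- 1)).
  apply/funext => x; rewrite powR_inv1 ?sqr_ge0//.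
  have [->|x0] := eqVneq x 0; first by rewrite invr0 mul0r.
  by rewrite expr2 invfM mulVKf.
apply: measurable_funM => //; apply: (measurableT_comp (measurable_powR _)).
exact: measurable_funX.
Qed.
End inv.
Lemma measurable_funV d (T : measurableType d) (R : realType) D (f : T -> R) :
  measurable_fun D f -> measurable_fun D (fun x => (f x)^-1).
Proof. exact: (measurableT_comp (@measurable_inv R)). Qed.

Section density.
Local Open Scope ereal_scope.
Context d (T : measurableType d) (R : realType).
Variables (mu nu : {measure set T -> \bar R}) (w : T -> R).
Hypothesis mw : measurable_fun [set: T] w.
Hypothesis w0 : forall x, (0 <= w x)%R.
Hypothesis nuE : forall A, measurable A -> nu A = \int[mu]_(x in A) (w x)%:E.

Import HBNNSimple.

(** The density is given on sets only; simple functions and monotone convergence extend it to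
    integrals. *)
Lemma ge0_integral_density (f : T -> \bar R) :
  measurable_fun [set: T] f -> (forall x, 0 <= f x) ->
  \int[nu]_x f x = \int[mu]_x (f x * (w x)%:E).
Proof.
move=> mf f0; pose f_ := nnsfun_approx measurableT mf.
have fE : \int[nu]_x f x = limn (fun n => \int[nu]_x (f_ n x)%:E).
  rewrite -monotone_convergence//=.
  - by apply: eq_integral => x _; apply/esym/cvg_lim => //; exact: cvg_nnsfun_approx.
  - by move=> n; exact/measurable_EFinP.
  - by move=> n x _; rewrite lee_fin.
  - by move=> x _ a b ab; rewrite lee_fin; exact/lefP/nd_nnsfun_approx.
rewrite fE.
transitivity (limn (fun n => \int[mu]_x ((f_ n x)%:E * (w x)%:E))); last first.
  rewrite -monotone_convergence//=.
  - apply: eq_integral => x _; rewrite -[LHS]/(limn (fun n => (f_ n x)%:E * (w x)%:E)).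
    rewrite limeMr//; last by apply/cvg_ex; exists (f x); exact: cvg_nnsfun_approx.
    congr (_ * _); apply: cvg_lim => //; exact: cvg_nnsfun_approx.
  - by move=> n; apply: emeasurable_funM; exact/measurable_EFinP.
  - by move=> n x _; rewrite mule_ge0// lee_fin.
  - move=> x _ a b ab; rewrite lee_wpmul2r ?lee_fin//; exact/lefP/nd_nnsfun_approx.
congr (limn _); apply/funext => n.
under eq_integral do rewrite fimfunE -fsumEFin//.
rewrite ge0_integral_fsum//; last 2 first.
  - by move=> r; exact/measurable_EFinP/measurableT_comp.
  - by move=> r x _; rewrite nnfun_muleindic_ge0.
under [RHS]eq_integral => x _.
  rewrite fimfunE -fsumEFin// ge0_mule_fsuml; last first.
    by move=> r; rewrite nnfun_muleindic_ge0.
  over.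
rewrite ge0_integral_fsum//; last 2 first.
  - by move=> r; apply: emeasurable_funM; apply/measurable_EFinP => //; exact: measurableT_comp.
  - by move=> r x _; rewrite mule_ge0 ?nnfun_muleindic_ge0// lee_fin.
apply: eq_fsbigr => r _.
rewrite integralZl_indic_nnsfun// integral_indic// setIT nuE//.
have [r0|r0] := ltP r 0%R.
  rewrite preimage_nnfun0// integral_set0 mule0 integral0_eq// => x _.
  by rewrite indic0 mulr0 mul0e.
transitivity (\int[mu]_x (r%:E * ((\1_(f_ n @^-1` [set r]) x)%:E * (w x)%:E))).
  rewrite ge0_integralZl//; last 2 first.
  - by apply: emeasurable_funM; apply/measurable_EFinP.
  - by move=> x _; rewrite -EFinM lee_fin mulr_ge0.
  congr (_ * _); rewrite integral_mkcond; apply: eq_integral => x _.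
  by rewrite epatch_indic muleC.
by apply: eq_integral => x _; rewrite EFinM muleA.
Qed.

End density.

Section gauss1.
Variable R : realType.
(** The standard normal law, restated on the measurable structure of [R] itself instead of
    [measurableTypeR R], so that it combines with measures on tuples. *)
Definition gauss1 : set R -> \bar R := normal_prob (0:R) 1.
Let g0 : gauss1 set0 = 0%E. Proof. exact: measure0. Qed.
Let g_ge0 A : (0 <= gauss1 A)%E. Proof. exact: measure_ge0. Qed.
Let g_sa : semi_sigma_additive gauss1.
Proof. exact: (@measure_semi_sigma_additive _ _ _ (normal_prob (0:R) 1)). Qed.
HB.instance Definition _ := isMeasure.Build _ _ _ gauss1 g0 g_ge0 g_sa.
Let gT : gauss1 [set: R] = 1%E. Proof. exact: probability_setT. Qed.
HB.instance Definition _ := Measure_isProbability.Build _ _ R gauss1 gT.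
Definition cons2 n (p : R * n.-tuple R) : n.+1.-tuple R := cons_tuple p.1 p.2.
Lemma measurable_cons2 n : measurable_fun [set: R * n.-tuple R] (@cons2 n).
Proof. exact: measurable_cons. Qed.
HB.instance Definition _ n := isMeasurableFun.Build _ _ _ _ (@cons2 n) (@measurable_cons2 n).
(** Built by adding one coordinate at the head, so that its recursion is the one of [iint]. *)
Fixpoint gaussn n : probability (n.-tuple R) R :=
  match n with
  | 0 => \d_[tuple]
  | n'.+1 => distribution (gauss1 \x gaussn n')%E (@cons2 n')
  end.

Lemma ge0_integral_gaussnS n (F : n.+1.-tuple R -> \bar R) :
  measurable_fun [set: n.+1.-tuple R] F -> (forall x, 0 <= F x)%E ->
  (\int[gaussn n.+1]_x F x = \int[gauss1]_t \int[gaussn n]_v F (cons_tuple t v))%E.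
Proof.
move=> mF F0; rewrite /= ge0_integral_pushforward//= fubini_tonelli1//.
exact: measurableT_comp.
Qed.

Definition gpdf (t : R) : R := normal_peak 1 * expR (- (t ^+ 2 / 2)).

Lemma gpdfE t : normal_pdf 0 1 t = gpdf t.
Proof.
rewrite normal_pdfE ?oner_neq0// /gpdf /normal_fun subr0 expr1n.
by rewrite mulNr.
Qed.

Lemma gpdf_gt0 t : 0 < gpdf t.
Proof. by rewrite mulr_gt0 ?expR_gt0// normal_peak_gt0 ?oner_neq0. Qed.

Lemma measurable_gpdf : measurable_fun [set: R] gpdf.
Proof. by rewrite -(funext gpdfE); exact: measurable_normal_pdf. Qed.

Lemma ge0_integral_gauss1 (f : R -> \bar R) : measurable_fun [set: R] f ->
  (forall x, 0 <= f x)%E ->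
  (\int[gauss1]_t f t = \int[@lebesgue_measure R]_(t in [set: R]) (f t * (gpdf t)%:E))%E.
Proof.
move=> mf f0.
have nuE A : measurable A -> normal_prob (0:R) 1 A = (\int[@lebesgue_measure R]_(x in A) (gpdf x)%:E)%E.
  by move=> mA; rewrite /normal_prob; apply: eq_integral => x _; rewrite gpdfE.
pose H := @ge0_integral_density _ (measurableTypeR R) R lebesgue_measure (normal_prob (0:R) 1) gpdf measurable_gpdf (fun x => ltW (gpdf_gt0 x)) nuE f mf f0.
rewrite -H.
pose idR : measurableTypeR R -> R := idfun.
have midR : measurable_fun [set: measurableTypeR R] idR.
  by move=> _ A mA; rewrite setTI.
pose K := @ge0_integral_pushforward _ _ (measurableTypeR R) R R idR midR (normal_prob (0:R) 1) setT f measurableT mf (fun y _ => f0 y).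
exact: K.
Qed.

(** Turns Lebesgue integrals into integrals for a probability, to which the product constructions
    apply. *)
Lemma lebesgue_gauss1 (f : R -> \bar R) : measurable_fun [set: R] f ->
  (forall x, 0 <= f x)%E ->
  (\int[@lebesgue_measure R]_(t in [set: R]) f t = \int[gauss1]_t (((gpdf t)^-1)%:E * f t))%E.
Proof.
move=> mf f0; rewrite ge0_integral_gauss1.
- apply: eq_integral => t _; rewrite muleAC -EFinM mulVf ?mul1e//.
  exact/lt0r_neq0/gpdf_gt0.
- apply: emeasurable_funM => //; apply/measurable_EFinP.
  by apply: measurable_funV; exact: measurable_gpdf.
- by move=> t; rewrite mule_ge0// lee_fin invr_ge0 ltW ?gpdf_gt0.
Qed.

Lemma lebesgue_scale (s : R) (f : R -> \bar R) : 0 < s -> measurable_fun [set: R] f ->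
  (forall x, 0 <= f x)%E ->
  (\int[@lebesgue_measure R]_(t in [set: R]) f t =
   s%:E * \int[@lebesgue_measure R]_(t in [set: R]) f (s * t)%R)%E.
Proof.
move=> s0 mf f0.
pose ms : measurableTypeR R -> measurableTypeR R := fun t => s * t.
have mms : measurable_fun [set: measurableTypeR R] ms.
  exact: (@mulrl_measurable R [set: R] s).
pose pm : {measure set (measurableTypeR R) -> \bar R} := pushforward (@lebesgue_measure R) ms.
(* The image of Lebesgue measure under [t -> s t], multiplied by [s]; it agrees with Lebesgue
   measure on half-open intervals, hence on all Borel sets. *)
pose nu := mscale (NngNum (ltW s0)) (pm mms).
have nuE X : measurable X -> lebesgue_measure X = nu X.
  move=> mX; apply: lebesgue_measure_unique => // _ [[a b]] _ <-.
  have pre : ms @^-1` `]a, b]%classic = `]s^-1 * a, s^-1 * b]%classic.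
    apply/seteqP; split => t /=; rewrite !in_itv /= /ms.
      by rewrite ltr_pdivrMl// ler_pdivlMl.
    by rewrite ltr_pdivrMl// ler_pdivlMl.
  transitivity (s%:E * lebesgue_measure (`](s^-1 * a)%R, (s^-1 * b)%R]%classic : set R))%E; last by rewrite -pre.
  rewrite !lebesgue_measure_itv /= !lte_fin ltr_pM2l ?invr_gt0//.
  by case: ifP => _; rewrite ?mule0// -EFinB -EFinM -mulrBr mulVKf ?gt_eqF.
rewrite (eq_measure_integral nu) => [|A mA _]; last exact: nuE.
rewrite ge0_integral_mscale//= ge0_integral_pushforward//.
Qed.

(** The reciprocal of the n-dimensional Gaussian density. *)
Fixpoint gweight n : n.-tuple R -> R := 
  match n with
  | 0 => fun=> 1
  | n'.+1 => fun x => (gpdf (thead x))^-1 * gweight [tuple of behead x]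
  end.
Arguments gweight : clear implicits.

Lemma gweight_gt0 n x : 0 < gweight n x.
Proof.
elim: n x => [|n IH] x //=; by rewrite mulr_gt0// invr_gt0 gpdf_gt0.
Qed.

Lemma measurable_gweight n : measurable_fun [set: n.-tuple R] (gweight n).
Proof.
elim: n => [|n IH]; first exact: measurable_cst.
apply: measurable_funM => /=.
  apply: measurable_funV.
  by apply: measurableT_comp; [exact: measurable_gpdf|exact: measurable_tnth].
by apply: measurableT_comp => //; exact: measurable_behead.
Qed.

Let measurable_cons_tuple n (t : R) : measurable_fun [set: n.-tuple R] (fun v => cons_tuple t v).
Proof. exact: measurable_cons. Qed.

Let measurable_consF n d (U : measurableType d) (F : n.+1.-tuple R -> U) :
  measurable_fun [set: n.+1.-tuple R] F ->
  forall t, measurable_fun [set: n.-tuple R] (fun v => F (cons_tuple t v)).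
Proof. by move=> mF t; exact: (measurableT_comp mF (measurable_cons_tuple t)). Qed.

Let measurable_integral_cons n (F : n.+1.-tuple R -> \bar R) :
  measurable_fun [set: n.+1.-tuple R] F -> (forall x, 0 <= F x)%E ->
  measurable_fun [set: R] (fun t => \int[gaussn n]_v ((gweight n v)%:E * F (cons_tuple t v)))%E.
Proof.
move=> mF F0.
apply: (@measurable_fun_fubini_tonelli_F _ _ _ _ _ (gaussn n)
    (fun p => ((gweight n p.2)%:E * F (cons2 p))%E)).
  apply: emeasurable_funM.
    by apply/measurable_EFinP; apply: measurableT_comp => //; exact: measurable_gweight.
  exact: measurableT_comp.
by move=> x; rewrite mule_ge0// lee_fin ltW ?gweight_gt0.
Qed.

(** Through this formula the iterated integral behind [sphere_int] gets the measurability and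
    Tonelli properties of [gaussn]. *)
Lemma iintE n (F : n.-tuple R -> \bar R) : measurable_fun [set: n.-tuple R] F ->
  (forall x, 0 <= F x)%E -> iint F = (\int[gaussn n]_x ((gweight n x)%:E * F x))%E.
Proof.
elim: n F => [|n IH] F mF F0.
  rewrite /= integral_dirac// ?diracE ?in_setT ?mul1e//.
  exact: measurable_funeM.
rewrite ge0_integral_gaussnS; last 2 first.
- by apply: emeasurable_funM => //; apply/measurable_EFinP; exact: measurable_gweight.
- by move=> x; rewrite mule_ge0// lee_fin ltW ?gweight_gt0.
have mFc t : measurable_fun [set: n.-tuple R] (fun v => F (cons_tuple t v)).
  exact: measurable_consF.
rewrite /=.
under eq_integral do rewrite IH//.
rewrite lebesgue_gauss1; last 2 first.
- exact: measurable_integral_cons.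
- by move=> t; apply: integral_ge0 => v _; rewrite mule_ge0// lee_fin ltW ?gweight_gt0.
apply: eq_integral => t _; rewrite -ge0_integralZl//; last 3 first.
- by apply: emeasurable_funM => //; apply/measurable_EFinP; exact: measurable_gweight.
- by move=> x; rewrite mule_ge0// lee_fin ltW ?gweight_gt0.
- by rewrite lee_fin invr_ge0 ltW ?gpdf_gt0.
apply: eq_integral => v _; rewrite EFinM -muleA theadE.
by congr (_ * (_%:E * _))%E; congr gweight; exact: val_inj.
Qed.

Lemma measurable_iint_cons n (F : n.+1.-tuple R -> \bar R) :
  measurable_fun [set: n.+1.-tuple R] F -> (forall x, 0 <= F x)%E ->
  measurable_fun [set: R] (fun t => iint (fun v => F (cons_tuple t v))).
Proof.
move=> mF F0.
rewrite (_ : (fun t => _) = (fun t => \int[gaussn n]_v ((gweight n v)%:E * F (cons_tuple t v)))%E).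
  exact: measurable_integral_cons.
by apply/funext => t; rewrite iintE//; exact: measurable_consF.
Qed.

Lemma measurable_scalet n (s : R) : measurable_fun [set: n.-tuple R] (@scalet R n s).
Proof.
apply/measurable_fun_tnthP => i.
rewrite (_ : _ \o _ = fun x => s * tnth x i); last by apply/funext => x /=; rewrite tnth_map.
by apply: measurable_funM => //; exact: measurable_tnth.
Qed.

Lemma iint_scale n (s : R) (F : n.-tuple R -> \bar R) : 0 < s ->
  measurable_fun [set: n.-tuple R] F -> (forall x, 0 <= F x)%E ->
  iint F = ((s ^+ n)%:E * iint (fun x => F (scalet s x)))%E.
Proof.
move=> s0; elim: n F => [|n IH] F mF F0.
  by rewrite /= mul1e; congr F; exact: val_inj.
rewrite /= (lebesgue_scale s0)//; last 2 first.
- exact: measurable_iint_cons.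
- move=> t; rewrite iintE//; last exact: measurable_consF.
  by apply: integral_ge0 => v _; rewrite mule_ge0// lee_fin ltW ?gweight_gt0.
rewrite exprS EFinM -muleA; congr (_ * _)%E.
rewrite -ge0_integralZl//; last 3 first.
- apply: (@measurable_iint_cons _ (fun x => F (scalet s x))) => //.
  by apply: measurableT_comp => //; exact: measurable_scalet.
- move=> t _; rewrite iintE//.
    by apply: integral_ge0 => v _; rewrite mule_ge0// lee_fin ltW ?gweight_gt0.
  apply: (measurableT_comp mF); apply: (measurableT_comp (@measurable_scalet _ s)).
  exact: measurable_cons_tuple.
- by rewrite lee_fin exprn_ge0// ltW.
apply: eq_integral => t _; rewrite IH//; last exact: measurable_consF.
by congr (_ * iint _)%E; apply/funext => v; congr F; exact: val_inj.
Qed.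

End gauss1.

(** * Radial Gaussian integrals *)

Section radial.
Variable R : realType.
Local Notation leb := (@lebesgue_measure R).

Lemma measurable_bool_nat d (T : measurableType d) (D : set T) (f : T -> bool) : 
  measurable_fun D f -> measurable_fun D (fun x => (f x)%:R : R).
Proof.
move=> mf mD; move: (mD).
apply: (@measurable_comp _ _ _ _ _ _ setT (fun b : bool => b%:R : R)) => //.
Qed.

Lemma measurable_lebesgue_integral d (T : measurableType d) (H : T * R -> \bar R) :
  measurable_fun [set: T * R] H -> (forall p, 0 <= H p)%E ->
  measurable_fun [set: T] (fun x => \int[leb]_(s in [set: R]) H (x, s))%E.
Proof.
move=> mH H0.
rewrite (_ : (fun x => _) = (fun x => \int[@gauss1 R]_s (((gpdf s)^-1)%:E * H (x, s)))%E); last first.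
  by apply/funext => x; rewrite lebesgue_gauss1//; exact: measurableT_comp.
apply: (@measurable_fun_fubini_tonelli_F _ _ _ _ _ (@gauss1 R) (fun p => (((gpdf p.2)^-1)%:E * H p)%E)).
  apply: emeasurable_funM => //; apply/measurable_EFinP; apply: measurable_funV.
  by apply: measurableT_comp => //; exact: measurable_gpdf.
by move=> x; rewrite mule_ge0// lee_fin invr_ge0 ltW ?gpdf_gt0.
Qed.

(** The weight [(gpdf s)^-1] reduces the exchange to Tonelli for a product of two probabilities. *)
Lemma lebesgue_tonelli d (T : measurableType d) (P : probability T R) (H : T * R -> \bar R) :
  measurable_fun [set: T * R] H -> (forall p, 0 <= H p)%E ->
  (\int[P]_x \int[leb]_(s in [set: R]) H (x, s) = \int[leb]_(s in [set: R]) \int[P]_x H (x, s))%E.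
Proof.
move=> mH H0.
have mHx x : measurable_fun [set: R] (fun s => H (x, s)) by exact: measurableT_comp.
under eq_integral do rewrite lebesgue_gauss1//.
rewrite lebesgue_gauss1; last 2 first.
- exact: measurable_fun_fubini_tonelli_G.
- by move=> s; exact: integral_ge0.
rewrite (@fubini_tonelli _ _ _ _ _ P (@gauss1 R) (fun p => (((gpdf p.2)^-1)%:E * H p)%E)); last 2 first.
- apply: emeasurable_funM => //; apply/measurable_EFinP; apply: measurable_funV.
  by apply: measurableT_comp => //; exact: measurable_gpdf.
- by move=> x; rewrite mule_ge0// lee_fin invr_ge0 ltW ?gpdf_gt0.
apply: eq_integral => s _ /=; rewrite ge0_integralZl//.
- exact: measurableT_comp.
- by rewrite lee_fin invr_ge0 ltW ?gpdf_gt0.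
Qed.

Lemma lebesgue_tonelli2 (H : R * R -> \bar R) :
  measurable_fun [set: R * R] H -> (forall p, 0 <= H p)%E ->
  (\int[leb]_(r in [set: R]) \int[leb]_(s in [set: R]) H (r, s) =
   \int[leb]_(s in [set: R]) \int[leb]_(r in [set: R]) H (r, s))%E.
Proof.
move=> mH H0.
have mHx x : measurable_fun [set: R] (fun s => H (x, s)) by exact: measurableT_comp.
have mHy y : measurable_fun [set: R] (fun s => H (s, y)) by exact: measurableT_comp.
rewrite lebesgue_gauss1; last 2 first.
- exact: measurable_lebesgue_integral.
- by move=> r; exact: integral_ge0.
have g0 x : (0 <= ((gpdf x)^-1)%:E :> \bar R)%E by rewrite lee_fin invr_ge0 ltW ?gpdf_gt0.
transitivity (\int[@gauss1 R]_r \int[leb]_(s in [set: R]) (((gpdf r)^-1)%:E * H (r, s)))%E.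
  by apply: eq_integral => r _; rewrite ge0_integralZl//; exact: mHx.
rewrite (@lebesgue_tonelli _ _ (@gauss1 R) (fun p => (((gpdf p.1)^-1)%:E * H p)%E)); last 2 first.
- apply: emeasurable_funM => //; apply/measurable_EFinP; apply: measurable_funV.
  by apply: measurableT_comp => //; exact: measurable_gpdf.
- by move=> x; rewrite mule_ge0.
by apply: eq_integral => s _; rewrite lebesgue_gauss1.
Qed.

Definition gexp (s : R) : R := expR (- (s ^+ 2 / 2)).

Lemma gexp_gt0 s : 0 < gexp s. Proof. exact: expR_gt0. Qed.

Lemma is_derive_gexp (s : R) : is_derive s 1 gexp (- s * gexp s).
Proof.
pose p : {poly R} := - (2^-1 *: 'X^2).
have -> : gexp = expR \o horner p.
  by apply/funext => x; rewrite /= /gexp /p hornerN hornerZ hornerXn mulrC.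
have -> : - s * (expR \o horner p) s = (expR (p.[s])) * p^`().[s].
  have -> : p^`().[s] = - s.
    rewrite /p derivN derivZ derivXn /= expr1 hornerN hornerZ hornerMn hornerX -mulr_natr.
    by field.
  by rewrite mulrC.
exact: is_derive1_comp.
Qed.

Lemma continuous_gexp : continuous gexp.
Proof.
move=> s; apply: differentiable_continuous; apply/derivable1_diffP.
by have [] := is_derive_gexp s.
Qed.

Lemma measurable_gexp : measurable_fun [set: R] gexp.
Proof. exact: continuous_measurable_fun continuous_gexp. Qed.

Lemma cvg_gexp : gexp x @[x --> +oo%R] --> (0 : R).
Proof.
apply: (cvg_comp (fun x => x ^+ 2 / 2) (fun x => expR (- x))); last exact: cvgr_expR.
apply/cvgryPge => A; near=> s.
have s2 : 2 <= s by near: s; exact: nbhs_pinfty_ge.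
have sA : A <= s by near: s; apply: nbhs_pinfty_ge; exact: num_real.
nra.
Unshelve. all: by end_near.
Qed.

Definition gtint n (a s : R) : R := (a <= s)%R%:R * (s ^+ n * gexp s).
(** The upper incomplete Gaussian moment. Taken at [a = |x|] it can be integrated over [x] by
    exchanging the radius with the variable [s]. *)
Definition gtail (n : nat) (a : R) : \bar R :=
  (\int[leb]_(s in [set: R]) (gtint n a s)%:E)%E.

Lemma lebesgue_itvy (f : R -> R) (a : R) :
  (\int[leb]_(s in [set: R]) ((a <= s)%R%:R * f s)%R%:E = \int[leb]_(s in `[a, +oo[) (f s)%:E)%E.
Proof.
rewrite [RHS]integral_mkcond; apply: eq_integral => s _; rewrite patchE.
have -> : (s \in `[a, +oo[%classic) = (a <= s).
  by apply/idP/idP; rewrite inE /= in_itv /= andbT.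
by case: ifP => _; rewrite ?mul1r ?mul0r.
Qed.

Lemma gtail1 (a : R) : 0 <= a -> gtail 1 a = (gexp a)%:E.
Proof.
move=> a0; rewrite /gtail /gtint lebesgue_itvy.
rewrite (@ge0_continuous_FTC2y R _ (fun s => - gexp s) a 0).
- by rewrite sub0e EFinN oppeK.
- by move=> x ax; rewrite mulr_ge0 ?(ltW (gexp_gt0 _))// expr1 (le_trans a0).
- apply: continuous_subspaceT => s; apply: cvgM; last exact: continuous_gexp.
  exact: exprn_continuous.
- by rewrite -oppr0; apply: cvgN; exact: cvg_gexp.
- by move=> x _; apply: derivableN; have [] := is_derive_gexp x.
- by apply: cvgN; apply: cvg_at_right_filter; exact: continuous_gexp.
- move=> x _; have := is_derive_gexp x => -[dx e].
  by rewrite derive1E deriveN// e mulNr opprK expr1.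
Qed.

Lemma lebesgue_itv_pow n (a b : R) : 0 <= a -> a <= b ->
  (\int[leb]_(r in [set: R]) (((a <= r) && (r <= b))%R%:R * (n.+1%:R * r ^+ n))%R%:E =
   (b ^+ n.+1 - a ^+ n.+1)%R%:E)%E.
Proof.
move=> a0 ab.
transitivity (\int[leb]_(r in `[a, b]) (n.+1%:R * r ^+ n)%R%:E)%E.
  rewrite [RHS]integral_mkcond; apply: eq_integral => s _; rewrite patchE.
  have -> : (s \in `[a, b]%classic) = (a <= s <= b).
    by apply/idP/idP; rewrite inE /= in_itv.
  by case: ifP => _; rewrite ?mul1r ?mul0r.
move: ab; rewrite le_eqVlt => /predU1P[<-|ab].
  by rewrite set_itv1 integral_set1 subrr.
have dX (x : R) : is_derive x (1 : R) (fun r : R => r ^+ n.+1) (n.+1%:R * x ^+ n).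
  have := @is_derive_poly R 'X^(n.+1) x; rewrite derivXn hornerMn hornerXn -mulr_natl.
  by congr (is_derive _ _ _ _); apply/funext => y; rewrite hornerXn.
rewrite (@continuous_FTC2 R _ (fun r => r ^+ n.+1))//.
- apply: continuous_subspaceT => s; apply: cvgM; first exact: cvg_cst.
  exact: exprn_continuous.
- split; first by move=> x _; have [] := dX x.
    by apply: cvg_at_right_filter; exact: exprn_continuous.
  by apply: cvg_at_left_filter; exact: exprn_continuous.
- by move=> x _; have [dx e] := dX x; rewrite derive1E.
Qed.

Lemma measurable_gtail_fun n (a : R) : measurable_fun [set: R] (gtint n a).
Proof.
apply: measurable_funM; first by apply: measurable_bool_nat; exact: measurable_fun_ler.
by apply: measurable_funM; [exact: measurable_funX|exact: measurable_gexp].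
Qed.

Lemma gtail_fun_ge0 n (a s : R) : 0 <= a -> 0 <= gtint n a s.
Proof.
rewrite /gtint => a0; have [as_|] := leP a s; last by rewrite mul0r.
by rewrite mul1r mulr_ge0 ?(ltW (gexp_gt0 _))// exprn_ge0// (le_trans a0).
Qed.

(** Integration by parts carried out by Tonelli: [s^(n+1)] is [a^(n+1)] plus the integral of
    [(n+1) r^n] over [a <= r <= s], and the integrals in [r] and [s] are exchanged. All terms are
    nonnegative, so infinite values do no harm. *)
Lemma gtailS n (a : R) : 0 <= a ->
  gtail n.+2 a = ((a ^+ n.+1 * gexp a)%R%:E + n.+1%:R%:E * gtail n a)%E.
Proof.
move=> a0.
pose k (s r : R) : R := ((a <= r) && (r <= s))%R%:R * (n.+1%:R * r ^+ n).
have k0 s r : 0 <= k s r.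
  rewrite /k; case: (boolP (a <= r)) => ar; last by rewrite mul0r.
  by rewrite !mulr_ge0// exprn_ge0// (le_trans a0).
have mk : measurable_fun [set: R * R] (fun p => k p.1 p.2).
  apply: measurable_funM.
    apply: measurable_bool_nat; apply: measurable_and; exact: measurable_fun_ler.
  by apply: measurable_funM => //; exact: measurable_funX.
have mks s : measurable_fun [set: R] (k s).
  apply: measurable_funM.
    apply: measurable_bool_nat; apply: measurable_and; exact: measurable_fun_ler.
  by apply: measurable_funM => //; exact: measurable_funX.
transitivity (\int[leb]_(s in [set: R]) ((a ^+ n.+1)%R%:E * (gtint 1 a s)%:E +
   \int[leb]_(r in [set: R]) ((k s r)%:E * (gtint 1 a s)%:E)))%E.
  apply: eq_integral => s _; rewrite /gtint; have [as_|sa] := leP a s; last first.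
    rewrite !mul0r mule0 add0e integral0_eq// => r _; by rewrite mule0.
  rewrite !mul1r ge0_integralZr//; last 3 first.
  - by apply/measurable_EFinP; exact: mks.
  - by move=> r _; rewrite lee_fin.
  - by rewrite lee_fin mulr_ge0 ?(ltW (gexp_gt0 _))// expr1 (le_trans a0).
  by rewrite lebesgue_itv_pow// -!EFinM -EFinD; congr (_%:E); rewrite expr1 exprS; ring.
have mg m : measurable_fun [set: R] (fun s : R => (gtint m a s)%:E).
  by apply/measurable_EFinP; exact: measurable_gtail_fun.
pose H (p : R * R) : \bar R := ((k p.1 p.2)%:E * (gtint 1 a p.1)%:E)%E.
have mH : measurable_fun [set: R * R] H.
  by apply: emeasurable_funM; [exact/measurable_EFinP|exact: measurableT_comp (mg 1%N) _].
have H0 p : (0 <= H p)%E by rewrite mule_ge0// lee_fin// gtail_fun_ge0.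
rewrite ge0_integralD//; last 4 first.
- by move=> s _; rewrite mule_ge0// lee_fin ?exprn_ge0// gtail_fun_ge0.
- by apply: emeasurable_funM => //; exact: mg.
- by move=> s _; apply: integral_ge0 => r _; exact: (H0 (s, r)).
- exact: (@measurable_lebesgue_integral _ _ H).
rewrite ge0_integralZl//; last 3 first.
- exact: mg.
- by move=> s _; rewrite lee_fin gtail_fun_ge0.
- by rewrite lee_fin exprn_ge0.
rewrite -/(gtail 1 a) gtail1// -EFinM; congr (_ + _)%E.
rewrite (lebesgue_tonelli2 mH H0).
rewrite /gtail -ge0_integralZl//; last 2 first.
- exact: mg.
- by move=> s _; rewrite lee_fin gtail_fun_ge0.
apply: eq_integral => r _; rewrite [gtint n a r]/gtint.
have [ar|ra] := leP a r; last first.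
  rewrite mul0r mule0 integral0_eq// => s _.
  by rewrite /H /k /= leNgt ra /= !mul0r mul0e.
transitivity ((n.+1%:R * r ^+ n)%R%:E * gtail 1 r)%E.
  rewrite /gtail -ge0_integralZl//; last 3 first.
  - by apply/measurable_EFinP; exact: measurable_gtail_fun.
  - by move=> s _; rewrite lee_fin gtail_fun_ge0// (le_trans a0).
  - by rewrite lee_fin mulr_ge0// exprn_ge0// (le_trans a0).
  apply: eq_integral => s _; rewrite /H /k /gtint /= ar /=.
  have [rs|_] := leP r s; last by rewrite !mul0r mul0e mule0.
  by rewrite (le_trans ar rs) !mul1r.
rewrite gtail1 ?(le_trans a0)// mul1r -!EFinM mulrA//.
Qed.

End radial.

Section euclid.
Variable R : realType.

Lemma dotp_cons n (t s : R) (v w : n.-tuple R) :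
  dotp (cons_tuple t v) (cons_tuple s w) = t * s + dotp v w.
Proof.
by rewrite /dotp big_ord_recl !tnth0; congr (_ + _); apply: eq_bigr => i _; rewrite !tnthS.
Qed.

Lemma dotpC n (x y : n.-tuple R) : dotp x y = dotp y x.
Proof. by apply: eq_bigr => i _; rewrite mulrC. Qed.

Lemma dotpZl n (s : R) (x y : n.-tuple R) : dotp (scalet s x) y = s * dotp x y.
Proof. by rewrite /dotp mulr_sumr; apply: eq_bigr => i _; rewrite tnth_map mulrA. Qed.

Lemma dotpZr n (s : R) (x y : n.-tuple R) : dotp x (scalet s y) = s * dotp x y.
Proof. by rewrite dotpC dotpZl dotpC. Qed.

Lemma dotp_ge0 n (x : n.-tuple R) : 0 <= dotp x x.
Proof. by apply: sumr_ge0 => i _; rewrite -expr2 sqr_ge0. Qed.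

Lemma enorm_ge0 n (x : n.-tuple R) : 0 <= enorm x.
Proof. exact: sqrtr_ge0. Qed.

Lemma enorm_sqr n (x : n.-tuple R) : enorm x ^+ 2 = dotp x x.
Proof. by rewrite sqr_sqrtr// dotp_ge0. Qed.

Lemma enormZ n (s : R) (x : n.-tuple R) : 0 <= s -> enorm (scalet s x) = s * enorm x.
Proof.
move=> s0; rewrite /enorm dotpZl dotpZr mulrA -expr2 sqrtrM ?sqr_ge0// sqrtr_sqr.
by rewrite ger0_norm.
Qed.

Lemma sphere_dotp n (x : n.-tuple R) : sphere x -> dotp x x = 1.
Proof. by move=> sx; rewrite -enorm_sqr sx expr1n. Qed.

(** Both bounds come from the nonnegativity of the squared lengths of [x - y] and [x + y]. *)
Lemma dotp_le1 n (x y : n.-tuple R) : sphere x -> sphere y -> -1 <= dotp x y <= 1.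
Proof.
move=> /sphere_dotp sx /sphere_dotp sy.
have h1 : \sum_(i < n) (tnth x i - tnth y i) ^+ 2 = 2 - 2 * dotp x y.
  rewrite (eq_bigr (fun i => (tnth x i * tnth x i + tnth y i * tnth y i) - 2 * (tnth x i * tnth y i))).
    by rewrite sumrB big_split /= -mulr_sumr -/(dotp x x) -/(dotp y y) sx sy.
  by move=> i _; ring.
have h2 : \sum_(i < n) (tnth x i + tnth y i) ^+ 2 = 2 + 2 * dotp x y.
  rewrite (eq_bigr (fun i => (tnth x i * tnth x i + tnth y i * tnth y i) + 2 * (tnth x i * tnth y i))).
    by rewrite !big_split /= -mulr_sumr -/(dotp x x) -/(dotp y y) sx sy.
  by move=> i _; ring.
have : 0 <= \sum_(i < n) (tnth x i - tnth y i) ^+ 2 by apply: sumr_ge0 => i _; exact: sqr_ge0.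
have : 0 <= \sum_(i < n) (tnth x i + tnth y i) ^+ 2 by apply: sumr_ge0 => i _; exact: sqr_ge0.
rewrite h1 h2; lra.
Qed.

Lemma measurable_dotp2 d (T : measurableType d) n (f g : T -> n.-tuple R) (D : set T) :
  measurable_fun D f -> measurable_fun D g -> measurable_fun D (fun x => dotp (f x) (g x)).
Proof.
move=> mf mg; apply: measurable_sum => i; apply: measurable_funM.
  exact: (measurableT_comp (measurable_tnth i) mf).
exact: (measurableT_comp (measurable_tnth i) mg).
Qed.

Lemma measurable_dotp n (x : n.-tuple R) D : measurable_fun D (dotp x).
Proof. exact: measurable_dotp2. Qed.

Lemma measurable_sqrt (D : set R) : measurable_fun D (@Num.sqrt R).
Proof.
apply: measurable_funTS.
have -> : @Num.sqrt R = (fun x => if 0 <= x then powR x 2^-1 else 0).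
  apply/funext => x; case: ifPn => [x0|]; first by rewrite powR12_sqrt.
  by rewrite -ltNge => x0; rewrite ler0_sqrtr// ltW.
by apply: measurable_fun_ifT => //; exact: measurable_fun_ler.
Qed.

Lemma measurable_enorm n D : measurable_fun D (@enorm R n).
Proof.
by apply: (measurableT_comp (@measurable_sqrt setT)); exact: measurable_dotp2.
Qed.

Lemma measurable_enorm0 n : measurable [set x : n.-tuple R | enorm x = 0].
Proof.
have := @measurable_enorm n setT measurableT [set 0] (measurable_set1 _).
by rewrite setTI.
Qed.

Lemma measurable_tnth0 n : measurable [set x : n.+1.-tuple R | tnth x ord0 = 0].
Proof.
have := @measurable_tnth _ R n.+1 ord0 measurableT [set 0] (measurable_set1 _).
by rewrite setTI.
Qed.

Lemma measurable_sphere n : measurable (@sphere R n).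
Proof.
have := @measurable_enorm n setT measurableT [set 1] (measurable_set1 _).
by rewrite setTI.
Qed.

(** The product of the coordinate densities is a function of the norm alone. *)
Lemma gweightE n (x : n.-tuple R) :
  gweight x * (normal_peak (1 : R) ^+ n * gexp (enorm x)) = 1.
Proof.
rewrite /gexp enorm_sqr.
elim: n x => [|n IH] x.
  by rewrite /= /dotp big_ord0 mul0r oppr0 expR0 !mul1r.
have -> : x = cons_tuple (thead x) [tuple of behead x].
  by rewrite {1}(tuple_eta x); exact: val_inj.
rewrite dotp_cons mulrDl opprD expRD /= theadE.
rewrite [X in gweight X](_ : _ = [tuple of behead x]); last exact: val_inj.
have := IH [tuple of behead x]; set g := gweight _ => {}IH.
rewrite -[RHS](mulr1 1) -[X in _ = X * _]IH /gpdf [_ ^+ n.+1]exprS -expr2.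
have p0 : normal_peak (1:R) != 0 by rewrite gt_eqF// normal_peak_gt0// oner_neq0.
have e0 : expR (- (thead x ^+ 2 / 2)) != 0 by rewrite gt_eqF// expR_gt0.
by field; rewrite p0 e0.
Qed.

End euclid.

(** * Polar coordinates for functions homogeneous of degree 0 *)

Section polar.
Variables (R : realType) (d : nat).
Hypothesis d0 : (0 < d)%N.
Local Notation T := (d.-tuple R).
Local Notation leb := (@lebesgue_measure R).

Variable F : T -> \bar R.
Hypothesis mF : measurable_fun [set: T] F.
Hypothesis F0 : forall x, (0 <= F x)%E.
Hypothesis FZ : forall s x, 0 < s -> F (scalet s x) = F x.

(** For [s = 1] and [F] a function of the direction, this is the integrand of [sphere_int]; the
    origin has no direction and is left out. *)
Definition rcut (s : R) (x : T) : \bar R := if (0 < enorm x) && (enorm x <= s) then F x else 0%E.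

Lemma measurable_rcut s : measurable_fun [set: T] (rcut s).
Proof.
apply: measurable_fun_ifT => //; apply: measurable_and.
  by apply: measurable_fun_ltr => //; exact: measurable_enorm.
by apply: measurable_fun_ler => //; exact: measurable_enorm.
Qed.

Lemma rcut_ge0 s x : (0 <= rcut s x)%E.
Proof. by rewrite /rcut; case: ifP. Qed.

Lemma iint_rcut s : 0 < s -> iint (rcut s) = ((s ^+ d)%:E * iint (rcut 1))%E.
Proof.
move=> s0; rewrite (iint_scale s0 (measurable_rcut s) (rcut_ge0 s)).
congr (_ * iint _)%E; apply/funext => x; rewrite /rcut enormZ ?(ltW s0)// FZ//.
by rewrite pmulr_rgt0// -{2}(mulr1 s) ler_pM2l.
Qed.

Definition rpos (x : T) : \bar R := if 0 < enorm x then F x else 0%E.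

Lemma measurable_rpos : measurable_fun [set: T] rpos.
Proof.
by apply: measurable_fun_ifT => //; apply: measurable_fun_ltr => //; exact: measurable_enorm.
Qed.

Lemma rpos_ge0 x : (0 <= rpos x)%E.
Proof. by rewrite /rpos; case: ifP. Qed.

Lemma measurable_gtint n : measurable_fun [set: T * R] (fun p => gtint n (enorm p.1) p.2).
Proof.
apply: measurable_funM.
  apply: measurable_bool_nat; apply: measurable_fun_ler => //.
  by apply: (measurableT_comp (@measurable_enorm R d setT)).
apply: measurable_funM; first exact: measurable_funX.
by apply: measurableT_comp => //; exact: measurable_gexp.
Qed.

Lemma measurable_gtail n : measurable_fun [set: T] (fun x => gtail n (enorm x)).
Proof.
apply: (@measurable_lebesgue_integral R _ T (fun p => (gtint n (enorm p.1) p.2)%:E)).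
  by apply/measurable_EFinP; exact: measurable_gtint.
by move=> p; rewrite lee_fin gtail_fun_ge0// enorm_ge0.
Qed.

Lemma gtail_ge0 n (a : R) : 0 <= a -> (0 <= gtail n a)%E.
Proof. by move=> a0; apply: integral_ge0 => s _; rewrite lee_fin gtail_fun_ge0. Qed.

(* Layer-cake: gtail n |x| is the integral over s >= |x|; exchange the two integrals and rescale. *)
Lemma iint_gtail n :
  iint (fun x => (rpos x * gtail n (enorm x))%E) = (gtail (n + d) 0 * iint (rcut 1))%E.
Proof.
rewrite iintE; last 2 first.
- by apply: emeasurable_funM; [exact: measurable_rpos|exact: measurable_gtail].
- by move=> x; rewrite mule_ge0 ?rpos_ge0// gtail_ge0// enorm_ge0.
pose H (p : T * R) : \bar R :=
  ((gweight p.1)%:E * rpos p.1 * (gtint n (enorm p.1) p.2)%:E)%E.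
have mH : measurable_fun [set: T * R] H.
  apply: emeasurable_funM; last by apply/measurable_EFinP; exact: measurable_gtint.
  apply: emeasurable_funM.
    by apply/measurable_EFinP; apply: measurableT_comp => //; exact: measurable_gweight.
  by apply: measurableT_comp => //; exact: measurable_rpos.
have w0 x : (0 <= (gweight x)%:E * rpos x)%E.
  by rewrite mule_ge0 ?rpos_ge0// lee_fin ltW ?gweight_gt0.
have H0 p : (0 <= H p)%E.
  by rewrite mule_ge0// lee_fin gtail_fun_ge0// enorm_ge0.
transitivity (\int[gaussn R d]_x \int[leb]_(s in [set: R]) H (x, s))%E.
  apply: eq_integral => x _; rewrite muleA /gtail -ge0_integralZl//.
    by apply/measurable_EFinP; exact: measurable_gtail_fun.
  by move=> s _; rewrite lee_fin gtail_fun_ge0// enorm_ge0.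
rewrite lebesgue_tonelli// /gtail -ge0_integralZr//; last 3 first.
- by apply/measurable_EFinP; exact: measurable_gtail_fun.
- by move=> s _; rewrite lee_fin gtail_fun_ge0.
- rewrite iintE; [|exact: measurable_rcut|exact: rcut_ge0].
  by apply: integral_ge0 => x _; rewrite mule_ge0 ?rcut_ge0// lee_fin ltW ?gweight_gt0.
apply: eq_integral => s _; have [s0|s0] := leP s 0.
  rewrite (_ : gtint (n + d) 0 s = 0) ?mul0e; last first.
    rewrite /gtint; move: s0; rewrite le_eqVlt => /predU1P[->|s0].
      by rewrite expr0n addn_eq0 (gtn_eqF d0) andbF mul0r mulr0.
    by rewrite leNgt s0 mul0r.
  apply: integral0_eq => x _; rewrite /H /rpos /gtint /=; case: ifPn => [x0|_].
    by rewrite leNgt (le_lt_trans s0 x0) mul0r mule0.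
  by rewrite mule0 mul0e.
transitivity ((s ^+ n * gexp s)%:E * iint (rcut s))%E; last first.
  rewrite iint_rcut// muleA -EFinM /gtint (ltW s0) mul1r exprD.
  by congr (_%:E * _)%E; ring.
rewrite iintE; [|exact: measurable_rcut|exact: rcut_ge0].
rewrite -ge0_integralZl//; last 3 first.
- apply: emeasurable_funM; last exact: measurable_rcut.
  by apply/measurable_EFinP; exact: measurable_gweight.
- by move=> x _; rewrite mule_ge0 ?rcut_ge0// lee_fin ltW ?gweight_gt0.
- by rewrite lee_fin mulr_ge0 ?(ltW (gexp_gt0 _))// exprn_ge0// ltW.
apply: eq_integral => x _; rewrite /H /rpos /rcut /gtint /=.
case: (0 < enorm x) => /=; last by rewrite !mule0 mul0e.
case: (enorm x <= s); last by rewrite !mul0r !mule0.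
by rewrite mul1r muleC.
Qed.

(* Closed form of the integral of s^m exp(-s^2/2) over s >= 0. *)
Fixpoint gmom (m : nat) : R :=
  match m with
  | 0 => Num.sqrt (pi / 2)
  | 1 => 1
  | m'.+2 => m'.+1%:R * gmom m'
  end.

Lemma nat_ind2 (P : nat -> Prop) : P 0%N -> P 1%N -> (forall n, P n -> P n.+2) -> forall n, P n.
Proof. by move=> P0 P1 PS n; have [] : P n /\ P n.+1; elim: n => // n [] *; split => //; exact: PS. Qed.

Lemma gmom_gt0 m : 0 < gmom m.
Proof.
elim/nat_ind2: m => [||m IH] /=; rewrite ?ltr01//; first by rewrite sqrtr_gt0 divr_gt0// pi_gt0.
by rewrite mulr_gt0// ltr0n.
Qed.

Lemma gtail00 : gtail 0 0 = (Num.sqrt (pi / 2 : R))%:E.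
Proof.
have s2 : 0 < Num.sqrt 2 :> R by rewrite sqrtr_gt0.
(* The substitution [s -> sqrt 2 s] turns exp(-s^2/2) into the exp(-s^2) of [gauss_fun]. *)
rewrite /gtail (lebesgue_scale s2)//; last 2 first.
- by apply/measurable_EFinP; exact: measurable_gtail_fun.
- by move=> s; rewrite lee_fin gtail_fun_ge0.
transitivity ((Num.sqrt (2 : R))%:E * (\int[leb]_(s in `[0%R, +oo[) (gauss_fun s)%:E))%E.
  rewrite -lebesgue_itvy; congr (_ * _)%E; apply: eq_integral => s _.
  rewrite /gtint expr0 mul1r pmulr_rge0// /gexp /gauss_fun exprMn sqr_sqrtr//.
  by rewrite mulrAC divff ?mul1r.
rewrite integral0y_gauss -EFinM sqrtrM ?pi_ge0// sqrtrV//; congr (_%:E).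
rewrite -{2}(sqr_sqrtr (ler0n R 2)); field.
by rewrite gt_eqF.
Qed.

Lemma gtail0 m : gtail m 0 = (gmom m)%:E.
Proof.
elim/nat_ind2: m => [||m IH]; first exact: gtail00.
  by rewrite gtail1// /gexp expr0n /= mul0r oppr0 expR0.
by rewrite gtailS// IH expr0n mul0r add0e.
Qed.

Let gexp_rad_ge0 n (x : T) : 0 <= enorm x ^+ n * gexp (enorm x).
Proof. by rewrite mulr_ge0 ?(ltW (gexp_gt0 _))// exprn_ge0// enorm_ge0. Qed.

Let measurable_gexp_rad n : measurable_fun [set: T] (fun x => enorm x ^+ n * gexp (enorm x)).
Proof.
apply: measurable_funM; first by apply: measurable_funX; exact: measurable_enorm.
apply: (measurableT_comp (@measurable_gexp R)); exact: measurable_enorm.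
Qed.

Lemma iint_gexp : iint (fun x => (rpos x * (gexp (enorm x))%:E)%E) = ((gmom d.+1)%:E * iint (rcut 1))%E.
Proof.
rewrite -gtail0 -[d.+1]add1n -iint_gtail; congr iint; apply/funext => x.
by rewrite gtail1// enorm_ge0.
Qed.

(** By [gtailS], [r^(n+1) gexp r] is [gtail (n+2) r - (n+1) gtail n r], and [iint_gtail] evaluates
    both terms. The subtraction is the reason for the finiteness hypothesis. *)
Lemma iint_radial n : (iint (rcut 1) < +oo)%E ->
  iint (fun x => (rpos x * (enorm x ^+ n * gexp (enorm x))%:E)%E) =
  ((d%:R * gmom (n + d.-1))%:E * iint (rcut 1))%E.
Proof.
case: n => [|n] fB.
  transitivity (iint (fun x => (rpos x * (gexp (enorm x))%:E)%E)).
    by congr iint; apply/funext => x; rewrite expr0 mul1r.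
  rewrite iint_gexp; congr (_%:E * _)%E; clear -d0.
  by case: (d) d0.
have B0 : (0 <= iint (rcut 1))%E.
  rewrite iintE; [|exact: measurable_rcut|exact: rcut_ge0].
  by apply: integral_ge0 => x _; rewrite mule_ge0 ?rcut_ge0// lee_fin ltW ?gweight_gt0.
have := iint_gtail n.+2; have := iint_gtail n.
have [b ->] : exists b, iint (rcut 1) = b%:E by exists (fine (iint (rcut 1))); rewrite fineK// ge0_fin_numE.
rewrite !gtail0 -!EFinM => e1 e2.
have mr : measurable_fun [set: T] (fun x => (rpos x * (enorm x ^+ n.+1 * gexp (enorm x))%:E)%E).
  by apply: emeasurable_funM; [exact: measurable_rpos|apply/measurable_EFinP; exact: measurable_gexp_rad].
have mt : measurable_fun [set: T] (fun x => (rpos x * gtail n (enorm x))%E).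
  by apply: emeasurable_funM; [exact: measurable_rpos|exact: measurable_gtail].
have r0 x : (0 <= rpos x * (enorm x ^+ n.+1 * gexp (enorm x))%:E)%E.
  by rewrite mule_ge0 ?rpos_ge0// lee_fin.
have t0 x : (0 <= rpos x * gtail n (enorm x))%E.
  by rewrite mule_ge0 ?rpos_ge0// gtail_ge0// enorm_ge0.
have g0 x : (0 <= (gweight x)%:E :> \bar R)%E by rewrite lee_fin ltW ?gweight_gt0.
have mg : measurable_fun [set: T] (fun x => (gweight x)%:E).
  by apply/measurable_EFinP; exact: measurable_gweight.
have e : (iint (fun x => (rpos x * gtail n.+2 (enorm x))%E) =
  iint (fun x => (rpos x * (enorm x ^+ n.+1 * gexp (enorm x))%:E)%E) +
  n.+1%:R%:E * iint (fun x => (rpos x * gtail n (enorm x))%E))%E.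
  rewrite !iintE//; last 2 first.
  - by apply: emeasurable_funM; [exact: measurable_rpos|exact: measurable_gtail].
  - by move=> x; rewrite mule_ge0 ?rpos_ge0// gtail_ge0// enorm_ge0.
  rewrite -ge0_integralZl//; last 2 first.
  - exact: emeasurable_funM.
  - by move=> x _; rewrite mule_ge0.
  rewrite -ge0_integralD//; last 4 first.
  - by move=> x _; rewrite mule_ge0.
  - exact: emeasurable_funM.
  - by move=> x _; rewrite mule_ge0 ?lee_fin// mule_ge0.
  - by apply: emeasurable_funM => //; exact: emeasurable_funM.
  apply: eq_integral => x _; rewrite gtailS ?enorm_ge0//.
  have gt0 : (0 <= gtail n (enorm x))%E by rewrite gtail_ge0// enorm_ge0.
  rewrite [(rpos x * (_ + _))%E]ge0_muleDr; last 2 first.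
  - by rewrite lee_fin.
  - by rewrite mule_ge0.
  rewrite ge0_muleDr ?r0//; last by rewrite mule_ge0 ?rpos_ge0// mule_ge0.
  by congr (_ + _)%E; rewrite !(muleCA _ n.+1%:R%:E).
move: e; rewrite e1 e2 -EFinM => h.
rewrite -[LHS](@addeK _ (n.+1%:R * (gmom (n + d) * b))%:E)// -h -EFinB; congr (_%:E).
have -> : (n.+2 + d = (n.+1 + d.-1).+2)%N by case: (d) d0 => // d' _; lia.
have -> : (n + d = n.+1 + d.-1)%N by case: (d) d0 => // d' _; lia.
rewrite /= -[(n + d.-1).+2%:R]/((n.+2 + d.-1)%:R).
have -> : (n.+2 + d.-1 = n.+1 + d)%N by case: (d) d0 => // d' _; lia.
by rewrite natrD; ring.
Qed.

Lemma gaussn_radial n : (iint (rcut 1) < +oo)%E ->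
  (\int[gaussn R d]_x (rpos x * (enorm x ^+ n)%:E) =
  (normal_peak (1 : R) ^+ d * (d%:R * gmom (n + d.-1)))%:E * iint (rcut 1))%E.
Proof.
move=> fB; rewrite EFinM -muleA -iint_radial//.
have p0 : 0 <= normal_peak (1 : R) ^+ d by rewrite exprn_ge0// normal_peak_ge0.
rewrite iintE; last 2 first.
- by apply: emeasurable_funM; [exact: measurable_rpos|apply/measurable_EFinP; exact: measurable_gexp_rad].
- by move=> x; rewrite mule_ge0 ?rpos_ge0// lee_fin.
rewrite -ge0_integralZl//; last 2 first.
- apply: emeasurable_funM; first by apply/measurable_EFinP; exact: measurable_gweight.
  by apply: emeasurable_funM; [exact: measurable_rpos|apply/measurable_EFinP; exact: measurable_gexp_rad].
- by move=> x _; rewrite !mule_ge0 ?rpos_ge0// lee_fin// ltW ?gweight_gt0.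
apply: eq_integral => x _.
rewrite [in RHS](muleC (rpos x)) !muleA -!EFinM [in RHS]muleC; congr (_ * _%:E)%E.
transitivity (gweight x * (normal_peak (1 : R) ^+ d * gexp (enorm x)) * enorm x ^+ n); last by ring.
by rewrite gweightE mul1r.
Qed.

(** Here the radial factor is [gtail 1] itself, so nothing is subtracted and infinite values are
    allowed; the finiteness that [gaussn_radial] asks for is later deduced from this version. *)
Lemma gaussn_rpos :
  (\int[gaussn R d]_x rpos x =
  (normal_peak (1 : R) ^+ d * gmom d.+1)%:E * iint (rcut 1))%E.
Proof.
rewrite EFinM -muleA -iint_gexp.
have p0 : 0 <= normal_peak (1 : R) ^+ d by rewrite exprn_ge0// normal_peak_ge0.
have mge : measurable_fun [set: T] (fun x => (gexp (enorm x))%:E).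
  by apply/measurable_EFinP; apply: (measurableT_comp (@measurable_gexp R)); exact: measurable_enorm.
have ge0 (x : T) : (0 <= (gexp (enorm x))%:E)%E by rewrite lee_fin ltW ?gexp_gt0.
rewrite iintE; last 2 first.
- by apply: emeasurable_funM => //; exact: measurable_rpos.
- by move=> x; rewrite mule_ge0 ?rpos_ge0.
rewrite -ge0_integralZl//; last 2 first.
- apply: emeasurable_funM; first by apply/measurable_EFinP; exact: measurable_gweight.
  by apply: emeasurable_funM => //; exact: measurable_rpos.
- by move=> x _; rewrite !mule_ge0 ?rpos_ge0// lee_fin// ltW ?gweight_gt0.
apply: eq_integral => x _.
rewrite [in RHS](muleC (rpos x)) !muleA -!EFinM [in RHS]muleC.
rewrite [X in (_ * X%:E)%E](_ : _ = 1) ?mule1//.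
by rewrite -[RHS](gweightE x) mulrAC mulrC mulrA.
Qed.

Lemma gamma_halfS m : (0 < m)%N -> gamma_half R m.+2 = m%:R / 2 * gamma_half R m.
Proof.
move=> m0; rewrite /gamma_half /= negbK.
have [om|em] := boolP (odd m); last first.
  have [k mk] : exists k, m = k.+1.*2.
    by exists m./2.-1; have := odd_double_half m; rewrite (negbTE em); lia.
  by rewrite mk doubleK /= factS natrM -muln2 natrM; field.
have [k mk] : exists k, m = k.*2.+1.
  by exists m./2; have := odd_double_half m; rewrite om; lia.
have h : m./2 = k by rewrite mk; lia.
rewrite h [(2 * k.+1)%N](_ : _ = (2 * k).+2); last lia.
have e1 : (2 * k).+2%:R = 2 * k%:R + 2 :> R by rewrite -addn2 natrD natrM.
have e2 : (2 * k).+1%:R = 2 * k%:R + 1 :> R by rewrite -addn1 natrD natrM.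
have e3 : k.+1%:R = k%:R + 1 :> R by rewrite -addn1 natrD.
rewrite !factS !natrM exprS mk -muln2 -[(k * 2)%N]mulnC e1 e2 e3 /=.
have k0 : (k`!)%:R != 0 :> R by rewrite pnatr_eq0 -lt0n fact_gt0.
have k1 : k%:R + 1 != 0 :> R by rewrite natr1 pnatr_eq0.
have f4 : (4 : R) ^+ k != 0 by rewrite expf_neq0.
by field; rewrite k0 k1 f4.
Qed.

(** The integral of s^(m+1) exp(-s^2/2) over the half-line is 2^(m/2) Gamma(m/2 + 1); both sides
    obey the same two-step recursion. *)
Lemma gmom_gamma m : (0 < m)%N ->
  2 * gmom m.+1 = m%:R * Num.sqrt 2 ^+ m * gamma_half R m.
Proof.
have s2 : Num.sqrt 2 != 0 :> R by rewrite gt_eqF// sqrtr_gt0.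
elim/nat_ind2: m => [//|_|m IH _].
  rewrite /gamma_half /= fact0 expr0 !mul1r expr1 sqrtrM ?pi_ge0// sqrtrV//.
  rewrite invr1 mul1r -{1}(sqr_sqrtr (ler0n R 2)); field.
  by rewrite s2.
have [->|m0] := posnP m.
  by rewrite /gamma_half /= fact0 !mulr1 sqr_sqrtr//.
have e : Num.sqrt 2 ^+ m.+2 = 2 * Num.sqrt 2 ^+ m :> R.
  by rewrite !exprS mulrA -expr2 sqr_sqrtr.
rewrite gamma_halfS// e.
have -> : gmom m.+3 = m.+2%:R * gmom m.+1 by [].
by rewrite mulrCA IH//; field.
Qed.

(** Here the closed formula of the area meets the cone formula: the identity says that the total
    mass of [sphere_int] is [sphere_area]. *)
Lemma sphere_area_gmom : sphere_area R d * (normal_peak (1 : R) ^+ d * gmom d.+1) = d%:R.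
Proof.
have s2 : Num.sqrt 2 != 0 :> R by rewrite gt_eqF// sqrtr_gt0.
have sp : Num.sqrt pi != 0 :> R by rewrite gt_eqF// sqrtr_gt0 pi_gt0.
have -> : normal_peak (1 : R) = (Num.sqrt 2 * Num.sqrt pi)^-1.
  by rewrite /normal_peak expr1n mul1r -mulr_natl sqrtrM.
have g0 : gamma_half R d != 0.
  apply/eqP => g0; have := gmom_gamma d0; rewrite g0 mulr0 => /eqP.
  by rewrite mulf_eq0 pnatr_eq0 (gt_eqF (gmom_gt0 _)).
have := gmom_gamma d0 => h.
have e : gmom d.+1 = d%:R * Num.sqrt 2 ^+ d * gamma_half R d / 2 by rewrite -h; field.
rewrite /sphere_area e exprVn exprMn.
have -> : powR pi (d%:R / 2) = Num.sqrt pi ^+ d :> R.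
  by rewrite mulrC powRrM -powR12_sqrt ?pi_ge0// powR_mulrn// powR_ge0.
by field; rewrite g0 !expf_neq0.
Qed.

End polar.

(** * Reflection symmetry and null hyperplanes *)

Section gauss_symmetry.
Variable R : realType.
Local Notation leb := (@lebesgue_measure R).

Lemma lebesgueN (f : R -> \bar R) : measurable_fun [set: R] f -> (forall x, 0 <= f x)%E ->
  (\int[leb]_(t in [set: R]) f (- t)%R = \int[leb]_(t in [set: R]) f t)%E.
Proof.
move=> mf f0.
pose N : measurableTypeR R -> measurableTypeR R := -%R.
have mN : measurable_fun [set: measurableTypeR R] N by exact: (@oppr_measurable R setT).
rewrite -[LHS](@ge0_integral_pushforward _ _ (measurableTypeR R) (measurableTypeR R) R N mN leb setT f measurableT mf (fun y _ => f0 y)).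
by apply: eq_measure_integral => A mA _; exact: lebesgue_measureN.
Qed.

Lemma gauss1N (f : R -> \bar R) : measurable_fun [set: R] f -> (forall x, 0 <= f x)%E ->
  (\int[@gauss1 R]_t f (- t)%R = \int[@gauss1 R]_t f t)%E.
Proof.
move=> mf f0; rewrite [RHS]ge0_integral_gauss1// ge0_integral_gauss1//; last first.
  by apply: measurableT_comp => //; exact: oppr_measurable.
rewrite -[RHS]lebesgueN; last 2 first.
- by apply: emeasurable_funM => //; apply/measurable_EFinP; exact: measurable_gpdf.
- by move=> x; rewrite mule_ge0// lee_fin ltW ?gpdf_gt0.
by apply: eq_integral => t _; rewrite /gpdf sqrrN.
Qed.

Lemma oppt_cons n (t : R) (v : n.-tuple R) : oppt (cons_tuple t v) = cons_tuple (- t) (oppt v).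
Proof. exact: val_inj. Qed.

Lemma measurable_oppt n : measurable_fun [set: n.-tuple R] (@oppt R n).
Proof.
apply/measurable_fun_tnthP => i.
rewrite (_ : _ \o _ = fun x => - tnth x i); last by apply/funext => x /=; rewrite tnth_map.
exact: (measurableT_comp (@oppr_measurable R setT) (measurable_tnth i)).
Qed.

Lemma gaussnN n (f : n.-tuple R -> \bar R) : measurable_fun setT f -> (forall x, 0 <= f x)%E ->
  (\int[gaussn R n]_x f (oppt x) = \int[gaussn R n]_x f x)%E.
Proof.
elim: n f => [|n IH] f mf f0.
  by apply: eq_integral => x _; congr f; exact: etrans (tuple0 _) (esym (tuple0 _)).
have mfo : measurable_fun setT (fun x => f (oppt x)).
  by apply: measurableT_comp => //; exact: measurable_oppt.
have mfc t : measurable_fun [set: n.-tuple R] (fun v => f (cons_tuple t v)).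
  by apply: measurableT_comp => //; exact: measurable_cons.
rewrite (ge0_integral_gaussnS mf f0) (ge0_integral_gaussnS mfo (fun x => f0 _)).
rewrite -[RHS]gauss1N; last 2 first.
- apply: (@measurable_fun_fubini_tonelli_F _ _ _ _ _ (gaussn R n) (fun p => f (cons2 p))) => //.
  by apply: measurableT_comp => //; exact: measurable_cons2.
- by move=> t; exact: integral_ge0.
apply: eq_integral => t _; rewrite -[RHS]IH//.
by apply: eq_integral => v _; rewrite oppt_cons.
Qed.

Lemma gaussn_coord1 n : gaussn R n.+1 [set x | tnth x ord0 = 0] = 0%E.
Proof.
have mA := @measurable_tnth0 R n.
rewrite -[LHS]mul1e -integral_cst// integral_mkcond ge0_integral_gaussnS; last 2 first.
- by apply/(measurable_restrictT _ _).1.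
- by move=> x; rewrite patchE; case: ifP.
transitivity (\int[@gauss1 R]_t (\1_[set 0] t)%:E)%E; last first.
  rewrite integral_indic// setIT.
  have /null_content_dominatesP D := @normal_prob_dominates R 0 1.
  by apply: (D [set 0]) => //; exact: lebesgue_measure_set1.
apply: eq_integral => t _; transitivity (\int[gaussn R n]_v (\1_[set 0] t)%:E)%E.
  apply: eq_integral => v _; rewrite patchE indicE.
  have -> : (cons_tuple t v \in [set x | tnth x ord0 = 0]) = (t \in [set 0]) => //.
  by case: ifP.
by rewrite -[RHS]mule1 -(probability_setT (gaussn R n)); exact: integral_cst.
Qed.

End gauss_symmetry.

(** * The uniform probability on the sphere *)

Section sphere_measure.
Variables (R : realType) (d : nat).
Local Notation T := (d.-tuple R).

(** At the origin the value is the zero tuple, the inverse of 0 being 0; for [0 < d] this happens on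
    a null set only. *)
Definition nrm (x : T) : T := scalet (enorm x)^-1 x.

Lemma measurable_nrm : measurable_fun [set: T] nrm.
Proof.
apply/measurable_fun_tnthP => i.
rewrite (_ : _ \o _ = fun x => (enorm x)^-1 * tnth x i); last by apply/funext => x /=; rewrite tnth_map.
apply: measurable_funM; last exact: measurable_tnth.
by apply: measurable_funV; exact: measurable_enorm.
Qed.

HB.instance Definition _ := isMeasurableFun.Build _ _ _ _ nrm measurable_nrm.

(* The uniform probability on the sphere. *)
Definition smu : probability T R := distribution (gaussn R d) nrm.

Lemma scaletA (s t : R) (x : T) : scalet s (scalet t x) = scalet (s * t) x.
Proof. by apply: eq_from_tnth => i; rewrite !tnth_map mulrA. Qed.

Lemma scalet1 (x : T) : scalet 1 x = x.
Proof. by apply: eq_from_tnth => i; rewrite !tnth_map mul1r. Qed.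

Lemma nrmZ s x : 0 < s -> nrm (scalet s x) = nrm x.
Proof.
move=> s0; rewrite /nrm enormZ ?(ltW s0)// scaletA invfM mulrAC mulVf ?mul1r//.
exact: lt0r_neq0.
Qed.

Lemma sphere_nrm x : 0 < enorm x -> sphere (nrm x).
Proof.
move=> x0; rewrite /sphere /= /nrm enormZ ?invr_ge0 ?(ltW x0)// mulVf//.
exact: lt0r_neq0.
Qed.

Lemma ge0_integral_smu (g : T -> \bar R) : measurable_fun setT g -> (forall x, 0 <= g x)%E ->
  (\int[smu]_x g x = \int[gaussn R d]_x g (nrm x))%E.
Proof. by move=> mg g0; rewrite /smu ge0_integral_distribution. Qed.

Hypothesis d0 : (0 < d)%N.

Lemma gaussn_enorm0 : gaussn R d [set x | enorm x = 0] = 0%E.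
Proof.
have m0 := @measurable_enorm0 R d.
case: d d0 m0 => // n _ m0; apply/eqP; rewrite eq_le measure_ge0 andbT.
rewrite -(gaussn_coord1 R n); apply: le_measure; rewrite ?inE//.
  exact: measurable_tnth0.
move=> x /= x0; have := enorm_sqr x; rewrite x0 expr0n /= => /esym/eqP.
rewrite psumr_eq0 => [/allP/(_ ord0)|i _]; last by rewrite -expr2 sqr_ge0.
by rewrite mem_index_enum /= mulf_eq0 orbb => /(_ isT)/eqP.
Qed.

Lemma integral_gaussn_rpos (g h : T -> \bar R) : measurable_fun setT g -> (forall x, 0 <= g x)%E ->
  measurable_fun setT h -> (forall x, 0 <= h x)%E ->
  (\int[gaussn R d]_x (g x * h x) = \int[gaussn R d]_x (rpos g x * h x))%E.
Proof.
move=> mg g0 mh h0; apply: ge0_ae_eq_integral => //.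
- exact: emeasurable_funM.
- by apply: emeasurable_funM => //; exact: measurable_rpos.
- by move=> x _; rewrite mule_ge0.
- by move=> x _; rewrite mule_ge0// rpos_ge0.
exists [set x | enorm x = 0]; split => //.
- exact: measurable_enorm0.
- exact: gaussn_enorm0.
move=> x /=; apply: contra_notP => /eqP x0 _; rewrite /rpos lt_neqAle eq_sym x0 enorm_ge0//.
Qed.

Section with_g.
Variable g : T -> \bar R.
Hypothesis mg : measurable_fun [set: T] g.
Hypothesis g0 : forall x, (0 <= g x)%E.
Let G x := g (nrm x).
Let mG : measurable_fun [set: T] G.
Proof. by apply: measurableT_comp => //; exact: measurable_nrm. Qed.
Let G0 x : (0 <= G x)%E. Proof. exact: g0. Qed.
Let GZ (s : R) x : 0 < s -> G (scalet s x) = G x.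
Proof. by move=> s0; rewrite /G nrmZ. Qed.

Let smuG : (\int[smu]_x g x = (normal_peak (1 : R) ^+ d * gmom R d.+1)%:E * iint (rcut G 1))%E.
Proof.
rewrite -gaussn_rpos// ge0_integral_smu//.
transitivity (\int[gaussn R d]_x (G x * 1))%E.
  by apply: eq_integral => x _; rewrite mule1.
rewrite (@integral_gaussn_rpos G (cst 1%E))//.
by apply: eq_integral => x _; rewrite mule1.
Qed.

Let c0 : 0 < normal_peak (1 : R) ^+ d * gmom R d.+1.
Proof. by rewrite mulr_gt0 ?gmom_gt0// exprn_gt0// normal_peak_gt0// oner_neq0. Qed.

(** Holds for infinite values too, as it must for densities that need not be bounded. *)
Lemma sphere_intE : (sphere_int g = (sphere_area R d)%:E * \int[smu]_x g x)%E.
Proof. by rewrite smuG muleA -EFinM sphere_area_gmom. Qed.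

(** The k-th moment of the norm of a d-dimensional standard Gaussian vector. *)
Definition krad k : R := gmom R (k + d.-1) / gmom R d.-1.

(** The independence of norm and direction of a Gaussian vector, tested on powers of the norm. *)
Lemma integral_radial k : (\int[smu]_x g x < +oo)%E ->
  (\int[gaussn R d]_x (g (nrm x) * (enorm x ^+ k)%:E) = (krad k)%:E * \int[smu]_x g x)%E.
Proof.
move=> fg; rewrite (@integral_gaussn_rpos G (fun x => (enorm x ^+ k)%:E))//; last 2 first.
- by apply/measurable_EFinP; apply: measurable_funX; exact: measurable_enorm.
- by move=> x; rewrite lee_fin exprn_ge0// enorm_ge0.
rewrite gaussn_radial//.
  rewrite smuG muleA -EFinM /krad.
  have e : gmom R d.+1 = d%:R * gmom R d.-1 by case: d d0.
  by rewrite e; congr (_%:E * _)%E; field; rewrite gt_eqF ?gmom_gt0.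
rewrite ltey; apply/eqP => h; move: fg; rewrite smuG h.
by rewrite gt0_muley ?lte_fin.
Qed.

End with_g.

Lemma kradS k : krad k.+2 = (k + d)%:R * krad k.
Proof.
rewrite /krad mulrA; congr (_ / _).
have -> : (k.+2 + d.-1 = (k + d.-1).+2)%N by lia.
have -> : (k + d = (k + d.-1).+1)%N by case: d d0 => // n _; lia.
by [].
Qed.

Lemma krad_gt0 k : 0 < krad k.
Proof. by rewrite divr_gt0// gmom_gt0. Qed.

Lemma smu_sphere : smu (@sphere R d) = 1%E.
Proof.
have mS := @measurable_sphere R d.
apply/eqP; rewrite eq_le probability_le1//=.
have m0 := @measurable_enorm0 R d.
have <- : gaussn R d (~` [set x : T | enorm x = 0]) = 1%E.
  by rewrite probability_setC// gaussn_enorm0 sube0.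
apply: le_measure; rewrite ?inE//; first exact: measurableC.
  by rewrite -[X in measurable X]setTI; exact: measurable_nrm.
move=> x /= /eqP x0; apply: sphere_nrm; by rewrite lt_neqAle eq_sym x0 enorm_ge0.
Qed.

Lemma smuN (g : T -> \bar R) : measurable_fun setT g -> (forall x, 0 <= g x)%E ->
  (\int[smu]_x g (oppt x) = \int[smu]_x g x)%E.
Proof.
move=> mg g0.
have mgo : measurable_fun setT (fun x => g (oppt x)).
  by apply: measurableT_comp => //; exact: measurable_oppt.
have mgn : measurable_fun setT (fun x => g (nrm x)).
  by apply: measurableT_comp => //; exact: measurable_nrm.
rewrite !ge0_integral_smu// -[RHS]gaussnN//.
apply: eq_integral => x _; congr g; rewrite /nrm.
have -> : enorm (oppt x) = enorm x.
  by rewrite /enorm /dotp; congr Num.sqrt; apply: eq_bigr => i _; rewrite !tnth_map mulrNN.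
by apply: eq_from_tnth => i; rewrite !tnth_map mulrN.
Qed.

End sphere_measure.

Lemma smu_coord1 (R : realType) n : smu R n.+1 [set x | coord1 x = 0] = 0%E.
Proof.
have mA := @measurable_tnth0 R n.
have cE (x : n.+1.-tuple R) : coord1 x = tnth x ord0 by rewrite /coord1 (tnth_nth 0).
have -> : [set x : n.+1.-tuple R | coord1 x = 0] = [set x | tnth x ord0 = 0].
  by apply/seteqP; split => x /=; rewrite cE.
apply/eqP; rewrite eq_le measure_ge0 andbT -(gaussn_coord1 R n).
rewrite -[smu R n.+1 _]/(gaussn R n.+1 (@nrm R n.+1 @^-1` [set x | tnth x ord0 = 0])).
apply: le_measure; rewrite ?inE//.
  by rewrite -[X in measurable X]setTI; exact: measurable_nrm.
move=> x /= /eqP; rewrite tnth_map mulf_eq0 invr_eq0 => /orP[|/eqP//] /eqP x0.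
have := enorm_sqr x; rewrite x0 expr0n /= => /esym/eqP.
rewrite psumr_eq0 => [/allP/(_ ord0)|i _]; last by rewrite -expr2 sqr_ge0.
by rewrite mem_index_enum /= mulf_eq0 orbb => /(_ isT)/eqP.
Qed.

(** * Gaussian integration by parts *)

Section gauss_moments1.
Variable R : realType.
Local Notation leb := (@lebesgue_measure R).

Lemma gauss1_even k :
  (\int[@gauss1 R]_t (t ^+ k.*2)%:E = (normal_peak (1 : R) * (2 * gmom R k.*2))%:E)%E.
Proof.
have ev0 (t : R) : 0 <= t ^+ k.*2 by rewrite -muln2 mulnC exprM exprn_ge0// sqr_ge0.
have p0 : 0 <= normal_peak (1 : R) by rewrite normal_peak_ge0.
rewrite ge0_integral_gauss1; last 2 first.
- by apply/measurable_EFinP; exact: measurable_funX.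
- by move=> t; rewrite lee_fin.
pose f (t : R) : R := t ^+ k.*2 * gexp t.
have cf : continuous f.
  by move=> t; apply: cvgM; [exact: exprn_continuous|exact: continuous_gexp].
have f0 t : 0 <= f t by rewrite mulr_ge0// ltW// gexp_gt0.
have fE t : f t = (f \o -%R) t.
  by rewrite /f /= /gexp sqrrN exprNn -signr_odd odd_double mul1r.
transitivity ((normal_peak (1 : R))%:E * \int[leb]_t (f t)%:E)%E.
  rewrite -ge0_integralZl//; last 2 first.
  - by apply/measurable_EFinP; exact: continuous_measurable_fun.
  - by move=> t _; rewrite lee_fin.
  by apply: eq_integral => t _; rewrite /f /gpdf /gexp -!EFinM; congr (_%:E); ring.
rewrite ge0_symfun_integralT// EFinM; congr (_ * _)%E.
rewrite EFinM -gtail0; congr (_ * _)%E.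
rewrite /gtail /gtint lebesgue_itvy; congr (integral _ _ _).
by apply/seteqP; split => t /=; rewrite in_itv /= andbT.
Qed.

Lemma integrable_gauss1_poly (p : {poly R}) : (@gauss1 R).-integrable setT (EFin \o horner p).
Proof.
have mX k : measurable_fun [set: R] (fun t : R => t ^+ k) by exact: measurable_funX.
have iX k : (@gauss1 R).-integrable setT (fun t : R => (t ^+ k)%:E).
  apply/integrableP; split; first by apply/measurable_EFinP; exact: mX.
  have ev0 (t : R) : 0 <= t ^+ k.*2 by rewrite -muln2 mulnC exprM exprn_ge0// sqr_ge0.
  (* Only even moments are known at this point; the bound [|t^k| <= 1 + t^(2k)] covers the odd
     powers. *)
  apply: (@le_lt_trans _ _ (\int[@gauss1 R]_t (1 + (t ^+ k.*2)%:E))%E).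
    apply: ge0_le_integral => //.
    - by apply: measurableT_comp => //; exact/measurable_EFinP.
    - by apply: emeasurable_funD => //; exact/measurable_EFinP.
    - move=> t _; rewrite /= -EFinD lee_fin -muln2 exprM ler_norml.
      have := sqr_ge0 (t ^+ k - 1); have := sqr_ge0 (t ^+ k + 1).
      by move: (t ^+ k) => b h1 h2; apply/andP; split; nra.
  rewrite ge0_integralD//; last 2 first.
  - by move=> t _; rewrite lee_fin.
  - exact/measurable_EFinP.
  rewrite gauss1_even [X in (X + _)%E](_ : _ = 1%E) -?EFinD ?ltry//.
  by rewrite -[RHS](probability_setT (@gauss1 R)) -[RHS]mul1e; exact: integral_cst.
have -> : EFin \o horner p = (fun t => \sum_(i < size p) ((p`_i)%:E * (t ^+ i)%:E))%E.
  apply/funext => t /=; rewrite horner_coef -sumEFin; apply: eq_bigr => i _; by rewrite EFinM.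
by apply: integrable_sum => // i _; exact: integrableZl.
Qed.

Lemma gauss1_odd k : \int[@gauss1 R]_t (t ^+ k.*2.+1) = 0.
Proof.
have iX : (@gauss1 R).-integrable setT (EFin \o (fun t : R => t ^+ k.*2.+1)).
  have := integrable_gauss1_poly 'X^(k.*2.+1); congr (_.-integrable _ _).
  by apply/funext => t /=; rewrite hornerXn.
rewrite /Rintegral integralE.
set f := (fun t : R => (t ^+ k.*2.+1)%:E).
have -> : (\int[@gauss1 R]_t f^\- t = \int[@gauss1 R]_t f^\+ t)%E.
  rewrite -[RHS]gauss1N; last 2 first.
  - by apply: measurable_funepos; have /integrableP[] := iX.
  - by move=> t; exact: funepos_ge0.
  apply: eq_integral => t _; rewrite funenegE funeposE /f exprNn -signr_odd /= odd_double expr1 mulN1r.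
  by rewrite EFinN.
by rewrite subee// integrable_pos_fin_num.
Qed.

Lemma poly_lin_ind (P : {poly R} -> Prop) :
  (forall p q, P p -> P q -> P (p + q)) -> (forall c p, P p -> P (c *: p)) ->
  (forall n, P 'X^n) -> forall p, P p.
Proof.
move=> PD PZ PX p; rewrite -[p]coefK poly_def; elim/big_ind : _ => //.
  by rewrite -(scale0r ('X^0 : {poly R})); exact: PZ.
by move=> i _; exact: PZ.
Qed.

(** By linearity this is the moment identity E t^(n+1) = n E t^(n-1): odd moments vanish by symmetry
    and even ones satisfy the recursion of [gmom]. *)
Lemma gauss1_ibp (h : {poly R}) :
  \int[@gauss1 R]_t (t * h.[t]) = \int[@gauss1 R]_t (h^`().[t]).
Proof.
have iP (p : {poly R}) := integrable_gauss1_poly p.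
elim/poly_lin_ind: h => [p q ep eq|c p ep|n].
- rewrite derivD.
  transitivity (\int[@gauss1 R]_t ((t * p.[t]) + (t * q.[t]))).
    by apply: eq_Rintegral => t _; rewrite hornerD mulrDr.
  have iXP (r : {poly R}) : (@gauss1 R).-integrable setT (EFin \o (fun t : R => t * r.[t])).
    have := iP ('X * r); congr (_.-integrable _ _).
    by apply/funext => t /=; rewrite hornerM hornerX.
  rewrite RintegralD// ep eq -RintegralD//.
  by apply: eq_Rintegral => t _; rewrite hornerD.
- rewrite derivZ.
  transitivity (\int[@gauss1 R]_t (c * (t * p.[t]))).
    by apply: eq_Rintegral => t _; rewrite hornerZ mulrCA.
  have iXP (r : {poly R}) : (@gauss1 R).-integrable setT (EFin \o (fun t : R => t * r.[t])).
    have := iP ('X * r); congr (_.-integrable _ _).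
    by apply/funext => t /=; rewrite hornerM hornerX.
  rewrite RintegralZl// ep -RintegralZl//.
  by apply: eq_Rintegral => t _; rewrite hornerZ.
transitivity (\int[@gauss1 R]_t (t ^+ n.+1)).
  by apply: eq_Rintegral => t _; rewrite hornerXn exprS.
transitivity (n%:R * \int[@gauss1 R]_t (t ^+ n.-1)); last first.
  rewrite -RintegralZl//.
    by apply: eq_Rintegral => t _; rewrite derivXn hornerMn hornerXn mulr_natl.
  have := iP 'X^(n.-1); congr (_.-integrable _ _).
  by apply/funext => t /=; rewrite hornerXn.
case: n => [|n]; first by rewrite mul0r -(gauss1_odd 0).
rewrite /=; have [on|en] := boolP (odd n).
  have -> : n = n./2.*2.+1 by rewrite -{1}(odd_double_half n) on.
  by rewrite -doubleS !gauss1_odd mulr0.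
have -> : n = n./2.*2 by rewrite -{1}(odd_double_half n) (negbTE en).
rewrite /Rintegral -[n./2.*2.+2]/(n./2.+1.*2) !gauss1_even /=.
by ring.
Qed.

End gauss_moments1.

Section gauss_ibp.
Variable R : realType.

(** Polynomial growth in the norm: stable under sums, products and fixing a coordinate, and
    sufficient for Gaussian integrability. *)
Definition pgrow n (f : n.-tuple R -> R) := measurable_fun [set: n.-tuple R] f /\
  exists C k, 0 <= C /\ forall y, `|f y| <= C * (1 + enorm y) ^+ k.

Let en1 n (y : n.-tuple R) : 1 <= 1 + enorm y. Proof. by rewrite lerDl enorm_ge0. Qed.

Lemma pgrow_cst n (c : R) : pgrow (fun _ : n.-tuple R => c).
Proof. by split=> //; exists `|c|, 0%N; split => // y; rewrite expr0 mulr1. Qed.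

Lemma pgrowD n (f g : n.-tuple R -> R) : pgrow f -> pgrow g -> pgrow (fun y => f y + g y).
Proof.
move=> [mf [C [k [C0 hf]]]] [mg [D [l [D0 hg]]]]; split; first exact: measurable_funD.
exists (C + D), (k + l)%N; split; first exact: addr_ge0.
move=> y; rewrite (le_trans (ler_normD _ _))// mulrDl lerD//.
  by rewrite (le_trans (hf y))// ler_wpM2l// ler_weXn2l// leq_addr.
by rewrite (le_trans (hg y))// ler_wpM2l// ler_weXn2l// leq_addl.
Qed.

Lemma pgrowM n (f g : n.-tuple R -> R) : pgrow f -> pgrow g -> pgrow (fun y => f y * g y).
Proof.
move=> [mf [C [k [C0 hf]]]] [mg [D [l [D0 hg]]]]; split; first exact: measurable_funM.
exists (C * D), (k + l)%N; split; first exact: mulr_ge0.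
by move=> y; rewrite normrM exprD mulrACA ler_pM.
Qed.

Lemma pgrow_coord n (i : 'I_n) : pgrow (fun y => tnth y i).
Proof.
split; first exact: measurable_tnth.
exists 1, 1%N; split => // y; rewrite mul1r expr1 (le_trans _ (_ : enorm y <= _))//; last by rewrite lerDr.
rewrite -(@ler_pXn2r _ 2)// ?nnegrE ?enorm_ge0// enorm_sqr real_normK ?num_real//.
by rewrite /dotp (bigD1 i)//= -expr2 lerDl sumr_ge0// => j _; rewrite -expr2 sqr_ge0.
Qed.

Lemma pgrow_sum n I (r : seq I) (f : I -> n.-tuple R -> R) :
  (forall i, pgrow (f i)) -> pgrow (fun y => \sum_(i <- r) f i y).
Proof.
move=> hf; elim: r => [|i r IH].
  by under [X in pgrow X]eq_fun do rewrite big_nil; exact: pgrow_cst.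
by under [X in pgrow X]eq_fun do rewrite big_cons; exact: pgrowD.
Qed.

Lemma pgrow_dotp n (x : n.-tuple R) : pgrow (dotp x).
Proof. by apply: pgrow_sum => i; apply: pgrowM; [exact: pgrow_cst|exact: pgrow_coord]. Qed.

Lemma pgrow_horner n (p : {poly R}) (f : n.-tuple R -> R) : pgrow f -> pgrow (fun y => p.[f y]).
Proof.
move=> hf; elim/poly_ind: p => [|p c IH].
  by under [X in pgrow X]eq_fun do rewrite horner0; exact: pgrow_cst.
under [X in pgrow X]eq_fun do rewrite hornerMXaddC.
by apply: pgrowD; [exact: pgrowM|exact: pgrow_cst].
Qed.

Lemma pgrow_consl n (f : n.+1.-tuple R -> R) t : pgrow f -> pgrow (fun v => f (cons_tuple t v)).
Proof.
move=> [mf [C [k [C0 hf]]]]; split.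
  by apply: (measurableT_comp mf); exact: measurable_cons.
exists (C * (1 + `|t|) ^+ k), k; split; first by rewrite mulr_ge0// exprn_ge0// addr_ge0.
move=> y; rewrite (le_trans (hf _))// -mulrA ler_wpM2l// -exprMn lerXn2r ?nnegrE//.
- by rewrite addr_ge0// enorm_ge0.
- by rewrite mulr_ge0// addr_ge0// enorm_ge0.
have h : enorm (cons_tuple t y) <= `|t| + enorm y.
  rewrite -(@ler_pXn2r _ 2)// ?nnegrE ?addr_ge0 ?enorm_ge0// enorm_sqr dotp_cons sqrrD.
  rewrite real_normK ?num_real// enorm_sqr -expr2 -addrA lerD2l lerDr.
  by rewrite mulrn_wge0// mulr_ge0// enorm_ge0.
have := enorm_ge0 y; have := normr_ge0 t; nra.
Qed.

Lemma integrable_pgrow n (f : n.-tuple R -> R) : pgrow f -> (gaussn R n).-integrable setT (EFin \o f).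
Proof.
case: n f => [|n] f [mf [C [k [C0 hf]]]].
  apply: (@measurable_bounded_integrable _ _ _ (gaussn R 0)) => //.
    by rewrite (le_lt_trans (probability_le1 _ _))// ltry.
  exists C; split; first exact: num_real.
  move=> M CM x _ /=; rewrite (le_trans (hf x))// /enorm /dotp big_ord0 sqrtr0 addr0 expr1n mulr1.
  exact: ltW.
(* Otherwise [gaussn_rpos] would give the constant 1 an infinite Gaussian integral. *)
have i0 : (iint (rcut (cst 1%E : n.+1.-tuple R -> _) 1) < +oo)%E.
  rewrite ltey; apply/eqP => h.
  have one0 (x : n.+1.-tuple R) : (0 <= cst 1%E x :> \bar R)%E by rewrite /= lee_fin.
  have := @gaussn_rpos R n.+1 isT (cst 1%E) (@measurable_cst _ _ _ _ _ _) one0 (fun _ _ _ => erefl).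
  rewrite h gt0_muley ?lte_fin; last first.
    by rewrite mulr_gt0 ?gmom_gt0// exprn_gt0// normal_peak_gt0// oner_neq0.
  apply/eqP; rewrite lt_eqF// (@le_lt_trans _ _ 1%E) ?ltry//.
  rewrite -[leRHS](probability_setT (gaussn R n.+1)) -[leRHS]mul1e -integral_cst//.
  apply: ge0_le_integral => //.
  - by move=> x _; exact: rpos_ge0.
  - exact: measurable_rpos.
  - by move=> x _; rewrite /rpos; case: ifP.
have ik : (\int[gaussn R n.+1]_x (1 + (enorm x ^+ k)%:E) < +oo)%E.
  have m1 : measurable_fun [set: n.+1.-tuple R] (fun x => (enorm x ^+ k)%:E).
    by apply/measurable_EFinP; apply: measurable_funX; exact: measurable_enorm.
  have g1 (x : n.+1.-tuple R) : (0 <= (enorm x ^+ k)%:E)%E by rewrite lee_fin exprn_ge0// enorm_ge0.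
  rewrite ge0_integralD//.
  rewrite (_ : (\int[_]__ 1)%E = 1%E); last first.
    rewrite -[RHS](probability_setT (gaussn R n.+1)) -[RHS]mul1e; exact: integral_cst.
  rewrite lte_add_pinfty ?ltry//.
  have -> : (\int[gaussn R n.+1]_x (enorm x ^+ k)%:E = \int[gaussn R n.+1]_x (cst 1 x * (enorm x ^+ k)%:E))%E.
    by apply: eq_integral => x _; rewrite mul1e.
  rewrite (@integral_gaussn_rpos R n.+1 isT (cst 1%E) (fun x => (enorm x ^+ k)%:E))//.
  rewrite gaussn_radial//.
  by rewrite lte_mul_pinfty// lee_fin !mulr_ge0 ?(ltW (gmom_gt0 _ _))// exprn_ge0// normal_peak_ge0.
apply/integrableP; split; first exact/measurable_EFinP.
apply: (@le_lt_trans _ _ (\int[gaussn R n.+1]_x ((C * 2 ^+ k)%:E * (1 + (enorm x ^+ k)%:E)))%E).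
  apply: ge0_le_integral => //.
  - by apply: measurableT_comp => //; exact/measurable_EFinP.
  - apply: measurable_funeM; apply: emeasurable_funD => //; apply/measurable_EFinP.
    by apply: measurable_funX; exact: measurable_enorm.
  move=> x _; rewrite /= -EFinD -EFinM lee_fin (le_trans (hf x))// -mulrA ler_wpM2l//.
  have := enorm_ge0 x; set a := enorm x => a0.
  have [a1|a1] := leP a 1.
    apply: (@le_trans _ _ (2 ^+ k)); first by rewrite lerXn2r ?nnegrE//; lra.
    by rewrite ler_peMr ?exprn_ge0// lerDl exprn_ge0.
  apply: (@le_trans _ _ ((2 * a) ^+ k)); first by rewrite lerXn2r ?nnegrE//; lra.
  by rewrite exprMn ler_wpM2l ?exprn_ge0// lerDr.
rewrite ge0_integralZl//.
- by rewrite lte_mul_pinfty// lee_fin mulr_ge0// exprn_ge0.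
- apply: emeasurable_funD => //; apply/measurable_EFinP.
  by apply: measurable_funX; exact: measurable_enorm.
- by move=> x _; rewrite adde_ge0// lee_fin ?exprn_ge0 ?enorm_ge0.
- by rewrite lee_fin mulr_ge0// exprn_ge0.
Qed.

Definition Eg n (f : n.-tuple R -> R) : R := \int[gaussn R n]_y f y.

Lemma EgD n (f g : n.-tuple R -> R) : pgrow f -> pgrow g -> Eg (fun y => f y + g y) = Eg f + Eg g.
Proof. by move=> /integrable_pgrow hf /integrable_pgrow hg; rewrite /Eg RintegralD. Qed.

Lemma EgZ n c (f : n.-tuple R -> R) : pgrow f -> Eg (fun y => c * f y) = c * Eg f.
Proof. by move=> /integrable_pgrow hf; rewrite /Eg RintegralZl. Qed.

Lemma eq_Eg n (f g : n.-tuple R -> R) : f =1 g -> Eg f = Eg g.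
Proof. by move=> fg; apply: eq_Rintegral => x _. Qed.

Let integrable_cons2 n (f : n.+1.-tuple R -> R) : pgrow f ->
  (@gauss1 R \x gaussn R n)%E.-integrable setT (EFin \o (f \o @cons2 R n)).
Proof.
move=> pf; have [mf _] := pf; have /integrableP[_ h] := integrable_pgrow pf.
have mc : measurable_fun setT (f \o @cons2 R n).
  by apply: measurableT_comp => //; exact: measurable_cons2.
apply/integrableP; split; first by apply/measurable_EFinP.
move: h; rewrite /= ge0_integral_distribution//.
by apply/measurable_EFinP; exact: measurableT_comp.
Qed.

Let Eg_prod n (f : n.+1.-tuple R -> R) : pgrow f ->
  Eg f = fine (\int[(@gauss1 R \x gaussn R n)%E]_p (f (cons2 p))%:E).
Proof.
move=> pf; have [mf _] := pf; have i2 := integrable_cons2 pf.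
rewrite /Eg /Rintegral /= integral_distribution//.
exact/measurable_EFinP.
Qed.

Lemma Eg_consl n (f : n.+1.-tuple R -> R) : pgrow f ->
  Eg f = \int[@gauss1 R]_t (Eg (fun v => f (cons_tuple t v))).
Proof.
move=> pf; rewrite Eg_prod// -integral12_prod_meas1//; last exact: integrable_cons2.
congr fine; apply: eq_integral => t _; rewrite /fubini_F /Eg /Rintegral fineK//.
apply: integrable_fin_num => //; apply: (@integrable_pgrow n (fun v => f (cons_tuple t v))).
exact: pgrow_consl.
Qed.

Lemma Eg_consr n (f : n.+1.-tuple R -> R) : pgrow f ->
  (forall v, (@gauss1 R).-integrable setT (EFin \o (fun t => f (cons_tuple t v)))) ->
  Eg f = Eg (fun v => \int[@gauss1 R]_t (f (cons_tuple t v))).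
Proof.
move=> pf hv; rewrite Eg_prod// -integral21_prod_meas1//; last exact: integrable_cons2.
congr fine; apply: eq_integral => v _; rewrite /fubini_G /Rintegral fineK//.
by apply: integrable_fin_num => //; exact: hv.
Qed.

Lemma pgrow_affine n (p : {poly R}) (a : R) (x : n.-tuple R) : pgrow (fun y => p.[a + dotp x y]).
Proof.
apply: (@pgrow_horner n p (fun y => a + dotp x y)); apply: pgrowD; first exact: pgrow_cst.
exact: pgrow_dotp.
Qed.

(** Gaussian integration by parts in the direction [x]. The shifts [a] and [b] make the induction on
    the dimension possible: they absorb the coordinate that is held fixed. *)
Lemma gauss_ibp n (p q : {poly R}) (a b : R) (x z : n.-tuple R) :
  Eg (fun y => dotp x y * (p.[a + dotp x y] * q.[b + dotp z y])) =
  Eg (fun y => dotp x x * (p^`().[a + dotp x y] * q.[b + dotp z y]) +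
               dotp x z * (p.[a + dotp x y] * q^`().[b + dotp z y])).
Proof.
elim: n a b x z => [|n IH] a b x z.
  by apply: eq_Eg => y; rewrite /dotp !big_ord0 !mul0r addr0.
have tE (w : n.+1.-tuple R) : exists s u, w = cons_tuple s u.
  exists (thead w), [tuple of behead w]; rewrite {1}(tuple_eta w); exact: val_inj.
have [x0 [x' ->]] := tE x; have [z0 [z' ->]] := tE z.
set X := cons_tuple x0 x'; set Z := cons_tuple z0 z'.
(* [dotp X y] is split into its first coordinate, treated by the one-dimensional formula with the
   tail fixed, and [dl], treated by induction with the first coordinate fixed. *)
pose dl (y : n.+1.-tuple R) := dotp (cons_tuple 0 x') y.
have pl : pgrow dl by exact: pgrow_dotp.
have pf (f g : {poly R}) : pgrow (fun y => f.[a + dotp X y] * g.[b + dotp Z y]).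
  by apply: pgrowM; exact: pgrow_affine.
have pc : pgrow (fun y : n.+1.-tuple R => tnth y ord0) by exact: pgrow_coord.
transitivity (Eg (fun y => x0 * (tnth y ord0 * (p.[a + dotp X y] * q.[b + dotp Z y])) +
                            dl y * (p.[a + dotp X y] * q.[b + dotp Z y]))).
  apply: eq_Eg => y; have [t [v ->]] := tE y.
  by rewrite /dl !dotp_cons mul0r add0r tnth0 -/X; ring.
rewrite EgD; last 2 first.
- by apply: pgrowM; [exact: pgrow_cst|exact: pgrowM].
- exact: pgrowM.
have -> : Eg (fun y => dl y * (p.[a + dotp X y] * q.[b + dotp Z y])) =
  Eg (fun y => dotp x' x' * (p^`().[a + dotp X y] * q.[b + dotp Z y]) +
               dotp x' z' * (p.[a + dotp X y] * q^`().[b + dotp Z y])).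
  rewrite Eg_consl; last exact: pgrowM.
  rewrite Eg_consl; last by apply: pgrowD; apply: pgrowM => //; exact: pgrow_cst.
  apply: eq_Rintegral => t _.
  transitivity (Eg (fun v => dotp x' v * (p.[(a + x0 * t) + dotp x' v] * q.[(b + z0 * t) + dotp z' v]))).
    by apply: eq_Eg => v; rewrite /dl /X /Z !dotp_cons mul0r add0r !addrA.
  by rewrite IH; apply: eq_Eg => v; rewrite /X /Z !dotp_cons !addrA.
have -> : Eg (fun y => x0 * (tnth y ord0 * (p.[a + dotp X y] * q.[b + dotp Z y]))) =
  Eg (fun y => x0 * x0 * (p^`().[a + dotp X y] * q.[b + dotp Z y]) +
               x0 * z0 * (p.[a + dotp X y] * q^`().[b + dotp Z y])).
  pose h (r s : {poly R}) (v : n.-tuple R) : {poly R} :=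
    (r \Po ((a + dotp x' v)%:P + x0%:P * 'X)) * (s \Po ((b + dotp z' v)%:P + z0%:P * 'X)).
  have hE r s v t : (h r s v).[t] = r.[a + dotp X (cons_tuple t v)] * s.[b + dotp Z (cons_tuple t v)].
    rewrite /h hornerM !horner_comp !hornerE /X /Z !dotp_cons.
    by congr (_.[_] * _.[_]); ring.
  have hd v : (h p q v)^`() = x0 *: h p^`() q v + z0 *: h p q^`() v.
    rewrite /h derivM !deriv_comp !derivD !derivM !derivC derivX -!mul_polyC.
    by rewrite !mul0r !add0r !mulr1; ring.
  have iP r : (@gauss1 R).-integrable setT (EFin \o horner r) by exact: integrable_gauss1_poly.
  rewrite Eg_consr; last 2 first.
  - by apply: pgrowM; [exact: pgrow_cst|exact: pgrowM].
  - move=> v; have := iP (x0 *: ('X * h p q v)); congr (_.-integrable _ _).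
    by apply/funext => t /=; rewrite hornerZ hornerM hornerX hE tnth0.
  rewrite Eg_consr; last 2 first.
  - by apply: pgrowD; apply: pgrowM => //; exact: pgrow_cst.
  - move=> v; have := iP ((x0 * x0) *: h p^`() q v + (x0 * z0) *: h p q^`() v).
    congr (_.-integrable _ _).
    by apply/funext => t /=; rewrite hornerD !hornerZ !hE.
  apply: eq_Eg => v.
  transitivity (x0 * \int[@gauss1 R]_t (t * (h p q v).[t])).
    rewrite -RintegralZl//; last first.
      have := iP ('X * h p q v); congr (_.-integrable _ _).
      by apply/funext => t /=; rewrite hornerM hornerX.
    by apply: eq_Rintegral => t _; rewrite hE tnth0.
  rewrite gauss1_ibp -RintegralZl//.
  by apply: eq_Rintegral => t _; rewrite hd hornerD !hornerZ !hE; ring.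
rewrite -EgD; last 2 first.
- by apply: pgrowD; apply: pgrowM => //; exact: pgrow_cst.
- by apply: pgrowD; apply: pgrowM => //; exact: pgrow_cst.
by apply: eq_Eg => y; rewrite !dotp_cons; ring.
Qed.

End gauss_ibp.

(** * Zonal functions on the sphere *)

Section bounded_integral.
Context d (T : measurableType d) (R : realType) (mu : probability T R) (S : set T).
Hypothesis mS : measurable S.

(** Bounded on [S] only, since polynomials in [dotp x y] are unbounded off the sphere; measurability
    is kept on the whole space, where compositions are easier. *)
Definition bmf (f : T -> R) := measurable_fun [set: T] f /\
  exists M, forall x, S x -> `|f x| <= M.

Definition Bint (f : T -> R) : R := \int[mu]_(x in S) f x.

Lemma bmf_integrable f : bmf f -> mu.-integrable S (EFin \o f).
Proof.
move=> [mf [M hM]]; apply: measurable_bounded_integrable => //.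
- by rewrite (le_lt_trans (probability_le1 _ _))// ltry.
- exact: measurable_funTS.
- exists M; split; first exact: num_real.
  by move=> K MK x Sx /=; rewrite (le_trans (hM x Sx))// ltW.
Qed.

Lemma bmf_cst c : bmf (fun=> c).
Proof. by split => //; exists `|c| => x _. Qed.

Lemma bmfD f g : bmf f -> bmf g -> bmf (fun x => f x + g x).
Proof.
move=> [mf [M hM]] [mg [N hN]]; split; first exact: measurable_funD.
by exists (M + N) => x Sx; rewrite (le_trans (ler_normD _ _))// lerD ?hM ?hN.
Qed.

Lemma bmfM f g : bmf f -> bmf g -> bmf (fun x => f x * g x).
Proof.
move=> [mf [M hM]] [mg [N hN]]; split; first exact: measurable_funM.
by exists (M * N) => x Sx; rewrite normrM ler_pM ?hM ?hN.
Qed.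

Lemma bmfZ c f : bmf f -> bmf (fun x => c * f x).
Proof. exact: bmfM (bmf_cst c). Qed.

Lemma bmfB f g : bmf f -> bmf g -> bmf (fun x => f x - g x).
Proof.
move=> hf hg; have := bmfD hf (bmfZ (- 1) hg); congr bmf.
by apply/funext => x; rewrite mulN1r.
Qed.

Lemma bmfX f n : bmf f -> bmf (fun x => f x ^+ n).
Proof.
move=> hf; elim: n => [|n IH]; first exact: bmf_cst.
by under [X in bmf X]eq_fun do rewrite exprS; exact: bmfM.
Qed.

Lemma bmf_sum I (r : seq I) (f : I -> T -> R) :
  (forall i, bmf (f i)) -> bmf (fun x => \sum_(i <- r) f i x).
Proof.
move=> hf; elim: r => [|i r IH].
  by under [X in bmf X]eq_fun do rewrite big_nil; exact: bmf_cst.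
by under [X in bmf X]eq_fun do rewrite big_cons; exact: bmfD.
Qed.

Lemma bmf_horner (p : {poly R}) f : bmf f -> bmf (fun x => p.[f x]).
Proof.
move=> hf; elim/poly_ind: p => [|p c IH].
  by under [X in bmf X]eq_fun do rewrite horner0; exact: bmf_cst.
under [X in bmf X]eq_fun do rewrite hornerMXaddC.
by apply: bmfD; [exact: bmfM|exact: bmf_cst].
Qed.

Lemma eq_Bint f g : (forall x, S x -> f x = g x) -> Bint f = Bint g.
Proof. by move=> fg; apply: eq_Rintegral => x /set_mem; exact: fg. Qed.

Lemma BintD f g : bmf f -> bmf g -> Bint (fun x => f x + g x) = Bint f + Bint g.
Proof. by move=> /bmf_integrable hf /bmf_integrable hg; rewrite /Bint RintegralD. Qed.

Lemma BintB f g : bmf f -> bmf g -> Bint (fun x => f x - g x) = Bint f - Bint g.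
Proof. by move=> /bmf_integrable hf /bmf_integrable hg; rewrite /Bint RintegralB. Qed.

Lemma BintZ c f : bmf f -> Bint (fun x => c * f x) = c * Bint f.
Proof. by move=> /bmf_integrable hf; rewrite /Bint RintegralZl. Qed.

Lemma Bint_sum I (r : seq I) (f : I -> T -> R) : (forall i, bmf (f i)) ->
  Bint (fun x => \sum_(i <- r) f i x) = \sum_(i <- r) Bint (f i).
Proof.
move=> hf; elim: r => [|i r IH].
  rewrite big_nil -[RHS](mul0r (Bint (fun=> 1))) -BintZ; last exact: bmf_cst.
  by apply: eq_Bint => x _; rewrite big_nil mul0r.
rewrite big_cons -IH -BintD//; last exact: bmf_sum.
by apply: eq_Bint => x _; rewrite big_cons.
Qed.

Lemma Bint_ge0 f : (forall x, S x -> 0 <= f x) -> 0 <= Bint f.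
Proof. exact: Rintegral_ge0. Qed.

Lemma le_Bint f g : bmf f -> bmf g -> (forall x, S x -> f x <= g x) -> Bint f <= Bint g.
Proof.
by move=> /bmf_integrable hf /bmf_integrable hg; exact: le_Rintegral.
Qed.

Lemma Bint_cst c : mu S = 1%E -> Bint (fun=> c) = c.
Proof.
move=> S1; transitivity (c * fine (mu S)); first exact: Rintegral_cst.
by rewrite S1 mulr1.
Qed.

Lemma bmf_max0 f : bmf f -> bmf (fun x => Num.max (f x) 0).
Proof.
move=> [mf [M hM]]; split; first exact: measurable_maxr.
exists M => x Sx; apply: le_trans (hM x Sx).
by case: (leP (f x) 0) => // _; rewrite normr0.
Qed.

Lemma bmfN f : bmf f -> bmf (fun x => - f x).
Proof. by move=> bf; have := bmfZ (- 1) bf; under eq_fun do rewrite mulN1r. Qed.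

Lemma max0_split (a : R) : a = Num.max a 0 - Num.max (- a) 0.
Proof. by case: (leP a 0) => h; case: (leP (- a) 0) => h'; lra. Qed.

Lemma Bint_max0 f : bmf f ->
  Bint f = Bint (fun x => Num.max (f x) 0) - Bint (fun x => Num.max (- f x) 0).
Proof.
move=> bf; rewrite -BintB; [|exact: bmf_max0|exact/bmf_max0/bmfN].
by apply: eq_Bint => x _; exact: max0_split.
Qed.

Definition bmf2 (k : T * T -> R) := measurable_fun [set: T * T] k /\
  exists M, forall x y, S x -> S y -> `|k (x, y)| <= M.

Lemma bmf2_l k x : bmf2 k -> S x -> bmf (fun y => k (x, y)).
Proof.
move=> [mk [M hM]] Sx; split; first exact: measurableT_comp.
by exists M => y; exact: hM.
Qed.

Lemma bmf2_r k y : bmf2 k -> S y -> bmf (fun x => k (x, y)).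
Proof.
move=> [mk [M hM]] Sy; split; first exact: measurableT_comp.
by exists M => x Sx; exact: hM.
Qed.

Lemma bmf2_fst f : bmf f -> bmf2 (fun p => f p.1).
Proof.
move=> [mf [M hM]]; split; first exact: measurableT_comp.
by exists M => x y Sx _; exact: hM.
Qed.

Lemma bmf2_snd f : bmf f -> bmf2 (fun p => f p.2).
Proof.
move=> [mf [M hM]]; split; first exact: measurableT_comp.
by exists M => x y _ Sy; exact: hM.
Qed.

Lemma bmf2D k l : bmf2 k -> bmf2 l -> bmf2 (fun p => k p + l p).
Proof.
move=> [mf [M hM]] [mg [N hN]]; split; first exact: measurable_funD.
by exists (M + N) => x y Sx Sy; rewrite (le_trans (ler_normD _ _))// lerD ?hM ?hN.
Qed.

Lemma bmf2M k l : bmf2 k -> bmf2 l -> bmf2 (fun p => k p * l p).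
Proof.
move=> [mf [M hM]] [mg [N hN]]; split; first exact: measurable_funM.
by exists (M * N) => x y Sx Sy; rewrite normrM ler_pM ?hM ?hN.
Qed.

Lemma bmf2_horner (p : {poly R}) f : bmf2 f -> bmf2 (fun x => p.[f x]).
Proof.
have cst c : bmf2 (fun=> c) by split => //; exists `|c|.
move=> hf; elim/poly_ind: p => [|p c IH].
  by under [X in bmf2 X]eq_fun do rewrite horner0; exact: cst.
under [X in bmf2 X]eq_fun do rewrite hornerMXaddC.
by apply: bmf2D => //; exact: bmf2M.
Qed.

Lemma BintE f : Bint f = fine (\int[mu]_x (\1_S x * f x)%:E).
Proof.
rewrite /Bint /Rintegral integral_mkcond; congr fine; apply: eq_integral => y _.
by rewrite patchE indicE; case: ifP => _; rewrite ?mul1r ?mul0r.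
Qed.

Lemma bmf_Bint k : bmf2 k -> mu S = 1%E -> bmf (fun x => Bint (fun y => k (x, y))).
Proof.
move=> hk S1; have [mk [M hM]] := hk; split; last first.
  exists M => x Sx; have hx := bmf2_l hk Sx.
  rewrite -(Bint_cst M S1) (le_trans (le_normr_Rintegral _ _))//; first exact: bmf_integrable.
  apply: le_Bint; [|exact: bmf_cst|by move=> y; exact: hM].
  by case: hx => m1 [N hN]; split; [exact: measurableT_comp|exists N => y Sy; rewrite normr_id hN].
(* The indicator of [S] extends the inner integral to the whole space, where the Tonelli
   measurability result applies to the positive and negative parts. *)
pose kS (p : T * T) : \bar R := ((\1_S p.2)%:E * (k p)%:E)%E.
have mkS : measurable_fun setT kS.
  apply: emeasurable_funM; apply/measurable_EFinP => //.
  by apply: measurableT_comp => //; exact: measurable_indic.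
suff m1 : measurable_fun setT (fun x => \int[mu]_y kS (x, y))%E.
  have -> : (fun x => Bint (fun y => k (x, y))) = (fun x => fine (\int[mu]_y kS (x, y))%E).
    apply/funext => x; rewrite /Bint /Rintegral integral_mkcond; congr fine.
    apply: eq_integral => y _; rewrite /kS /= patchE indicE.
    by case: ifP => _; rewrite ?mul1e ?mul0e.
  exact: (measurableT_comp (@fine_measurable R setT measurableT) m1).
have -> : (fun x => \int[mu]_y kS (x, y))%E =
  (fun x => \int[mu]_y (kS^\+ (x, y)) - \int[mu]_y (kS^\- (x, y)))%E.
  apply/funext => x; rewrite integralE.
  by congr (_ - _)%E; apply: eq_integral => y _; rewrite ?funeposE ?funenegE.
apply: emeasurable_funB.
  by apply: measurable_fun_fubini_tonelli_F => //; exact: measurable_funepos.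
by apply: measurable_fun_fubini_tonelli_F => //; exact: measurable_funeneg.
Qed.

Lemma Bint_fubini k : bmf2 k ->
  Bint (fun x => Bint (fun y => k (x, y))) = Bint (fun y => Bint (fun x => k (x, y))).
Proof.
move=> hk; have [mk [M hM]] := hk.
(* Both indicators together turn a kernel bounded on [S] into one bounded everywhere, hence
   integrable for the product probability. *)
pose kS (p : T * T) : R := \1_S p.1 * \1_S p.2 * k p.
have mkS : measurable_fun setT kS.
  apply: measurable_funM => //; apply: measurable_funM.
    by apply: measurableT_comp => //; exact: measurable_indic.
  by apply: measurableT_comp => //; exact: measurable_indic.
have kSM p : `|kS p| <= `|M|.
  rewrite /kS !normrM !indicE.
  have [/set_mem h1|_] := boolP (p.1 \in S); last by rewrite normr0 !mul0r.
  have [/set_mem h2|_] := boolP (p.2 \in S); last by rewrite normr0 mulr0 mul0r.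
  rewrite normr1 !mul1r (le_trans _ (ler_norm M))//; case: p h1 h2 => x y; exact: hM.
have i2 : (mu \x mu)%E.-integrable setT (EFin \o kS).
  apply: (@measurable_bounded_integrable _ _ _ (mu \x mu)%E) => //.
    by rewrite (le_lt_trans (probability_le1 _ _))// ltry.
  exists `|M|; split; first exact: num_real.
  by move=> K MK p _ /=; rewrite (le_trans (kSM p))// ltW.
have E1 x : (\int[mu]_y (kS (x, y))%:E)%E = (\1_S x * Bint (fun y => k (x, y)))%:E.
  have [Sx|Sx] := boolP (x \in S); last first.
    rewrite indicE (negbTE Sx) mul0r; apply: integral0_eq => y _.
    by rewrite /kS /= indicE (negbTE Sx) !mul0r.
  rewrite indicE Sx mul1r BintE fineK.
    by apply: eq_integral => y _; rewrite /kS /= [X in X * _ * _]indicE Sx mul1r.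
  have := integrable_fin_num mS (bmf_integrable (bmf2_l hk (set_mem Sx))).
  rewrite integral_mkcond; congr (_ \is a fin_num); apply: eq_integral => y _.
  by rewrite patchE indicE; case: ifP => _ /=; rewrite ?mul1r ?mul0r.
have E2 y : (\int[mu]_x (kS (x, y))%:E)%E = (\1_S y * Bint (fun x => k (x, y)))%:E.
  have [Sy|Sy] := boolP (y \in S); last first.
    rewrite indicE (negbTE Sy) mul0r; apply: integral0_eq => x _.
    by rewrite /kS /= [X in _ * X * _]indicE (negbTE Sy) mulr0 mul0r.
  rewrite indicE Sy mul1r BintE fineK.
    by apply: eq_integral => x _; rewrite /kS /= [X in _ * X * _]indicE Sy mulr1.
  have := integrable_fin_num mS (bmf_integrable (bmf2_r hk (set_mem Sy))).
  rewrite integral_mkcond; congr (_ \is a fin_num); apply: eq_integral => x _.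
  by rewrite patchE indicE; case: ifP => _ /=; rewrite ?mul1r ?mul0r.
rewrite BintE [RHS]BintE; congr fine.
under eq_integral do rewrite -E1.
under [RHS]eq_integral do rewrite -E2.
exact: (Fubini i2).
Qed.

Lemma cvg_Bint (f_ : nat -> T -> R) (f : T -> R) (M : R) :
  (forall n, measurable_fun setT (f_ n)) -> measurable_fun setT f ->
  (forall n x, S x -> `|f_ n x| <= M) -> (forall x, S x -> f_ n x @[n --> \oo] --> f x) ->
  Bint (f_ n) @[n --> \oo] --> Bint f.
Proof.
move=> mf_ mf hM cvf.
have iM : mu.-integrable S (EFin \o cst M).
  by apply: bmf_integrable; exact: bmf_cst.
have bf : bmf f.
  split => //; exists M => x Sx.
  have cv : `|f_ n x| @[n --> \oo] --> `|f x| by apply: cvg_norm; exact: cvf.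
  apply: (cvgr_to_le cv).
  by apply: nearW => n; exact: hM.
have H := @dominated_cvg _ T R mu S mS (fun n => EFin \o f_ n) (EFin \o f) (EFin \o cst M).
apply: fine_cvg; rewrite fineK; last exact: integrable_fin_num (bmf_integrable bf).
apply: H => //.
- by move=> n; apply/measurable_EFinP; exact: measurable_funTS.
- by move=> x Sx; apply: cvg_EFin; [exact: nearW|exact: cvf].
Qed.

End bounded_integral.

(** * Means of zonal products and the spherical Laplacian *)

Section sphere_integrals.
Variables (R : realType) (d : nat).
Hypothesis hd : (2 <= d)%N.
Local Notation T := (d.-tuple R).
Local Notation S := (@sphere R d).
Local Notation mu := (smu R d).
Local Notation I := (Bint mu S).
Local Notation mS := (@measurable_sphere R d).

Let d_gt0 : (0 < d)%N. Proof. exact: ltn_trans hd. Qed.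

Lemma integral_smu_sphere (g : T -> \bar R) : measurable_fun setT g -> (forall x, 0 <= g x)%E ->
  (\int[mu]_x g x = \int[mu]_(x in S) g x)%E.
Proof.
move=> mg g0; rewrite (@ge0_negligible_integral _ _ _ _ setT (~` S))//.
- by rewrite setDE setCK setTI.
- exact: measurableC mS.
- rewrite [LHS](@probability_setC _ _ _ mu S)//; last exact: mS.
  by rewrite smu_sphere// subee.
Qed.

Lemma Eg_homog_ge0 (f : T -> R) k : bmf S f -> (forall x, 0 <= f x) ->
  (forall s x, 0 <= s -> f (scalet s x) = s ^+ k * f x) ->
  (gaussn R d).-integrable setT (EFin \o f) /\ Eg f = krad R d k * I f.
Proof.
move=> bf f0 fh; have [mf _] := bf.
have mEf : measurable_fun setT (EFin \o f) by exact/measurable_EFinP.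
have Ef0 x : (0 <= (EFin \o f) x)%E by rewrite lee_fin.
have IS : (\int[mu]_x (EFin \o f) x)%E = (I f)%:E.
  rewrite integral_smu_sphere// /Bint /Rintegral fineK//.
  exact: (integrable_fin_num mS (bmf_integrable mu mS bf)).
have IG : (\int[gaussn R d]_x (EFin \o f) x)%E = (krad R d k * I f)%:E.
  rewrite EFinM -IS -integral_radial//; last by rewrite IS ltry.
  apply: ge0_ae_eq_integral => //.
  - apply: emeasurable_funM; first exact: (measurableT_comp mEf (@measurable_nrm R d)).
    by apply/measurable_EFinP; apply: measurable_funX; exact: measurable_enorm.
  - by move=> x _; rewrite mule_ge0// lee_fin exprn_ge0// enorm_ge0.
  exists [set x | enorm x = 0]; split => //.
  - exact: measurable_enorm0.
  - exact: gaussn_enorm0.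
  move=> x /=; apply: contra_notP => /eqP x0 _; rewrite -EFinM mulrC -fh ?enorm_ge0//.
  by rewrite scaletA divff// scalet1.
split; last by rewrite /Eg /Rintegral IG.
apply/integrableP; split => //.
under eq_integral do rewrite gee0_abs//.
by rewrite IG ltry.
Qed.

(** Carries Gaussian identities to the sphere: each homogeneous term picks up the radial moment of
    its degree. *)
Lemma Eg_homog (f : T -> R) k : bmf S f ->
  (forall s x, 0 <= s -> f (scalet s x) = s ^+ k * f x) -> Eg f = krad R d k * I f.
Proof.
move=> bf fh; have [mf [M hM]] := bf.
pose p x := Num.max (f x) 0; pose m x := Num.max (- f x) 0.
have fE x : f x = p x - m x by exact: max0_split.
have bp : bmf S p by exact: bmf_max0.
have bm : bmf S m by exact/bmf_max0/bmfN.
have p0 x : 0 <= p x by rewrite le_max lexx orbT.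
have m0 x : 0 <= m x by rewrite le_max lexx orbT.
have ph s x : 0 <= s -> p (scalet s x) = s ^+ k * p x.
  by move=> s0; rewrite /p fh// maxr_pMr ?mulr0// exprn_ge0.
have mh s x : 0 <= s -> m (scalet s x) = s ^+ k * m x.
  by move=> s0; rewrite /m fh// maxr_pMr ?mulr0 ?mulrN// exprn_ge0.
have [ip Ep] := Eg_homog_ge0 bp p0 ph; have [im Em] := Eg_homog_ge0 bm m0 mh.
have -> : f = fun x => p x - m x by exact/funext.
by rewrite (BintB mu mS)// mulrBr -Ep -Em /Eg RintegralB.
Qed.

Lemma bmf_dotp x : bmf S (dotp x).
Proof.
split; first exact: measurable_dotp.
pose n := scalet (enorm x)^-1 x; exists (enorm x) => y Sy.
have [x0|x0] := eqVneq (enorm x) 0.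
  have : dotp x x = 0 by rewrite -enorm_sqr x0 expr0n.
  move=> /eqP; rewrite psumr_eq0 => [/allP h|i _]; last by rewrite -expr2 sqr_ge0.
  rewrite x0 /dotp big1 ?normr0// => i _; have := h i; rewrite mem_index_enum => /(_ isT).
  by rewrite /= mulf_eq0 orbb => /eqP ->; rewrite mul0r.
have xp : 0 < enorm x by rewrite lt_neqAle eq_sym x0 enorm_ge0.
have := dotp_le1 (sphere_nrm xp) Sy; rewrite dotpZl -ler_norml normrM ger0_norm ?invr_ge0 ?enorm_ge0//.
by rewrite mulrC ler_pdivrMr// mul1r.
Qed.

Lemma bmf_hdotp (p : {poly R}) x : bmf S (fun y => p.[dotp x y]).
Proof. exact: bmf_horner (bmf_dotp x). Qed.

Lemma I_cst c : I (fun=> c) = c.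
Proof. by apply: Bint_cst; [exact: mS|exact: smu_sphere]. Qed.

Definition zpair (x z : T) (f g : {poly R}) := I (fun y => f.[dotp x y] * g.[dotp z y]).

Lemma zpairC x z f g : zpair x z f g = zpair z x g f.
Proof. by apply: eq_Bint => y _; rewrite mulrC. Qed.

Let bfg x z f g : bmf S (fun y => f.[dotp x y] * g.[dotp z y]).
Proof. by apply: bmfM; exact: bmf_hdotp. Qed.

Lemma zpairDl x z f1 f2 g : zpair x z (f1 + f2) g = zpair x z f1 g + zpair x z f2 g.
Proof.
rewrite -(BintD mu mS (bfg x z f1 g) (bfg x z f2 g)).
by apply: eq_Bint => y _; rewrite hornerD mulrDl.
Qed.

Lemma zpairDr x z f g1 g2 : zpair x z f (g1 + g2) = zpair x z f g1 + zpair x z f g2.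
Proof. by rewrite zpairC zpairDl zpairC [X in _ + X]zpairC. Qed.

Lemma zpairZl x z c f g : zpair x z (c *: f) g = c * zpair x z f g.
Proof.
rewrite -(BintZ mu mS c (bfg x z f g)).
by apply: eq_Bint => y _; rewrite hornerZ mulrA.
Qed.

Lemma zpairZr x z c f g : zpair x z f (c *: g) = c * zpair x z f g.
Proof. by rewrite zpairC zpairZl zpairC. Qed.

Lemma zpairBl x z f1 f2 g : zpair x z (f1 - f2) g = zpair x z f1 g - zpair x z f2 g.
Proof. by rewrite zpairDl -scaleN1r zpairZl mulN1r. Qed.

Lemma zpair_suml x z J (r : seq J) (F : J -> {poly R}) g :
  zpair x z (\sum_(i <- r) F i) g = \sum_(i <- r) zpair x z (F i) g.
Proof.
elim: r => [|i r IH]; last by rewrite !big_cons zpairDl IH.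
by rewrite !big_nil -(scale0r 0) zpairZl mul0r.
Qed.

Lemma zpair_sumr x z J (r : seq J) (F : J -> {poly R}) g :
  zpair x z g (\sum_(i <- r) F i) = \sum_(i <- r) zpair x z g (F i).
Proof. by rewrite zpairC zpair_suml; apply: eq_bigr => i _; rewrite zpairC. Qed.

(** The Gaussian identity relates the degrees [j + k + 1] and [j + k - 1]. On the sphere the ratio
    of their radial moments, given by [kradS], remains as the factor on the left. *)
Lemma zpairXX x z j k : sphere x ->
  ((j + k)%:R + d%:R - 1) * zpair x z 'X^(j.+1) 'X^k =
  j%:R * zpair x z 'X^(j.-1) 'X^k + k%:R * dotp x z * zpair x z 'X^j 'X^(k.-1).
Proof.
move=> Sx.
have hom (a b : nat) s y : 0 <= s ->
    ('X^a).[dotp x (scalet s y)] * ('X^b).[dotp z (scalet s y)] =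
    s ^+ (a + b) * (('X^a).[dotp x y] * ('X^b).[dotp z y]) :> R.
  by move=> _; rewrite !hornerXn !dotpZr !exprMn exprD; ring.
have E a b : Eg (fun y => ('X^a).[dotp x y] * ('X^b).[dotp z y]) =
    krad R d (a + b) * zpair x z 'X^a 'X^b.
  by apply: Eg_homog => // s y; exact: hom.
have pg (a b : {poly R}) : pgrow (fun y => a.[dotp x y] * b.[dotp z y]).
  by apply: pgrowM; apply: pgrow_horner; exact: pgrow_dotp.
have : Eg (fun y => ('X^(j.+1)).[dotp x y] * ('X^k).[dotp z y]) =
    Eg (fun y => j%:R * (('X^(j.-1)).[dotp x y] * ('X^k).[dotp z y]) +
      k%:R * dotp x z * (('X^j).[dotp x y] * ('X^(k.-1)).[dotp z y])).
  etransitivity; [|etransitivity; [exact: (gauss_ibp 'X^j 'X^k 0 0 x z)|]]; apply: eq_Eg => y.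
    by rewrite !add0r !hornerXn exprS mulrA.
  by rewrite (sphere_dotp Sx) !derivXn !add0r !hornerMn -[_ *+ j]mulr_natl -[_ *+ k]mulr_natl; ring.
rewrite EgD; last 2 first.
- by apply: pgrowM; [exact: pgrow_cst|exact: pg].
- by apply: pgrowM; [exact: pgrow_cst|exact: pg].
rewrite EgZ// EgZ// !E.
(* The predecessors are truncated at 0, exactly where the coefficients [j] and [k] vanish. *)
case: j => [|j]; case: k => [|k] /=; rewrite ?mul0r ?add0r ?addr0.
- move=> /eqP; rewrite mulf_eq0 gt_eqF/= ?krad_gt0// => /eqP ->; by rewrite mulr0.
- rewrite add1n kradS// => e; apply: (mulfI (lt0r_neq0 (krad_gt0 R d k))).
  transitivity ((k + d)%:R * krad R d k * zpair x z 'X^1 'X^(k.+1)).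
    by rewrite add0n !natrD -natr1; ring.
  by rewrite e; ring.
- rewrite !addn0 kradS// => e; apply: (mulfI (lt0r_neq0 (krad_gt0 R d j))).
  transitivity ((j + d)%:R * krad R d j * zpair x z 'X^(j.+2) 'X^0).
    by rewrite !natrD -natr1; ring.
  by rewrite e; ring.
- rewrite !addSn !addnS kradS// => e; apply: (mulfI (lt0r_neq0 (krad_gt0 R d (j + k).+1))).
  transitivity (((j + k).+1 + d)%:R * krad R d (j + k).+1 * zpair x z 'X^(j.+2) 'X^(k.+1)).
    by rewrite natrD -natr1; ring.
  by rewrite e; ring.
Qed.

(** The recursion on monomials, extended bilinearly. It is the divergence theorem on the sphere for
    the tangential part [x - (x'y) y] of [x], whose divergence is [- (d - 1) x'y]. *)
Lemma zpair_ibp x z f g : sphere x ->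
  (d%:R - 1) * zpair x z ('X * f) g =
  zpair x z ((1 - 'X^2) * f^`()) g + dotp x z * zpair x z f g^`() - zpair x z ('X * f) ('X * g^`()).
Proof.
move=> Sx; elim/poly_lin_ind: f => [p q hp hq|c p hp|j].
- rewrite derivD !mulrDr !zpairDl !mulrDr hp hq; ring.
- rewrite derivZ -!scalerAr !zpairZl mulrCA hp; ring.
elim/poly_lin_ind: g => [p q hp hq|c p hp|k].
- rewrite derivD !mulrDr !zpairDr !mulrDr hp hq; ring.
- rewrite derivZ -!scalerAr !zpairZr mulrCA hp; ring.
rewrite !derivXn -['X^_ *+ j]scaler_nat -['X^_ *+ k]scaler_nat [(1 - 'X^2) * _]mulrBl mul1r zpairBl -!scalerAr -exprD -(exprS 'X j) -(exprS 'X k.-1).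
rewrite !zpairZr !zpairZl.
have := zpairXX z j k Sx.
have -> : k%:R * zpair x z 'X^(j.+1) 'X^(k.-1.+1) = k%:R * zpair x z 'X^(j.+1) 'X^k.
  by case: (k) => [|k'] //; rewrite !mul0r.
have -> : j%:R * zpair x z 'X^(2 + j.-1) 'X^k = j%:R * zpair x z 'X^(j.+1) 'X^k.
  by case: (j) => [|j'] //; rewrite !mul0r.
rewrite natrD; lra.
Qed.

(** Both sides are minus the Dirichlet form, the mean of [f'(x'y) g'(z'y) (x'z - (x'y)(z'y))], in
    which the two functions play symmetric roles. *)
Lemma zpair_legop x z f g : sphere x -> sphere z ->
  zpair x z (legop (d%:R - 1) f) g = zpair x z f (legop (d%:R - 1) g).
Proof.
have E a b f' g' : sphere a -> zpair a b (legop (d%:R - 1) f') g' =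
    zpair a b ('X * f'^`()) ('X * g'^`()) - dotp a b * zpair a b f'^`() g'^`().
  by move=> Sa; have := zpair_ibp b f'^`() g' Sa; rewrite /legop zpairBl zpairZl; lra.
move=> Sx Sz; rewrite E// [RHS]zpairC E// dotpC; congr (_ - _ * _); exact: zpairC.
Qed.

Local Notation Z m := (gegq R m d).

Lemma zpair_orth x z m n : sphere x -> sphere z -> m != n -> zpair x z (Z m) (Z n) = 0.
Proof.
move=> Sx Sz mn; have := zpair_legop (Z m) (Z n) Sx Sz.
rewrite !legop_gegq// (zpairZl _ _ (- _) (Z m)) (zpairZr _ _ (- _) _ (Z n)) => /eqP.
rewrite -subr_eq0 -mulrBl mulf_eq0 => /orP[|/eqP//].
rewrite opprK addrC legeigB mulf_eq0 => /orP[|].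
  by rewrite subr_eq0 eqr_nat eq_sym (negbTE mn).
have d2 : 2 <= d%:R :> R by rewrite ler_nat.
have := ltn0Sn 0; have : (0 < m + n)%N by move: mn; case: (m) => //; case: (n).
rewrite -(ltr_nat R) natrD; lra.
Qed.

End sphere_integrals.

(** * The reproducing property of the zonal polynomials *)

Section reproducing.
Variables (R : realType) (d : nat).
Hypothesis hd : (2 <= d)%N.
Local Notation T := (d.-tuple R).
Local Notation S := (@sphere R d).
Local Notation mu := (smu R d).
Local Notation I := (Bint mu S).
Local Notation mS := (@measurable_sphere R d).
Local Notation Z m := (gegq R m d).

Lemma lead_gegq_gt0 n : 0 < (Z n)`_n.
Proof.
rewrite lead_gegq//; apply: prodr_gt0 => i _; have i0 : 0 <= i%:R :> R by exact: ler0n.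
have d2 : 2 <= d%:R :> R by rewrite ler_nat.
by apply: divr_gt0; lra.
Qed.

Lemma gegq_expansion n (p : {poly R}) : (size p <= n)%N ->
  exists b : nat -> R, p = \sum_(m < n) b m *: Z m.
Proof.
elim: n p => [|n IH] p sp.
  by exists (fun=> 0); rewrite big_ord0; apply/eqP; rewrite -size_poly_eq0 -leqn0.
pose c := p`_n / (Z n)`_n.
have /IH[b pb] : (size (p - c *: Z n)%R <= n)%N.
  apply/leq_sizeP => j; rewrite leq_eqVlt => /orP[/eqP <-|nj].
    by rewrite coefB coefZ mulfVK ?subrr// lt0r_neq0// lead_gegq_gt0.
  rewrite coefB coefZ !nth_default ?mulr0 ?subrr//.
    exact: leq_trans (size_gegq _ _ hd) nj.
  exact: leq_trans nj.
exists (fun m => if m == n then c else b m); rewrite big_ord_recr/= eqxx.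
rewrite -[LHS](subrK (c *: Z n)) pb; congr (_ + _); apply: eq_bigr => i _.
by rewrite ltn_eqF.
Qed.

(** The recursion of [zpairXX] solved along [j = k]; it is the reciprocal of the leading coefficient
    of [Z j]. *)
Let cst j : R := \prod_(i < j) ((i%:R + 1) / (i%:R * 2 + d%:R)).

(** In the recursion a factor [x'z] appears only when both exponents drop by one, hence the degree
    bound [minn j k]. *)
Lemma zpairXX_poly N j k : (j + k <= N)%N -> exists s : {poly R},
  [/\ (size s <= (minn j k).+1)%N, j = k -> s`_j = cst j &
    forall x z : T, S x -> S z -> zpair x z 'X^j 'X^k = s.[dotp x z]].
Proof.
elim: N j k => [|N IH] j k jkN.
  have [-> ->] : j = 0%N /\ k = 0%N by lia.
  exists 1; split => [|_|x z _ _].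
  - by rewrite size_poly1.
  - by rewrite /cst big_ord0 coef1.
  rewrite hornerE -[RHS](I_cst hd); apply: eq_Bint => y _.
  by rewrite !expr0 !hornerE.
have step j' k' : (j'.+1 + k' <= N.+1)%N -> exists s : {poly R},
  [/\ (size s <= (minn j'.+1 k').+1)%N, j'.+1 = k' -> s`_(j'.+1) = cst j'.+1 &
    forall x z : T, S x -> S z -> zpair x z 'X^(j'.+1) 'X^k' = s.[dotp x z]].
  move=> jk.
  have [|s1 [z1 _ e1]] := IH j'.-1 k'; first lia.
  have [|s2 [z2 c2 e2]] := IH j' k'.-1; first lia.
  have D0 : (j' + k')%:R + d%:R - 1 != 0 :> R.
    have h0 : 0 <= (j' + k')%:R :> R by exact: ler0n.
    have d2 : 2 <= d%:R :> R by rewrite ler_nat.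
    by apply: lt0r_neq0; lra.
  exists (((j' + k')%:R + d%:R - 1)^-1 *: (j'%:R *: s1 + k'%:R *: ('X * s2))); split.
  - apply: leq_trans (size_scale_leq _ _) _; apply: leq_trans (size_polyD _ _) _.
    rewrite geq_max; apply/andP; split.
      by apply: leq_trans (size_scale_leq _ _) _; apply: leq_trans z1 _; lia.
    case: (k') z2 => [|k''] z2; first by rewrite scale0r size_poly0.
    apply: leq_trans (size_scale_leq _ _) _; apply: leq_trans (size_polyMleq _ _) _.
    by rewrite size_polyX; move: z2 => /=; lia.
  - move=> jk'; rewrite -jk' /= in c2 z1 *; rewrite coefZ coefD !coefZ coefXM /= c2//.
    (* The term that keeps the second exponent has degree below [j'.+1] and does not reach the top
       coefficient. *)
    rewrite nth_default ?mulr0 ?add0r; last by apply: leq_trans z1 _; lia.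
    have -> : (j' + j'.+1)%:R + d%:R - 1 = j'%:R * 2 + d%:R :> R.
      by rewrite addnS -natr1 natrD; ring.
    by rewrite /cst big_ord_recr /= -/(cst j') -natr1; ring.
  move=> x z Sx Sz; apply: (mulfI D0); rewrite zpairXX// e1// e2//.
  by rewrite hornerZ mulrA divff// mul1r hornerD !hornerZ hornerM hornerX; ring.
(* The recursion lowers the first exponent; when that is 0, [x] and [z] are exchanged. *)
case: j jkN => [|j]; last exact: step.
case: k => [|k] jkN; first by apply: IH.
have [|s [zs _ es]] := step k 0%N; first lia.
exists s; split => //.
by move=> x z Sx Sz; rewrite zpairC es// dotpC.
Qed.

(** The top coefficient is the square of that of [Z n] times [cst n], hence again that of [Z n], and
    the difference drops below degree [n]. *)
Lemma zpair_gegq_poly n : exists2 s : {poly R}, (size (s - Z n)%R <= n)%N &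
    forall x z : T, S x -> S z -> zpair x z (Z n) (Z n) = s.[dotp x z].
Proof.
have /choice[F hF] : forall jk : nat * nat, exists s : {poly R},
  [/\ (size s <= (minn jk.1 jk.2).+1)%N, jk.1 = jk.2 -> s`_jk.1 = cst jk.1 &
    forall x z : T, S x -> S z -> zpair x z 'X^(jk.1) 'X^(jk.2) = s.[dotp x z]].
  by move=> [j k]; exact: zpairXX_poly (leqnn _).
have ZE : Z n = \sum_(i < n.+1) (Z n)`_i *: 'X^i.
  rewrite -poly_def; apply/polyP => i; rewrite coef_poly; case: ltnP => // ni.
  by rewrite nth_default//; exact: leq_trans (size_gegq _ _ hd) ni.
exists (\sum_(i < n.+1) \sum_(j < n.+1) ((Z n)`_i * (Z n)`_j) *: F (i : nat, j : nat)).
  have sF (i j : nat) : (size (F (i, j)) <= (minn i j).+1)%N.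
    by have [] := hF (i, j).
  apply/leq_sizeP => k; rewrite leq_eqVlt => /orP[/eqP <-|nk].
    rewrite coefB coef_sum big_ord_recr/= coef_sum big_ord_recr/=.
    rewrite big1 ?add0r; last first.
      move=> i _; rewrite coef_sum big1// => j _; rewrite coefZ [X in _ * X]nth_default ?mulr0//.
      apply: leq_trans (sF i j) _ => /=.
      by rewrite (leq_trans _ (ltn_ord i))// ltnS geq_minl.
    rewrite big1 ?add0r; last first.
      move=> j _; rewrite coefZ [X in _ * X]nth_default ?mulr0//.
      apply: leq_trans (sF n j) _ => /=.
      by rewrite (leq_trans _ (ltn_ord j))// ltnS geq_minr.
    rewrite coefZ; have [_ /= -> // _] := hF (n, n).
    rewrite -mulrA; have -> : (Z n)`_n * cst n = 1.
      rewrite lead_gegq// -big_split/= big1// => i _.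
      have i0 : 0 <= i%:R :> R by exact: ler0n.
      have d2 : 2 <= d%:R :> R by rewrite ler_nat.
      by field; apply/andP; split; apply: lt0r_neq0; lra.
    by rewrite mulr1 subrr.
  rewrite coefB coef_sum big1 => [|i _].
    by rewrite sub0r nth_default ?oppr0//; exact: leq_trans (size_gegq _ _ hd) nk.
  rewrite coef_sum big1// => j _; rewrite coefZ [X in _ * X]nth_default ?mulr0//.
  by apply: leq_trans (sF i j) _; apply: leq_trans nk; rewrite ltnS (leq_trans (geq_minl _ _))// -ltnS ltn_ord.
move=> x z Sx Sz; rewrite [in LHS]ZE zpair_suml// horner_sum; apply: eq_bigr => i _.
rewrite zpairZl// zpair_sumr// mulr_sumr horner_sum; apply: eq_bigr => j _.
by rewrite zpairZr// mulrA hornerZ; have [_ _ ->] := hF (i : nat, j : nat).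
Qed.

Lemma bmf2_dotp : bmf2 S (fun p : T * T => dotp p.1 p.2).
Proof.
split; first exact: measurable_dotp2.
by exists 1 => x y Sx Sy; rewrite ler_norml dotp_le1.
Qed.

Lemma zpair_gegq n (x z : T) : S x -> S z -> zpair x z (Z n) (Z n) = (Z n).[dotp x z].
Proof.
elim/ltn_ind: n x z => n IH x z Sx Sz.
have [s ss es] := zpair_gegq_poly n.
have [b sb] := gegq_expansion ss.
suff -> : zpair x z (Z n) (Z n) = (Z n + (s - Z n)).[dotp x z].
  rewrite sb big1 ?addr0// => m _; have mn := ltn_ord m.
  (* The coefficient is read off by pairing with [Z m], which reproduces by induction. Exchanging
     the integrals leaves a pairing of [Z n] with [Z m], which is 0. *)
  suff : b m * hdim R m d = 0.
    by move=> /eqP; rewrite mulf_eq0 orbC gt_eqF ?hdim_gt0//= => /eqP ->; rewrite scale0r.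
  have <- : zpair x x (s - Z n) (Z m) = b m * hdim R m d.
    rewrite sb zpair_suml// (bigD1 m)//= (zpairZl _ _ (b m) (Z m))// IH// (sphere_dotp Sx) gegq1//.
    rewrite big1 ?addr0// => i im; rewrite (zpairZl _ _ (b i) (Z i))// zpair_orth// mulr0//.
  rewrite zpairBl// [X in _ - X]zpair_orth ?gtn_eqF// subr0.
  transitivity (I (fun z => I (fun y => (Z n).[dotp x y] * (Z n).[dotp z y] * (Z m).[dotp x z]))).
    apply: eq_Bint => w Sw; rewrite -es// mulrC /zpair -(BintZ mu mS).
      by apply: eq_Bint => y _; rewrite mulrC.
    by apply: bmfM; exact: bmf_hdotp.
  rewrite (@Bint_fubini _ _ _ mu S mS
     (fun p => (Z n).[dotp x p.2] * (Z n).[dotp p.1 p.2] * (Z m).[dotp x p.1])); last first.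
    apply: bmf2M; last by apply: (bmf2_fst (f := fun y => (Z m).[dotp x y])); exact: bmf_hdotp.
    apply: bmf2M; first by apply: (bmf2_snd (f := fun y => (Z n).[dotp x y])); exact: bmf_hdotp.
    by apply: bmf2_horner; exact: bmf2_dotp.
  rewrite -[RHS](I_cst hd); apply: eq_Bint => y Sy /=.
  transitivity ((Z n).[dotp x y] * zpair y x (Z n) (Z m)).
    rewrite -(BintZ mu mS); last by apply: bmfM; exact: bmf_hdotp.
    by apply: eq_Bint => w _; rewrite mulrA (dotpC w y).
  by rewrite zpair_orth ?mulr0// gtn_eqF.
by rewrite es// addrC subrK.
Qed.

End reproducing.

(** * Completeness of the zonal projections *)

Section completeness.
Variables (R : realType) (d : nat).
Hypothesis hd : (2 <= d)%N.
Local Notation T := (d.-tuple R).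
Local Notation S := (@sphere R d).
Local Notation mu := (smu R d).
Local Notation I := (Bint mu S).
Local Notation mS := (@measurable_sphere R d).
Local Notation Z m := (gegq R m d).

Let S1 : mu S = 1%E. Proof. exact/smu_sphere/(ltn_trans _ hd). Qed.

Lemma bmf2_cst c : bmf2 S (fun=> c : R).
Proof. by split => //; exists `|c|. Qed.

Lemma bmf2Z c (k : T * T -> R) : bmf2 S k -> bmf2 S (fun p => c * k p).
Proof. exact: bmf2M (bmf2_cst c). Qed.

Lemma bmf2B (k l : T * T -> R) : bmf2 S k -> bmf2 S l -> bmf2 S (fun p => k p - l p).
Proof.
move=> hk hl; have := bmf2D hk (bmf2Z (- 1) hl); congr bmf2.
by apply/funext => x; rewrite mulN1r.
Qed.

Lemma bmf2_hdotp (p : {poly R}) : bmf2 S (fun q : T * T => p.[dotp q.1 q.2]).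
Proof. exact: bmf2_horner (bmf2_dotp _ _). Qed.

Definition II (k : T * T -> R) := I (fun x => I (fun y => k (x, y))).

Lemma eq_II k l : (forall x y, S x -> S y -> k (x, y) = l (x, y)) -> II k = II l.
Proof. by move=> kl; apply: eq_Bint => x Sx; apply: eq_Bint => y Sy; exact: kl. Qed.

Lemma IID k l : bmf2 S k -> bmf2 S l -> II (fun p => k p + l p) = II k + II l.
Proof.
move=> hk hl; rewrite -(BintD mu mS (bmf_Bint mS hk S1) (bmf_Bint mS hl S1)).
by apply: eq_Bint => x Sx; rewrite -(BintD mu mS (bmf2_l hk Sx) (bmf2_l hl Sx)).
Qed.

Lemma IIZ c k : bmf2 S k -> II (fun p => c * k p) = c * II k.
Proof.
move=> hk; rewrite -(BintZ mu mS c (bmf_Bint mS hk S1)).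
by apply: eq_Bint => x Sx; rewrite -(BintZ mu mS c (bmf2_l hk Sx)).
Qed.

Lemma le_II k l : bmf2 S k -> bmf2 S l -> (forall x y, S x -> S y -> k (x, y) <= l (x, y)) ->
  II k <= II l.
Proof.
move=> hk hl kl; apply: (@le_Bint _ _ _ mu _ mS); [exact: (bmf_Bint mS hk S1)|exact: (bmf_Bint mS hl S1)|move=> x Sx].
apply: (@le_Bint _ _ _ mu _ mS); [exact: bmf2_l|exact: bmf2_l|by move=> y Sy; exact: kl].
Qed.

Lemma II_ge0 k : (forall x y, S x -> S y -> 0 <= k (x, y)) -> 0 <= II k.
Proof. by move=> k0; apply: Bint_ge0 => x Sx; apply: Bint_ge0 => y Sy; exact: k0. Qed.

Lemma IIC k : bmf2 S k -> II k = II (fun p => k (p.2, p.1)).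
Proof. exact: (Bint_fubini mu mS). Qed.

(** The area in the denominator of [qker] is absorbed by integrating for the probability [smu]
    instead of sigma. *)
Definition Q n (F : T -> R) x := I (fun y => (Z n).[dotp x y] * F y).

(** By [Q_orth] this is the squared norm of [Q n F]. *)
Definition energy n F := I (fun x => F x * Q n F x).

Lemma bmf2_QF n F : bmf S F -> bmf2 S (fun p : T * T => (Z n).[dotp p.1 p.2] * F p.2).
Proof. by move=> bF; apply: bmf2M (bmf2_hdotp _) (bmf2_snd bF). Qed.

Lemma bmf_Q n F : bmf S F -> bmf S (Q n F).
Proof. by move=> bF; exact: (bmf_Bint mS (bmf2_QF n bF) S1). Qed.

Lemma eq_Q n F G x : (forall y, S y -> F y = G y) -> Q n F x = Q n G x.
Proof. by move=> FG; apply: eq_Bint => y Sy; rewrite FG. Qed.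

Lemma QB n F G x : bmf S F -> bmf S G -> Q n (fun y => F y - G y) x = Q n F x - Q n G x.
Proof.
have bZ : bmf S (fun y => (Z n).[dotp x y]) by exact: bmf_hdotp.
move=> bF bG; rewrite -(BintB mu mS (bmfM bZ bF) (bmfM bZ bG)).
by apply: eq_Bint => y _; rewrite mulrBr.
Qed.

Lemma QZ n c F x : bmf S F -> Q n (fun y => c * F y) x = c * Q n F x.
Proof.
have bZ : bmf S (fun y => (Z n).[dotp x y]) by exact: bmf_hdotp.
move=> bF; rewrite -(BintZ mu mS c (bmfM bZ bF)).
by apply: eq_Bint => y _; rewrite mulrCA.
Qed.

Lemma Q_sym n F G : bmf S F -> bmf S G -> I (fun x => G x * Q n F x) = I (fun x => F x * Q n G x).
Proof.
move=> bF bG.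
have E F' G' : bmf S F' -> I (fun x => G' x * Q n F' x) =
    II (fun p => (Z n).[dotp p.1 p.2] * (G' p.1 * F' p.2)).
  move=> bF'; apply: eq_Bint => x Sx; rewrite -(BintZ mu mS).
    by apply: eq_Bint => y _; ring.
  exact: (bmf2_l (bmf2_QF n bF') Sx).
rewrite (E F G bF) (E G F bG) IIC; last exact: bmf2M (bmf2_hdotp _) (bmf2M (bmf2_fst bG) (bmf2_snd bF)).
by apply: eq_II => x y _ _ /=; rewrite dotpC [G _ * _]mulrC.
Qed.

Lemma Q_comp n m F x : bmf S F -> S x -> Q n (Q m F) x = if n == m then Q n F x else 0.
Proof.
move=> bF Sx.
transitivity (II (fun p => (Z n).[dotp x p.1] * ((Z m).[dotp p.1 p.2] * F p.2))).
  apply: eq_Bint => y Sy; rewrite -(BintZ mu mS)//.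
  exact: (bmf2_l (bmf2_QF m bF) Sy).
have bx : bmf S (fun y => (Z n).[dotp x y]) by exact: bmf_hdotp.
rewrite IIC; last exact: bmf2M (bmf2_fst bx) (bmf2_QF m bF).
transitivity (I (fun w => F w * zpair x w (Z n) (Z m))).
  apply: eq_Bint => w Sw; rewrite -(BintZ mu mS).
    by apply: eq_Bint => y _ /=; rewrite (dotpC w y); ring.
  by apply: bmfM; exact: bmf_hdotp.
have [<-|nm] := eqVneq n m.
  by apply: eq_Bint => w Sw; rewrite zpair_gegq// mulrC.
rewrite -[RHS](I_cst hd); apply: eq_Bint => w Sw.
by rewrite zpair_orth// mulr0.
Qed.

Lemma Q_orth n m F : bmf S F ->
  I (fun x => Q n F x * Q m F x) = if n == m then energy n F else 0.
Proof.
move=> bF; rewrite Q_sym//; last exact: bmf_Q.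
have [<-|nm] := eqVneq n m.
  by apply: eq_Bint => x Sx; rewrite Q_comp// eqxx.
rewrite -[RHS](I_cst hd); apply: eq_Bint => x Sx.
by rewrite Q_comp// eq_sym (negbTE nm) mulr0.
Qed.

Lemma energy_ge0 n F : bmf S F -> 0 <= energy n F.
Proof.
move=> bF; have := Q_orth n n bF; rewrite eqxx => <-.
by apply: Bint_ge0 => x _; rewrite -expr2 sqr_ge0.
Qed.

Lemma residual_energy m F : bmf S F ->
  I (fun x => (F x - \sum_(n < m) Q n F x) ^+ 2) = I (fun x => F x ^+ 2) - \sum_(n < m) energy n F.
Proof.
move=> bF; elim: m => [|m IH].
  by rewrite big_ord0 subr0; apply: eq_Bint => x _; rewrite big_ord0 subr0.
have bS : bmf S (fun x => \sum_(n < m) Q n F x) by apply: bmf_sum => n; exact: bmf_Q.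
have bQ := bmf_Q m bF.
transitivity (I (fun x => ((F x - \sum_(n < m) Q n F x) ^+ 2 - 2 * (F x * Q m F x)) +
    ((2 * (Q m F x * \sum_(n < m) Q n F x)) + Q m F x * Q m F x))).
  by apply: eq_Bint => x _; rewrite big_ord_recr/=; ring.
rewrite (BintD mu mS); last 2 first.
- apply: bmfB; first by apply: bmfX; exact: bmfB.
  by apply: bmfZ; exact: bmfM.
- by apply: bmfD; [apply: bmfZ; exact: bmfM|exact: bmfM].
rewrite (BintB mu mS); last 2 first.
- by apply: bmfX; exact: bmfB.
- by apply: bmfZ; exact: bmfM.
rewrite (BintD mu mS); last 2 first.
- by apply: bmfZ; exact: bmfM.
- exact: bmfM.
rewrite IH (BintZ mu mS); last exact: bmfM.
rewrite (BintZ mu mS); last exact: bmfM.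
rewrite Q_orth// eqxx -/(energy m F).
have -> : I (fun x => Q m F x * \sum_(n < m) Q n F x) = 0.
  transitivity (I (fun x => \sum_(n < m) Q m F x * Q n F x)).
    by apply: eq_Bint => x _; rewrite mulr_sumr.
  rewrite (Bint_sum mu mS) ?big1// => [i _|i]; last by apply: bmfM => //; exact: bmf_Q.
  by rewrite Q_orth// gtn_eqF.
by rewrite big_ord_recr/=; ring.
Qed.

(* The kernels [((1 + t) / 2) ^+ m] concentrate at [t = 1]. *)
Definition Kpoly m : {poly R} := (2^-1 *: (1 + 'X)) ^+ m.

(** The closed form of kappa_m: each factor is the mean of [(1 + t) / 2] under the previous kernel,
    under which t has mean [i / (i + d - 1)]. *)
Definition Kmass m : R := \prod_(i < m) ((1 + i%:R / (i%:R + d%:R - 1)) / 2).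

Lemma Kmass_gt0 m : 0 < Kmass m.
Proof.
apply: prodr_gt0 => i _; have i0 : 0 <= i%:R :> R by exact: ler0n.
have d2 : 2 <= d%:R :> R by rewrite ler_nat.
by rewrite divr_gt0// ltr_wpDr// divr_ge0//; lra.
Qed.

(** For K the m-th kernel, [(1 - t^2) K' = m (1 - t) K]. Spherical integration by parts against 1
    then gives the mean of t, and with it the step from [m] to [m + 1]. *)
Lemma zpair_Kpoly x m : S x -> zpair x x (Kpoly m) 1 = Kmass m /\
  zpair x x ('X * Kpoly m) 1 = m%:R / (m%:R + d%:R - 1) * Kmass m.
Proof.
move=> Sx; have d2 : 2 <= d%:R :> R by rewrite ler_nat.
have X1 n : zpair x x ('X * Kpoly n) 1 = n%:R / (n%:R + d%:R - 1) * zpair x x (Kpoly n) 1.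
  have n0 : 0 <= n%:R :> R by exact: ler0n.
  have D0 : n%:R + d%:R - 1 != 0 :> R by apply: lt0r_neq0; lra.
  apply: (mulfI D0); rewrite mulrA mulrCA divff// mulr1.
  have := zpair_ibp hd x (Kpoly n) 1 Sx.
  have -> : (1 - 'X^2) * (Kpoly n)^`() = n%:R *: (Kpoly n - 'X * Kpoly n).
    rewrite /Kpoly; case: n {n0 D0} => [|n]; first by rewrite expr0 derivC mulr0 scale0r.
    rewrite deriv_exp derivZ derivD derivC derivX add0r -[_ *+ n.+1]scaler_nat [(_ *: _) ^+ n.+1]exprS /=.
    by move: (_ ^+ n) => h; rewrite -!mul_polyC; ring.
  have z0 f : zpair x x f 0 = 0 by rewrite -(scale0r (0 : {poly R})) zpairZr// mul0r.
  have -> : (1 : {poly R})^`() = 0 by rewrite -polyC1 derivC.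
  rewrite mulr0 !z0 zpairZl// zpairBl//; lra.
suff K1 : zpair x x (Kpoly m) 1 = Kmass m by split => //; rewrite X1 K1.
elim: m => [|m IH].
  rewrite /Kmass big_ord0 -[RHS](I_cst hd); apply: eq_Bint => y _.
  by rewrite /Kpoly expr0 !hornerE.
have -> : Kpoly m.+1 = 2^-1 *: (Kpoly m + 'X * Kpoly m).
  by rewrite /Kpoly exprS -scalerAl mulrDl mul1r.
rewrite zpairZl// zpairDl// X1 IH /Kmass big_ord_recr/=; ring.
Qed.

End completeness.

(** * Energies of the concentrating kernels *)

Section dirichlet.
Variables (R : realType) (d : nat).
Hypothesis hd : (2 <= d)%N.
Local Notation T := (d.-tuple R).
Local Notation S := (@sphere R d).
Local Notation mu := (smu R d).
Local Notation I := (Bint mu S).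
Local Notation mS := (@measurable_sphere R d).
Local Notation Z m := (gegq R m d).
Local Notation K m := (Kpoly R m).
Local Notation kappa m := (Kmass R d m).

Let S1 : mu S = 1%E. Proof. exact/smu_sphere/(ltn_trans _ hd). Qed.

Lemma sphere_nonempty : exists x : T, S x.
Proof.
apply/set0P; apply/eqP => S0; have := S1.
by rewrite S0 measure0 => /eqP; rewrite eq_sym onee_eq0.
Qed.

Lemma Kpoly_ge0 m (x y : T) : S x -> S y -> 0 <= (K m).[dotp x y].
Proof.
move=> Sx Sy; have := dotp_le1 Sx Sy => /andP[h _].
by rewrite /Kpoly horner_exp !hornerE; apply: exprn_ge0; lra.
Qed.

Lemma Kpoly_expansion m : exists a : nat -> R, K m = \sum_(n < m.+1) a n *: Z n.
Proof.
apply: (gegq_expansion hd); apply: leq_trans (size_poly_exp_leq _ _) _.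
have : (size (2^-1 *: (1 + 'X) : {poly R}) <= 2)%N.
  apply: leq_trans (size_scale_leq _ _) _; apply: leq_trans (size_polyD _ _) _.
  by rewrite size_polyX size_poly1.
by case: (size _) => [|[|[|k]]] //= _; rewrite ?mul0n ?mul1n.
Qed.

Definition Kint m (G : T * T -> R) := II (fun p => (K m).[dotp p.1 p.2] * G p).

Lemma bmf2_Kint m G : bmf2 S G -> bmf2 S (fun p => (K m).[dotp p.1 p.2] * G p).
Proof. by move=> bG; apply: bmf2M => //; exact: bmf2_hdotp. Qed.

Lemma KintD m G H : bmf2 S G -> bmf2 S H ->
  Kint m (fun p => G p + H p) = Kint m G + Kint m H.
Proof.
move=> bG bH; rewrite -(IID hd (bmf2_Kint m bG) (bmf2_Kint m bH)).
by apply: eq_II => x y _ _; rewrite mulrDr.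
Qed.

Lemma KintZ m c G : bmf2 S G -> Kint m (fun p => c * G p) = c * Kint m G.
Proof.
move=> bG; rewrite -(IIZ hd c (bmf2_Kint m bG)).
by apply: eq_II => x y _ _; rewrite mulrCA.
Qed.

Lemma le_Kint m G H : bmf2 S G -> bmf2 S H -> (forall x y, S x -> S y -> G (x, y) <= H (x, y)) ->
  Kint m G <= Kint m H.
Proof.
move=> bG bH GH; apply: (le_II hd (bmf2_Kint m bG) (bmf2_Kint m bH)) => x y Sx Sy.
by rewrite ler_wpM2l ?GH//= Kpoly_ge0.
Qed.

Lemma Kint_fst m f : bmf S f -> Kint m (fun p => f p.1) = kappa m * I f.
Proof.
move=> bf; rewrite -(BintZ mu mS _ bf); apply: eq_Bint => x Sx.
have [<- _] := zpair_Kpoly hd m Sx.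
rewrite mulrC -(BintZ mu mS); last by apply: bmfM; exact: bmf_hdotp.
by apply: eq_Bint => y _; rewrite /= hornerC mulr1 mulrC.
Qed.

Lemma Kint_snd m f : bmf S f -> Kint m (fun p => f p.2) = kappa m * I f.
Proof.
move=> bf; rewrite -(Kint_fst m bf) /Kint IIC; last exact: bmf2_Kint (bmf2_snd bf).
by apply: eq_II => x y _ _ /=; rewrite dotpC.
Qed.

(** The rate of concentration: relative to the mass, the mean of [1 - t] decays like 1/m. *)
Lemma Kint_dotp m : Kint m (fun p => 1 - dotp p.1 p.2) = kappa m * ((d%:R - 1) / (m%:R + d%:R - 1)).
Proof.
rewrite -[RHS](I_cst hd); apply: eq_Bint => x Sx.
have [k1 k2] := zpair_Kpoly hd m Sx.
transitivity (zpair x x (K m - 'X * K m) 1).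
  by apply: eq_Bint => y _; rewrite /= !hornerE; ring.
rewrite zpairBl// k1 k2.
have m0 : 0 <= m%:R :> R by exact: ler0n.
have d2 : 2 <= d%:R :> R by rewrite ler_nat.
by field; apply: lt0r_neq0; lra.
Qed.

Definition dirichlet m (F : T -> R) := Kint m (fun p => (F p.1 - F p.2) ^+ 2).

Lemma bmf2_diff (F : T -> R) : bmf S F -> bmf2 S (fun p : T * T => (F p.1 - F p.2) ^+ 2).
Proof.
move=> bF; have b : bmf2 S (fun p : T * T => F p.1 - F p.2) by exact: bmf2B (bmf2_fst bF) (bmf2_snd bF).
by have := bmf2M b b; congr bmf2; apply/funext => p; rewrite expr2.
Qed.

Lemma dirichlet_ge0 m F : 0 <= dirichlet m F.
Proof. by apply: II_ge0 => x y Sx Sy; rewrite mulr_ge0 ?sqr_ge0// Kpoly_ge0. Qed.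

(** In the expanded square the diagonal terms see only the mass of the kernel, and the cross term is
    diagonal in the projections. *)
Lemma dirichletE m (a : nat -> R) F : K m = \sum_(n < m.+1) a n *: Z n -> bmf S F ->
  dirichlet m F = 2 * (kappa m * I (fun x => F x ^+ 2) - \sum_(n < m.+1) a n * energy n F).
Proof.
move=> Ka bF; have bF2 := bmfX 2 bF.
have bFF : bmf2 S (fun p : T * T => F p.1 * F p.2) by exact: bmf2M (bmf2_fst bF) (bmf2_snd bF).
transitivity (Kint m (fun p => (F p.1 ^+ 2 + F p.2 ^+ 2) + (- 2) * (F p.1 * F p.2))).
  by apply: eq_II => x y _ _ /=; ring.
rewrite KintD; last 2 first.
- exact: bmf2D (bmf2_fst bF2) (bmf2_snd bF2).
- exact: bmf2Z.
rewrite KintD; last 2 first.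
- exact: bmf2_fst bF2.
- exact: bmf2_snd bF2.
rewrite (Kint_fst m bF2) (Kint_snd m bF2) KintZ//.
suff -> : Kint m (fun p => F p.1 * F p.2) = \sum_(n < m.+1) a n * energy n F by ring.
transitivity (I (fun x => \sum_(n < m.+1) a n * (F x * Q n F x))).
  apply: eq_Bint => x Sx.
  transitivity (I (fun y => \sum_(n < m.+1) a n * F x * ((Z n).[dotp x y] * F y))).
    apply: eq_Bint => y _ /=; rewrite Ka horner_sum mulr_suml; apply: eq_bigr => n _.
    by rewrite hornerZ; ring.
  have bZ n : bmf S (fun y => (Z n).[dotp x y] * F y) by apply: bmfM => //; exact: bmf_hdotp.
  rewrite (Bint_sum mu mS) => [|n]; last by apply: bmfZ.
  by apply: eq_bigr => n _; rewrite (BintZ mu mS)// mulrA.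
rewrite (Bint_sum mu mS) => [|n]; last by apply: bmfZ; apply: bmfM => //; exact: bmf_Q.
by apply: eq_bigr => n _; rewrite (BintZ mu mS)//; apply: bmfM => //; exact: bmf_Q.
Qed.

(** The function [y -> Z_n(x0'y)] has no projection but the n-th, and the nonnegativity of its
    energy reads [2 (kappa m - a n) hdim >= 0]. *)
Lemma Kpoly_coef_le m (a : nat -> R) n : K m = \sum_(n < m.+1) a n *: Z n -> (n < m.+1)%N ->
  a n <= kappa m.
Proof.
move=> Ka nm; have [x0 S0] := sphere_nonempty.
pose F x := (Z n).[dotp x0 x].
have bF : bmf S F by exact: bmf_hdotp.
have := dirichlet_ge0 m F; rewrite (dirichletE Ka bF).
have h0 := hdim_gt0 R n hd.
have zn : zpair x0 x0 (Z n) (Z n) = hdim R n d by rewrite zpair_gegq// (sphere_dotp S0) gegq1.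
have -> : I (fun x => F x ^+ 2) = hdim R n d.
  by rewrite -zn; apply: eq_Bint => x _; rewrite expr2.
have QF k x : S x -> Q k F x = if k == n then (Z n).[dotp x0 x] else 0.
  move=> Sx; rewrite /Q -/(zpair x x0 (Z k) (Z n)).
  by case: eqVneq => [->|kn]; rewrite ?zpair_gegq// ?zpair_orth// dotpC.
rewrite (bigD1 (Ordinal nm))//= [X in _ - (_ + X)]big1 ?addr0; last first.
  move=> k kn; suff -> : energy k F = 0 by rewrite mulr0.
  rewrite -[RHS](I_cst hd); apply: eq_Bint => x Sx; rewrite QF// ifN ?mulr0//.
have -> : energy n F = hdim R n d.
  by rewrite -zn; apply: eq_Bint => x Sx; rewrite QF// eqxx.
rewrite -mulrBl pmulr_rge0// pmulr_lge0// subr_ge0//.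
Qed.

Lemma residual_le_dirichlet m F : bmf S F ->
  2 * kappa m * I (fun x => (F x - \sum_(n < m.+1) Q n F x) ^+ 2) <= dirichlet m F.
Proof.
move=> bF; have [a Ka] := Kpoly_expansion m.
rewrite residual_energy// (dirichletE Ka bF) -mulrA ler_pM2l// mulrBr lerD2l lerN2 mulr_sumr.
apply: ler_sum => n _; rewrite ler_wpM2r ?energy_ge0//.
exact: Kpoly_coef_le Ka (ltn_ord n).
Qed.

(** The condition E_m(F) = o(kappa_m), written without division. *)
Definition dsmall (F : T -> R) := bmf S F /\
  forall e, 0 < e -> exists N, forall m, (N <= m)%N -> dirichlet m F <= e * kappa m.

Lemma dsmall_residual F : dsmall F -> forall e, 0 < e ->
  exists N, forall m, (N <= m)%N -> I (fun x => (F x - \sum_(n < m.+1) Q n F x) ^+ 2) <= e.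
Proof.
move=> [bF hF] e e0; have [N hN] := hF (2 * e) (mulr_gt0 (ltr0Sn R 1) e0).
exists N => m Nm; have k0 := Kmass_gt0 R hd m.
have := le_trans (residual_le_dirichlet m bF) (hN m Nm).
by rewrite -!mulrA ler_pM2l// [X in _ <= X]mulrC ler_pM2l.
Qed.

(** On the sphere [1 - x'y] is half the squared distance, so the hypothesis is a Lipschitz bound and
    [Kint_dotp] supplies the decay. *)
Lemma dsmall_lip F C : bmf S F -> 0 <= C ->
  (forall x y, S x -> S y -> (F x - F y) ^+ 2 <= C * (1 - dotp x y)) -> dsmall F.
Proof.
move=> bF C0 hF; split => // e e0.
have d2 : 2 <= d%:R :> R by rewrite ler_nat.
exists (Num.truncn (C * (d%:R - 1) / e)).+1 => m Nm.
have bD : bmf2 S (fun p : T * T => 1 - dotp p.1 p.2).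
  by apply: bmf2B; [exact: bmf2_cst|exact: bmf2_dotp].
apply: (le_trans (le_Kint m (bmf2_diff bF) (bmf2Z C bD) _)); first by move=> x y; exact: hF.
rewrite (KintZ m C bD) Kint_dotp mulrCA [X in _ <= X]mulrC.
apply: ler_wpM2l; first exact/ltW/Kmass_gt0.
have m0 : C * (d%:R - 1) / e < m%:R.
  apply: lt_le_trans (truncnS_gt _) _; by rewrite ler_nat.
rewrite mulrA ler_pdivrMr; last by have : 0 <= m%:R :> R by []; lra.
rewrite ltr_pdivrMr// in m0.
have : 0 <= e * (d%:R - 1) by rewrite mulr_ge0//; lra.
lra.
Qed.

Lemma dirichlet_mix m (F : T -> R) (c : R) (G H : T -> R) : bmf S F -> bmf S G -> bmf S H ->
  (forall x y, S x -> S y -> (F x - F y) ^+ 2 <= c * ((G x - G y) ^+ 2 + (H x - H y) ^+ 2)) ->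
  dirichlet m F <= c * (dirichlet m G + dirichlet m H).
Proof.
move=> bF bG bH h; rewrite /dirichlet -KintD; try exact: bmf2_diff.
have b := bmf2D (bmf2_diff bG) (bmf2_diff bH).
by rewrite -(KintZ m c b); apply: le_Kint; [exact: bmf2_diff|exact: bmf2Z|exact: h].
Qed.

(** The common source of stability under sums, multiples and products: energies are compared through
    pointwise differences. *)
Lemma dsmall_mix (F : T -> R) (c : R) (G H : T -> R) : bmf S F -> 0 < c ->
  (forall x y, S x -> S y -> (F x - F y) ^+ 2 <= c * ((G x - G y) ^+ 2 + (H x - H y) ^+ 2)) ->
  dsmall G -> dsmall H -> dsmall F.
Proof.
move=> bF c0 h [bG hG] [bH hH]; split; first exact: bF.
move=> e e0.
have e1 : 0 < e / (2 * c) by rewrite divr_gt0// mulr_gt0.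
have [N hN] := hG _ e1; have [N' hN'] := hH _ e1.
exists (maxn N N') => m; rewrite geq_max => /andP[Nm N'm].
apply: le_trans (dirichlet_mix m bF bG bH h) _.
have -> : e * kappa m = c * (e / (2 * c) * kappa m + e / (2 * c) * kappa m).
  by field; rewrite lt0r_neq0.
by apply: ler_wpM2l; [exact: ltW|apply: lerD; [exact: hN|exact: hN']].
Qed.

Lemma dsmall_cst c : dsmall (fun=> c).
Proof.
apply: (@dsmall_lip _ 0) => //; first exact: bmf_cst.
by move=> x y _ _; rewrite subrr expr0n mul0r.
Qed.

Lemma dsmallD F G : dsmall F -> dsmall G -> dsmall (fun x => F x + G x).
Proof.
move=> hF hG; apply: (@dsmall_mix _ 2 F G) => //; first by apply: bmfD; [exact: hF.1|exact: hG.1].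
move=> x y _ _; rewrite -subr_ge0.
by have := sqr_ge0 ((F x - F y) - (G x - G y)); congr (_ <= _); ring.
Qed.

Lemma dsmallZ c F : dsmall F -> dsmall (fun x => c * F x).
Proof.
move=> hF; apply: (@dsmall_mix _ (c ^+ 2 + 1) F F) => //.
- by apply: bmfZ; exact: hF.1.
- by rewrite ltr_wpDl// sqr_ge0.
move=> x y _ _; rewrite -subr_ge0.
have : 0 <= (c ^+ 2 + 2) * (F x - F y) ^+ 2 by rewrite mulr_ge0 ?sqr_ge0// addr_ge0 ?sqr_ge0.
by congr (_ <= _); ring.
Qed.

Lemma dsmall_sum J (r : seq J) (F : J -> T -> R) : (forall i, dsmall (F i)) ->
  dsmall (fun x => \sum_(i <- r) F i x).
Proof.
move=> hF; elim: r => [|i r IH].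
  by under [X in dsmall X]eq_fun do rewrite big_nil; exact: dsmall_cst.
by under [X in dsmall X]eq_fun do rewrite big_cons; exact: (dsmallD (hF i) IH).
Qed.

Lemma dsmallM F G : (forall x, S x -> `|F x| <= 1) -> (forall x, S x -> `|G x| <= 1) ->
  dsmall F -> dsmall G -> dsmall (fun x => F x * G x).
Proof.
move=> F1 G1 hF hG; apply: (@dsmall_mix _ 2 F G) => //; first by apply: bmfM; [exact: hF.1|exact: hG.1].
move=> x y Sx Sy.
have -> : F x * G x - F y * G y = (F x - F y) * G x + F y * (G x - G y) by ring.
have a1 : ((F x - F y) * G x) ^+ 2 <= (F x - F y) ^+ 2.
  rewrite exprMn ler_piMr ?sqr_ge0// -real_normK ?num_real//.
  by rewrite expr_le1// G1.
have a2 : (F y * (G x - G y)) ^+ 2 <= (G x - G y) ^+ 2.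
  rewrite exprMn ler_piMl ?sqr_ge0// -real_normK ?num_real//.
  by rewrite expr_le1// F1.
have := sqr_ge0 ((F x - F y) * G x - F y * (G x - G y)).
move: a1 a2; move: ((F x - F y) * G x) (F y * (G x - G y)) => u v; nra.
Qed.

Lemma dsmall_lim F : bmf S F ->
  (forall e, 0 < e -> exists2 G, dsmall G & I (fun x => (F x - G x) ^+ 2) <= e) -> dsmall F.
Proof.
move=> bF hF; split => // e e0.
(* Three terms of size at most [kappa m * (e / 12)], times the factor 3 from the square of a sum of
   three, use nine twelfths of the allowance. *)
have e12 : 0 < e / 12 by rewrite divr_gt0.
have [G [bG hG] FG] := hF _ e12; have [N hN] := hG _ e12.
exists N => m Nm; pose D x := (F x - G x) ^+ 2.
have bD : bmf S D by apply: bmfX; exact: bmfB.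
have b1 : bmf2 S (fun p : T * T => D p.1 + D p.2) by exact: bmf2D (bmf2_fst bD) (bmf2_snd bD).
have b2 := bmf2D b1 (bmf2_diff bG).
have : dirichlet m F <= 3 * (kappa m * I D + kappa m * I D + dirichlet m G).
  rewrite -[X in X + _ + _](Kint_fst m bD) -(Kint_snd m bD).
  rewrite -KintD; [|exact: bmf2_fst bD|exact: bmf2_snd bD].
  rewrite -KintD//; last exact: bmf2_diff.
  rewrite -(KintZ m 3 b2); apply: le_Kint; [exact: bmf2_diff|exact: bmf2Z|move=> x y _ _ /=; rewrite /D].
  move: (F x) (F y) (G x) (G y) => f f' g g'; rewrite -subr_ge0.
  (* With a, b, c for [f - g], [f' - g'], [g - g'] this sum is
     [3 (a^2 + b^2 + c^2) - (a - b + c)^2]. *)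
  have : 0 <= ((f - g) + (f' - g')) ^+ 2 + ((f - g) - (g - g')) ^+ 2 + ((f' - g') + (g - g')) ^+ 2.
    by rewrite !addr_ge0// sqr_ge0.
  by congr (_ <= _); ring.
have k0 := Kmass_gt0 R hd m.
have : kappa m * I D <= kappa m * (e / 12) by rewrite ler_pM2l.
have := hN m Nm; have : 0 < e * kappa m by exact: mulr_gt0.
move: (kappa m) (I D) (dirichlet m F) (dirichlet m G) => k i dF dG.
lra.
Qed.

End dirichlet.

Section level_sets.
Context dT (T : measurableType dT) (R : realType).
Variables (f : T -> R) (a : R).
Hypothesis mf : measurable_fun [set: T] f.

Lemma measurable_lt_cst : measurable [set x | f x < a].
Proof.
have := mf measurableT (measurable_itv `]-oo, a[); rewrite setTI.
by congr measurable; apply/seteqP; split => x /=; rewrite in_itv.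
Qed.

Lemma measurable_gt_cst : measurable [set x | a < f x].
Proof.
have := mf measurableT (measurable_itv `]a, +oo[); rewrite setTI.
by congr measurable; apply/seteqP; split => x /=; rewrite in_itv/= andbT.
Qed.

End level_sets.

(** * From half-spaces to bounded measurable functions *)

Section density.
Variables (R : realType) (d : nat).
Hypothesis hd : (2 <= d)%N.
Local Notation T := (d.-tuple R).
Local Notation S := (@sphere R d).
Local Notation mu := (smu R d).
Local Notation I := (Bint mu S).
Local Notation mS := (@measurable_sphere R d).

Lemma dsmall_bmf (F : T -> R) : dsmall F -> bmf S F.
Proof. by case. Qed.

#[local] Opaque dsmall.

(** Bounded pointwise limits are L^2 limits by dominated convergence, the squared difference being
    at most [(M + M)^2]. *)
Lemma dsmall_cvg (F : T -> R) (G : nat -> T -> R) (M : R) : measurable_fun setT F ->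
  (forall x, S x -> `|F x| <= M) -> (forall n, dsmall (G n)) ->
  (forall n x, S x -> `|G n x| <= M) -> (forall x, S x -> G n x @[n --> \oo] --> F x) -> dsmall F.
Proof.
move=> mF FM hG GM cG; have bF : bmf S F by split => //; exists M.
have bG n : bmf S (G n) by exact: dsmall_bmf.
apply: (dsmall_lim hd bF) => e e0.
have : I (fun x => (F x - G n x) ^+ 2) @[n --> \oo] --> I (fun=> 0).
  apply: (@cvg_Bint _ _ _ mu S mS _ _ ((M + M) ^+ 2)) => //.
  - by move=> n; exact: (bmfX 2 (bmfB bF (bG n))).1.
  - move=> n x Sx; rewrite normrX lerXn2r ?nnegrE//.
      by rewrite addr_ge0// (le_trans _ (FM x Sx)).
    by rewrite (le_trans (ler_normB _ _))// lerD ?FM ?GM.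
  move=> x Sx; have -> : 0 = (F x - F x) * (F x - F x) by rewrite subrr mul0r.
  under eq_fun do rewrite expr2.
  by apply: cvgM; apply: cvgB; [exact: cvg_cst|exact: cG|exact: cvg_cst|exact: cG].
rewrite I_cst// => /cvgrPdist_le /(_ e e0)[N _ /(_ N (leqnn N))].
rewrite sub0r normrN => h; exists (G N) => //.
exact: le_trans (ler_norm _) h.
Qed.

Lemma sqr_dist_sphere (x y : T) (i : 'I_d) : S x -> S y ->
  (tnth x i - tnth y i) ^+ 2 <= 2 * (1 - dotp x y).
Proof.
move=> Sx Sy.
have -> : 2 * (1 - dotp x y) = \sum_(j < d) (tnth x j - tnth y j) ^+ 2.
  have -> : 2 * (1 - dotp x y) = dotp x x + dotp y y - 2 * dotp x y.
    by rewrite !sphere_dotp//; ring.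
  by rewrite /dotp mulr_sumr -big_split -sumrB; apply: eq_bigr => j _ /=; ring.
by rewrite (bigD1 i)//= lerDl sumr_ge0// => j _; rewrite sqr_ge0.
Qed.

Let clip (s : R) := Num.min 1 (Num.max 0 s).

Let clip_lip s t : (clip s - clip t) ^+ 2 <= (s - t) ^+ 2.
Proof.
wlog st : s t / s <= t => [h|].
  by case/orP: (le_total s t) => /h//; rewrite -sqrrN opprB => /le_trans; apply; rewrite -sqrrN opprB.
have /andP[h0 h1] : 0 <= clip t - clip s <= t - s.
  by rewrite /clip; case: (leP 0 s) => ?; case: (leP 0 t) => ?; do ?[case: (leP 1 _) => ?]; lra.
rewrite -sqrrN -[leRHS]sqrrN !opprB lerXn2r ?nnegrE//.
by rewrite subr_ge0.
Qed.

Let clip_norm s : `|clip s| <= 1.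
Proof. by rewrite /clip ler_norml; case: (leP 0 s) => ?; do ?[case: (leP 1 _) => ?]; lra. Qed.

(** The indicator is the limit of the Lipschitz ramps [clip (n (x_i - a))]; the inequality is strict
    because all of them vanish on the boundary. *)
Lemma dsmall_halfspace (i : 'I_d) (a : R) : dsmall (\1_[set x : T | a < tnth x i] : T -> R).
Proof.
have mti : measurable_fun [set: T] (fun x : T => tnth x i) by exact: measurable_tnth.
have mA : measurable [set x : T | a < tnth x i] := measurable_gt_cst a mti.
pose G (n : nat) (x : T) := clip (n%:R * (tnth x i - a)).
apply: (@dsmall_cvg _ G 1) => //.
- by move=> x _; rewrite indicE; case: (_ \in _); rewrite ?normr1 ?normr0.
- move=> n; apply: (dsmall_lip hd (C := n%:R ^+ 2 * 2)).
  + split; last by exists 1 => x _; exact: clip_norm.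
    apply: measurable_minr => //; apply: measurable_maxr => //.
    by apply: measurable_funM => //; exact: measurable_funB.
  + by rewrite mulr_ge0// exprn_ge0.
  move=> x y Sx Sy; apply: le_trans (clip_lip _ _) _.
  rewrite -mulrBr exprMn -mulrA ler_wpM2l ?exprn_ge0//.
  have -> : tnth x i - a - (tnth y i - a) = tnth x i - tnth y i by ring.
  exact: sqr_dist_sphere.
- by move=> n x _; exact: clip_norm.
move=> x Sx; rewrite indicE; case: (boolP (x \in [set x0 : T | a < tnth x0 i])) => xa; last first.
  rewrite (_ : (fun n => G n x) = fun=> 0); first exact: cvg_cst.
  apply/funext => n; rewrite /G /clip; move: xa; rewrite notin_setE /= => /negP; rewrite -leNgt => xa.
  have : n%:R * (tnth x i - a) <= 0 by rewrite mulr_ge0_le0// subr_le0.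
  by case: (leP 0 _) => ? ?; case: (leP 1 _) => ?; lra.
move: xa => /set_mem /=; rewrite -subr_gt0 => xa.
apply: cvg_near_cst; exists (Num.truncn (tnth x i - a)^-1).+1 => // n /= hn.
have : 1 <= n%:R * (tnth x i - a).
  rewrite -ler_pdivrMr// mul1r (le_trans (ltW (truncnS_gt _)))// ler_nat//.
by rewrite /G /clip => ?; case: (leP 0 _) => ?; case: (leP 1 _) => ?; lra.
Qed.

(** Shown below to be a sigma-algebra: products give intersections, and [dsmall_cvg] gives countable
    unions. *)
Let smallset : set (set T) := [set A | measurable A /\ dsmall (\1_A : T -> R)].

Let ind1 (A : set T) x : `|\1_A x : R| <= 1.
Proof. by rewrite indicE; case: (_ \in _); rewrite ?normr1 ?normr0. Qed.

Let smallI A B : smallset A -> smallset B -> smallset (A `&` B).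
Proof.
move=> [mA hA] [mB hB]; split; first exact: measurableI.
rewrite (_ : \1__ = fun x => \1_A x * \1_B x : R); last first.
  by apply/funext => x; rewrite indicI.
by apply: (dsmallM hd _ _ hA hB) => x _; exact: ind1.
Qed.

Let smallC A : smallset A -> smallset (~` A).
Proof.
move=> [mA hA]; split; first exact: measurableC.
rewrite (_ : \1__ = fun x => 1 + (- 1) * \1_A x : R); last first.
  by apply/funext => x; rewrite !indicE in_setC; case: (_ \in _) => /=; ring.
exact: (dsmallD hd (dsmall_cst hd 1) (dsmallZ hd (- 1) hA)).
Qed.

Let small_sigma : sigma_algebra [set: T] smallset.
Proof.
have s0 : smallset set0.
  by split; [exact: measurable0|rewrite indic0; exact: dsmall_cst].
split; [exact: s0|by move=> A; rewrite setTD; exact: smallC|move=> A hA; split]; first by apply: bigcupT_measurable => n; exact: (hA n).1.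
have hU n : smallset (\big[setU/set0]_(i < n) A i).
  elim: n => [|n IH]; first by rewrite big_ord0.
  rewrite big_ord_recr/= -[X in smallset X]setCK setCU.
  exact: (smallC (smallI (smallC IH) (smallC (hA n)))).
apply: (@dsmall_cvg _ (fun n => \1_(\big[setU/set0]_(i < n) A i)) 1) => //.
- by apply: measurable_indic; apply: bigcupT_measurable => n; exact: (hA n).1.
- by move=> n; exact: (hU n).2.
move=> x Sx; apply: cvg_near_cst.
have [[k _ Ak]|nA] := pselect ((\bigcup_n A n) x).
  exists k.+1 => // n /= kn; have kA : (\big[setU/set0]_(i < n) A i) x by rewrite -bigcup_mkord; exists k.
  have UA : (\bigcup_n A n) x by exists k.
  by rewrite !indicE (mem_set kA) (mem_set UA).
apply: nearW => n; rewrite !indicE !memNset// -bigcup_mkord => -[j /= _ Aj].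
by apply: nA; exists j.
Qed.

Lemma dsmall_indic (A : set T) : measurable A -> dsmall (\1_A : T -> R).
Proof.
move=> mA; suff : smallset A by case.
apply: (smallest_sub small_sigma _ mA); apply: (big_ind (fun X => X `<=` smallset)).
- exact: sub0set.
- by move=> X Y hX hY; rewrite subUset; split.
move=> i _ B [C mC <-]; rewrite setTI.
have mC' : (@ocitv R).-sigma.-measurable C by exact: mC.
(* The open rays []a, +oo[] generate the Borel sets of the line, and their preimages are the
   half-spaces already treated. *)
rewrite RGenOInfty.measurableE in mC'.
suff : smallest (sigma_algebra setT) (@RGenOInfty.G R) `<=` [set C | smallset ((fun x : T => tnth x i) @^-1` C)].
  by apply; exact: mC'.
apply: smallest_sub.
  have [h0 hC hU] := small_sigma; split => [|D|D hD] /=.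
  - by rewrite preimage_set0.
  - by rewrite setTD preimage_setC; exact: smallC.
  by rewrite preimage_bigcup; exact: hU.
move=> D [a ->] /=; split.
  rewrite -[X in measurable X]setTI; apply: measurable_tnth => //.
rewrite (_ : _ @^-1` _ = [set x : T | a < tnth x i]); first exact: dsmall_halfspace.
by apply/seteqP; split => x /=; rewrite in_itv/= andbT.
Qed.

(** The sum counts the positive integers up to [s], so it is the integer part of [s]. *)
Lemma step_approx (k : nat) (s : R) : 0 <= s <= k%:R ->
  let c := \sum_(i < k) (i.+1%:R <= s)%R%:R in c <= s <= c + 1.
Proof.
move=> /= /andP[s0 sk].
have C n : n%:R <= s -> \sum_(i < n) (i.+1%:R <= s)%R%:R = n%:R :> R.
  elim: n => [|n IH] ns; first by rewrite big_ord0.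
  rewrite big_ord_recr/= ns IH ?natr1//.
  by apply: le_trans ns; rewrite ler_nat.
elim: k sk => [|k IH] sk.
  by rewrite big_ord0 s0/= add0r (le_trans sk).
rewrite big_ord_recr/=; have [ks|ks] := leP k.+1%:R s.
  have ks' : k%:R <= s by apply: le_trans ks; rewrite ler_nat.
  by rewrite (C k ks') natr1 ks/= (le_trans sk)// lerDl.
rewrite addr0; have [ks'|/ltW/IH//] := leP k%:R s.
by rewrite C// ks'/= natr1 ltW.
Qed.

Lemma dsmall_bounded01 (F : T -> R) : measurable_fun setT F -> (forall x, 0 <= F x <= 1) ->
  dsmall F.
Proof.
move=> mF F01.
(* Rounds [F] down to a multiple of [1 / (k + 1)], as a combination of indicators of level sets. *)
pose G k (x : T) : R := \sum_(i < k.+1) k.+1%:R^-1 * \1_[set x | i.+1%:R <= k.+1%:R * F x] x.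
have GE k x : G k x <= F x <= G k x + k.+1%:R^-1.
  have k0 : 0 < k.+1%:R :> R by rewrite ltr0n.
  have /step_approx : 0 <= k.+1%:R * F x <= k.+1%:R.
    by have /andP[f0 f1] := F01 x; rewrite mulr_ge0// ger_pMr.
  have -> : (G k x <= F x <= G k x + k.+1%:R^-1) =
      (k.+1%:R * G k x <= k.+1%:R * F x <= k.+1%:R * G k x + 1).
    have <- : k.+1%:R * (G k x + k.+1%:R^-1) = k.+1%:R * G k x + 1.
      by rewrite mulrDr divff// lt0r_neq0.
    by rewrite !(ler_pM2l k0).
  suff -> : k.+1%:R * G k x = \sum_(i < k.+1) (i.+1%:R <= k.+1%:R * F x)%R%:R by [].
  rewrite mulr_sumr; apply: eq_bigr => i _; rewrite mulrA divff ?lt0r_neq0// mul1r indicE.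
  by rewrite mem_setE.
apply: (@dsmall_cvg _ G 1) => //.
- by move=> x _; have /andP[f0 f1] := F01 x; rewrite ger0_norm.
- move=> n; apply: dsmall_sum => // i; apply: dsmallZ => //; apply: dsmall_indic.
  have mG : measurable_fun setT (fun x => n.+1%:R * F x) by exact: measurable_funM.
  have := mG measurableT _ (measurable_itv `[i.+1%:R, +oo[).
  by rewrite setTI; congr measurable; apply/seteqP; split => x /=; rewrite in_itv/= andbT.
- move=> n x _; rewrite ger0_norm; last first.
    by apply: sumr_ge0 => i _; rewrite mulr_ge0// indicE.
  by have /andP[h _] := GE n x; have /andP[_ f1] := F01 x; exact: le_trans f1.
move=> x _; apply/cvgrPdist_le => e e0.
have [N hN] : exists N, forall k, (N <= k)%N -> k.+1%:R^-1 <= e.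
  exists (Num.truncn e^-1).+1 => k Nk.
  rewrite -[e]invrK lef_pV2 ?posrE ?invr_gt0//.
  by rewrite (le_trans (ltW (truncnS_gt _)))// ler_nat (leq_trans Nk).
exists N => // k /= Nk; have := hN k Nk; have := GE k x.
move: (F x) (G k x) (k.+1%:R^-1) => f g v /andP[a1 a2] a3.
by rewrite ler_norml; apply/andP; split; lra.
Qed.

End density.

(** * The density of X and the odd extension *)

Section law_density.
Local Open Scope ereal_scope.
Context dO (Omega : measurableType dO) dT (T : measurableType dT) (R : realType).
Variables (P : probability Omega R) (X : Omega -> T) (Y : set Omega).
Hypotheses (mX : measurable_fun [set: Omega] X) (mY : measurable Y).

Let mX_mixin := isMeasurableFun.Build _ _ _ _ _ mX.
Let X_pack : {mfun _ >-> _} := HB.pack X mX_mixin.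

Let mXB B : measurable B -> measurable (X @^-1` B).
Proof. by move=> mB; rewrite -[X in measurable X]setTI; exact: mX. Qed.

Variables (mu : {measure set T -> \bar R}) (w : T -> R).
Hypotheses (mw : measurable_fun [set: T] w) (w0 : forall x, (0 <= w x)%R).
Hypothesis lawE : forall A, measurable A -> P (X @^-1` A) = \int[mu]_(x in A) (w x)%:E.

Lemma ge0_integral_law (f : T -> \bar R) : measurable_fun [set: T] f -> (forall x, 0 <= f x) ->
  \int[P]_u f (X u) = \int[mu]_x (f x * (w x)%:E).
Proof.
move=> mf f0; rewrite -(@ge0_integral_density _ _ _ _ (pushforward P X_pack))//.
by rewrite ge0_integral_pushforward.
Qed.

Section conditional.
Variable s : T -> R.
Hypotheses (ms : measurable_fun [set: T] s) (s0 : forall x, (0 <= s x)%R).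
Hypothesis condE : forall B, measurable B ->
  P (Y `&` X @^-1` B) = \int[P]_(u in X @^-1` B) (s (X u))%:E.

(** The image under [X] of the restriction of [P] to [Y] has density [s * w] for [mu]; [condE] says
    so on sets. *)
Lemma ge0_integral_cond (f : T -> \bar R) : measurable_fun [set: T] f -> (forall x, 0 <= f x) ->
  \int[P]_u (f (X u) * (\1_Y u)%:E) = \int[mu]_x (f x * (s x * w x)%:E).
Proof.
move=> mf f0.
rewrite -(@ge0_integral_density _ _ _ _ (pushforward (mrestr P mY) X_pack))//; last 3 first.
- exact: measurable_funM.
- by move=> x; rewrite mulr_ge0.
- move=> B mB; rewrite -[LHS]/(P ((X @^-1` B) `&` Y)) setIC condE// [LHS]integral_mkcond [RHS]integral_mkcond.
  transitivity (\int[P]_u ((\1_B (X u) * s (X u))%:E)).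
    apply: eq_integral => u _; rewrite patchE indicE.
    have -> : (u \in X @^-1` B) = (X u \in B) by apply/idP/idP => /set_mem h; exact/mem_set.
    by case: ifP => _; rewrite ?mul1r ?mul0r.
  rewrite (@ge0_integral_law (fun x => (\1_B x * s x)%:E)).
  + by apply: eq_integral => x _; rewrite patchE indicE; case: ifP => _; rewrite -EFinM ?mul1r ?mul0r.
  + by apply/measurable_EFinP; apply: measurable_funM => //; exact: measurable_indic.
  + by move=> x; rewrite lee_fin mulr_ge0// indicE.
rewrite ge0_integral_pushforward//= preimage_setT.
rewrite (@ge0_integral_density _ _ _ P (mrestr P mY) (\1_Y)).
- by apply: eq_integral => u _.
- exact: measurable_indic.
- by move=> u; rewrite indicE.
- by move=> A mA; rewrite integral_indic// setIC.
- exact: measurableT_comp.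
- by move=> u; exact: f0.
Qed.

End conditional.

Section clipping.
Variable r : T -> R.
Hypothesis mr : measurable_fun [set: T] r.
Hypothesis condE : forall B, measurable B ->
  P (Y `&` X @^-1` B) = \int[P]_(u in X @^-1` B) (r (X u))%:E.

Let null_of_eq0 (D : set Omega) (g : Omega -> R) : measurable D -> measurable_fun [set: Omega] g ->
  (forall u, D u -> (0 < g u)%R) -> \int[P]_(u in D) (g u)%:E <= 0 -> P D = 0.
Proof.
move=> mD mg g0 ig.
have : \int[P]_(u in D) `|(g u)%:E| = 0.
  under eq_integral => u /set_mem Du do rewrite gee0_abs ?lee_fin ?ltW ?g0//.
  by apply/eqP; rewrite eq_le ig integral_ge0// => u /g0 /ltW.
move=> /(ae_eq_integral_abs P mD (measurable_funTS _)) h.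
have {h} /negligibleS : ae_eq P D (EFin \o g) (cst 0).
  by apply: h; exact/measurable_EFinP.
move=> /(_ D) h; apply/(measure_negligible mD)/h => u Du /= /(_ Du) [] gu.
by have := g0 u Du; rewrite gu ltxx.
Qed.

(** A version of a conditional probability lies in [0, 1] only up to null sets of the law of [X]. *)
Lemma cond_prob_bounds : P (X @^-1` [set x | (r x < 0)%R]) = 0 /\ P (X @^-1` [set x | (1 < r x)%R]) = 0.
Proof.
have m1 := measurable_lt_cst 0%R mr; have m2 := measurable_gt_cst 1%R mr.
split.
- apply: (@null_of_eq0 _ (fun u => - r (X u))%R) => //; first exact: mXB.
  + by apply: measurableT_comp => //; exact: measurableT_comp.
  + by move=> u /=; rewrite oppr_gt0.
  rewrite -[leLHS]oppeK -integral_ge0N => [|u /= /ltW]; last by rewrite lee_fin oppr_ge0.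
  under eq_integral do rewrite -EFinN opprK.
  by rewrite -condE// oppe_le0.
apply: (@null_of_eq0 _ (fun u => r (X u) - 1)%R) => //; first exact: mXB.
+ by apply: measurable_funB => //; exact: measurableT_comp.
+ by move=> u /=; rewrite subr_gt0.
(* On the event [r > 1], the integral of [r - 1] plus the probability of the event equals the
   probability of its part in [Y], so the integral of [r - 1] is at most 0. *)
have := condE m2.
under eq_integral do rewrite -[r _](subrK 1%R) EFinD.
rewrite ge0_integralD//; last 3 first.
- exact: mXB.
- by move=> u /= /ltW; rewrite lee_fin subr_ge0.
- by apply/measurable_funTS/measurable_EFinP; apply: measurable_funB => //; exact: measurableT_comp.
rewrite integral_cst ?mul1e; last exact: mXB.
move=> e; rewrite -(@leeD2rE _ (P (X @^-1` [set x | (1 < r x)%R]))) ?fin_num_measure//; last exact: mXB.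
rewrite -e add0e; apply: le_measure; rewrite ?inE; [|exact: mXB|exact: subIsetr].
by apply: measurableI => //; exact: mXB.
Qed.

End clipping.
End law_density.

(** * Almost everywhere identities and parity on the sphere *)

Section sphere_ae.
Variables (R : realType) (d : nat).
Hypothesis hd : (2 <= d)%N.
Local Notation T := (d.-tuple R).
Local Notation S := (@sphere R d).
Local Notation mu := (smu R d).
Local Notation I := (Bint mu S).
Local Notation mS := (@measurable_sphere R d).
Local Notation Z m := (gegq R m d).
Local Notation area := (sphere_area R d).

Let d_gt0 : (0 < d)%N. Proof. exact: ltn_trans hd. Qed.

Lemma eq_sphere_int (g h : T -> \bar R) : (forall x, S x -> g x = h x) -> sphere_int g = sphere_int h.
Proof.
move=> gh; rewrite /sphere_int; congr (_ * iint _)%E; apply/funext => x.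
by case: ifPn => // /andP[x0 _]; apply: gh; exact: sphere_nrm.
Qed.

Lemma ae_eq_Bint (f g : T -> R) : bmf S f -> bmf S g ->
  {ae mu, forall x, S x -> f x = g x} -> I f = I g.
Proof.
move=> [mf _] [mg _] fg; rewrite /Bint /Rintegral; congr fine.
apply: ae_eq_integral => //; first exact: mS.
- by apply: measurable_funTS; exact/measurable_EFinP.
- by apply: measurable_funTS; exact/measurable_EFinP.
by apply: filterS fg => x h Sx; rewrite h.
Qed.

(** Admits an integrand that is unbounded on a null set, such as one built from an arbitrary version
    of [r]. *)
Lemma sphere_int_Bint (g h : T -> R) : measurable_fun setT g -> (forall x, 0 <= g x) -> bmf S h ->
  {ae mu, forall x, S x -> g x = h x} -> sphere_int (fun x => (g x)%:E) = (area * I h)%:E.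
Proof.
move=> mg g0 bh gh.
have mEg : measurable_fun setT (fun x => (g x)%:E) by exact/measurable_EFinP.
have E0 x : (0 <= (g x)%:E)%E by rewrite lee_fin.
rewrite (sphere_intE d_gt0 mEg E0) [RHS]EFinM (integral_smu_sphere hd mEg E0).
rewrite /Bint /Rintegral fineK; last exact: (integrable_fin_num mS (bmf_integrable mu mS bh)).
congr (_ * _)%E.
apply: ae_eq_integral => //; first exact: mS.
- exact: measurable_funTS.
- by apply: measurable_funTS; apply/measurable_EFinP; exact: bh.1.
by apply: filterS gh => x h' Sx; rewrite h'.
Qed.

Lemma sphere_intR_Bint (g h : T -> R) : measurable_fun setT g -> bmf S h ->
  {ae mu, forall x, S x -> g x = h x} -> sphere_intR g = area * I h.
Proof.
move=> mg bh gh; have bNh := bmfN bh; rewrite /sphere_intR (Bint_max0 mu mS bh) mulrBr.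
rewrite (@sphere_int_Bint _ (fun x => Num.max (h x) 0)); last 4 first.
- exact: measurable_maxr.
- by move=> x; rewrite le_max lexx orbT.
- exact: bmf_max0.
- by apply: filterS gh => x h' Sx; rewrite h'.
rewrite (@sphere_int_Bint _ (fun x => Num.max (- h x) 0))//.
- by apply: measurable_maxr => //; exact: measurableT_comp.
- by move=> x; rewrite le_max lexx orbT.
- exact: bmf_max0.
- by apply: filterS gh => x h' Sx; rewrite h'.
Qed.

Lemma opptK (x : T) : oppt (oppt x) = x.
Proof. by apply: eq_from_tnth => i; rewrite !tnth_map opprK. Qed.

Lemma dotpNr (x y : T) : dotp x (oppt y) = - dotp x y.
Proof. by rewrite /dotp -sumrN; apply: eq_bigr => i _; rewrite tnth_map mulrN. Qed.

Lemma sphere_oppt (x : T) : S (oppt x) <-> S x.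
Proof. by rewrite /sphere /= /enorm dotpNr dotpC dotpNr opprK. Qed.

Lemma coord1_tnth (x : T) : coord1 x = tnth x (Ordinal d_gt0).
Proof. by rewrite /coord1 (tnth_nth 0). Qed.

Lemma coord1N (x : T) : coord1 (oppt x) = - coord1 x.
Proof. by rewrite !coord1_tnth tnth_map. Qed.

Lemma measurable_coord1 : measurable_fun [set: T] (@coord1 R d).
Proof.
rewrite (_ : @coord1 R d = fun x => tnth x (Ordinal d_gt0)); first exact: measurable_tnth.
by apply/funext => x; exact: coord1_tnth.
Qed.

Lemma ae_coord1 : {ae mu, forall x, coord1 x != 0}.
Proof.
have mN : measurable [set x : T | coord1 x = 0].
  by have := measurable_coord1 measurableT (measurable_set1 0); rewrite setTI.
exists [set x | coord1 x = 0]; split => //; last by move=> x /= /negP; rewrite negbK => /eqP.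
by move: mN; case: d d_gt0 => // n _ _; exact: smu_coord1.
Qed.

Lemma bmf_oppt (f : T -> R) : bmf S f -> bmf S (fun x => f (oppt x)).
Proof.
move=> [mf [M hM]]; split; first exact: (measurableT_comp mf (@measurable_oppt R d)).
by exists M => x /sphere_oppt; exact: hM.
Qed.

Lemma Bint_oppt (f : T -> R) : bmf S f -> I (fun x => f (oppt x)) = I f.
Proof.
have ge0 (g : T -> R) : bmf S g -> (forall x, 0 <= g x) -> I (fun x => g (oppt x)) = I g.
  move=> bg g0; rewrite /Bint /Rintegral; congr fine.
  have mg : measurable_fun setT (EFin \o g) by apply/measurable_EFinP; exact: bg.1.
  have mgo : measurable_fun setT (EFin \o (fun x => g (oppt x))).
    by apply/measurable_EFinP; exact: (bmf_oppt bg).1.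
  have E0 x : (0 <= (EFin \o g) x)%E by rewrite lee_fin.
  have E1 x : (0 <= (EFin \o (fun x => g (oppt x))) x)%E by rewrite lee_fin.
  by rewrite -(integral_smu_sphere hd mg E0) -(integral_smu_sphere hd mgo E1) -(smuN mg E0).
move=> bf; rewrite (Bint_max0 mu mS bf) (Bint_max0 mu mS (bmf_oppt bf)).
rewrite (ge0 (fun x => Num.max (f x) 0)); [|exact: bmf_max0|by move=> x; rewrite le_max lexx orbT].
rewrite (ge0 (fun x => Num.max (- f x) 0)) //; last by move=> x; rewrite le_max lexx orbT.
exact/bmf_max0/bmfN.
Qed.

Lemma ae_oppt (A : T -> Prop) : {ae mu, forall x, A x} -> {ae mu, forall x, A (oppt x)}.
Proof.
move=> [N [mN N0 AN]]; exists (@oppt R d @^-1` N); split.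
- by rewrite -[X in measurable X]setTI; exact: measurable_oppt.
- have mNo : measurable (@oppt R d @^-1` N).
    by rewrite -[X in measurable X]setTI; exact: measurable_oppt.
  have e B : measurable B -> mu B = (\int[mu]_x (\1_B x)%:E)%E.
    by move=> mB; rewrite integral_indic// setIT.
  rewrite -N0 !e//; apply: (smuN (g := fun x => (\1_N x)%:E)).
  + by apply/measurable_EFinP; exact: measurable_indic.
  + by move=> x; rewrite lee_fin indicE.
by move=> x /= h; apply: AN.
Qed.

Lemma gegqN n t : (Z n).[- t] = (-1) ^+ n * (Z n).[t].
Proof.
apply: (@legop_hornerN R (d%:R - 1) (Z n) n t); [|exact: legop_gegq|exact: size_gegq].
have : 2 <= d%:R :> R by rewrite ler_nat.
lra.
Qed.

(** Substitute [y -> -y] and use that [Z n] has the parity of [n]. *)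
Lemma Q_parity n F G x : bmf S F -> bmf S G ->
  {ae mu, forall y, S y -> F (oppt y) = G y} -> Q n F x = (-1) ^+ n * Q n G x.
Proof.
move=> bF bG FG; have bZ : bmf S (fun y => (Z n).[dotp x y]) by exact: bmf_hdotp.
rewrite /Q -Bint_oppt; last exact: bmfM.
rewrite -(BintZ mu mS); last exact: bmfM.
apply: ae_eq_Bint; [exact: bmf_oppt (bmfM bZ bF)|by apply: bmfZ; exact: bmfM|].
by apply: filterS FG => y h Sy; rewrite dotpNr gegqN h// mulrA.
Qed.

Lemma Q_cst_odd n c (x : T) : odd n -> Q n (fun=> c) x = 0.
Proof.
move=> on; have bc : bmf S (fun=> c : R) by exact: bmf_cst.
have := Q_parity n x bc bc (aeW mu _); rewrite -signr_odd on expr1 => /(_ (fun y _ => erefl)); lra.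
Qed.

Lemma Q_odd_even n F x : bmf S F -> {ae mu, forall y, S y -> F (oppt y) = - F y} -> ~~ odd n ->
  Q n F x = 0.
Proof.
move=> bF oF on; have := Q_parity n x bF (bmfN bF) oF.
rewrite -signr_odd (negbTE on) expr0 mul1r.
have -> : Q n (fun y => - F y) x = - Q n F x.
  by rewrite -mulN1r -QZ//; apply: eq_Q => y _; rewrite mulN1r.
lra.
Qed.

End sphere_ae.

(** * The odd extension from the hemisphere *)

Section hemisphere.
Variables (R : realType) (d : nat).
Hypothesis hd : (2 <= d)%N.
Local Notation T := (d.-tuple R).
Local Notation S := (@sphere R d).
Local Notation mu := (smu R d).
Local Notation I := (Bint mu S).
Local Notation mS := (@measurable_sphere R d).
Local Notation Z m := (gegq R m d).
Local Notation area := (sphere_area R d).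

Lemma eq_sphere_intR (g h : T -> R) : (forall x, S x -> g x = h x) -> sphere_intR g = sphere_intR h.
Proof. by move=> gh; congr (fine _ - fine _); apply: eq_sphere_int => x Sx; rewrite gh. Qed.

Lemma measurable_bool_coord1 : measurable_fun [set: T] (fun x => 0 <= coord1 x).
Proof. by apply: measurable_fun_ler => //; exact: measurable_coord1. Qed.

Lemma measurable_Rext (f : T -> R) : measurable_fun setT f -> measurable_fun setT (Rext f).
Proof.
move=> mf; apply: measurable_fun_ifT => //; first exact: measurable_bool_coord1.
by apply: measurable_funB => //; exact: (measurableT_comp mf (@measurable_oppt R d)).
Qed.

Lemma measurable_Hplus : measurable (@Hplus R d).
Proof.
have -> : @Hplus R d = S `&` [set x | 0 <= coord1 x] by [].
apply: measurableI; first exact: mS.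
have mc := @measurable_coord1 R d hd.
have := mc measurableT _ (measurable_itv `[0, +oo[); rewrite setTI.
by congr measurable; apply/seteqP; split => x /=; rewrite in_itv/= andbT.
Qed.

Definition hemi (x : T) : R := (0 <= coord1 x)%R%:R.

Lemma bmf_hemi : bmf S hemi.
Proof.
split; last by exists 1 => x _; rewrite /hemi; case: (0 <= coord1 x); rewrite ?normr1 ?normr0.
rewrite (_ : hemi = fun x => if 0 <= coord1 x then 1 else 0).
  by apply: measurable_fun_ifT => //; exact: measurable_bool_coord1.
by apply/funext => x; rewrite /hemi; case: (0 <= coord1 x).
Qed.

Section odd_part.
Variable f : T -> R.
Hypotheses (mf : measurable_fun [set: T] f) (f01 : forall x, 0 <= f x <= 1).
Let F x := Rext f x - 1 / 2.

Lemma Rext01 x : 0 <= Rext f x <= 1.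
Proof.
by rewrite /Rext; case: ifP => _ //; have /andP[a b] := f01 (oppt x); apply/andP; split; lra.
Qed.

Lemma bmf_Rext : bmf S (Rext f).
Proof.
split; first exact: measurable_Rext.
by exists 1 => x _; have /andP[a b] := Rext01 x; rewrite ger0_norm.
Qed.

Lemma bmf_Rext_half : bmf S F.
Proof. by apply: bmfB; [exact: bmf_Rext|exact: bmf_cst]. Qed.

(** On the equator both [x] and [-x] fall into the first branch of [Rext], and oddness may fail
    there. *)
Lemma Rext_halfN x : coord1 x != 0 -> F (oppt x) = - F x.
Proof.
rewrite /F /Rext (coord1N hd) opptK oppr_ge0 => x0.
by have [h|h|h] := ltgtP (coord1 x) 0; [field|field|move: x0; rewrite h eqxx].
Qed.

Lemma ae_Rext_halfN : {ae mu, forall x, S x -> F (oppt x) = - F x}.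
Proof. by apply: filterS (ae_coord1 R hd) => x x0 _; exact: Rext_halfN. Qed.

(** For odd [n] the product of [Z n] and [F] is even, so both hemispheres contribute equally, and
    twice [f - 1/2] is [2 f - 1]. *)
Lemma Q_Rext_odd n x : odd n ->
  Q n F x = I (fun y => (Z n).[dotp x y] * (hemi y * (2 * f y - 1))).
Proof.
move=> on; have bF := bmf_Rext_half.
have bZ : bmf S (fun y => (Z n).[dotp x y]) by exact: bmf_hdotp.
have bh := bmf_hemi; have bZF := bmfM bZ bF; have bA := bmfM bZF bh.
have bB := bmfM bZF (bmfB (bmf_cst S 1) bh).
have -> : Q n F x = I (fun y => (Z n).[dotp x y] * F y * hemi y) +
    I (fun y => (Z n).[dotp x y] * F y * (1 - hemi y)).
  by rewrite -(BintD mu mS bA bB); apply: eq_Bint => y _; ring.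
have -> : I (fun y => (Z n).[dotp x y] * F y * (1 - hemi y)) =
    I (fun y => (Z n).[dotp x y] * F y * hemi y).
  rewrite -(Bint_oppt hd bB); apply: ae_eq_Bint; [exact: (bmf_oppt bB)|exact: bA|].
  apply: filterS (ae_coord1 R hd) => y y0 _; rewrite dotpNr gegqN// Rext_halfN//.
  rewrite -signr_odd on expr1 /hemi (coord1N hd) oppr_ge0.
  by have [h|h|h] := ltgtP (coord1 y) 0; [rewrite /=; ring|rewrite /=; ring|move: y0; rewrite h eqxx].
rewrite -(BintD mu mS bA bA); apply: eq_Bint => y _; rewrite /hemi /F /Rext.
by case: ifP => _ /=; field.
Qed.

Lemma Q_Rext_half n x : odd n -> Q n (Rext f) x = Q n F x.
Proof.
move=> on; rewrite /F QB//; [|exact: bmf_Rext|exact: bmf_cst].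
by rewrite (Q_cst_odd hd)// subr0.
Qed.

Lemma Rext_half_residual e : 0 < e -> exists N, forall m, (N <= m)%N ->
  I (fun x => (F x - \sum_(p < m) Q (2 * p + 1) F x) ^+ 2) <= e.
Proof.
move=> e0.
have sF : dsmall F.
  have s1 := dsmall_bounded01 hd (measurable_Rext mf) Rext01.
  exact: (dsmallD hd s1 (dsmall_cst hd (- (1 / 2)))).
(* At index [m], [dsmall_residual] subtracts [m + 1] projections. Taken at [2 m + 1] it subtracts
   [m + 1] pairs of an even and an odd degree, of which the even ones vanish. *)
have [N hN] := dsmall_residual hd sF e0; exists N.+1 => -[//|m] Nm.
apply: le_trans (hN (m.*2.+1) _); last by rewrite (leq_trans (_ : N <= m)%N)// -addnn -addnS leq_addr.
rewrite le_eqVlt; apply/orP; left; apply/eqP; apply: eq_Bint => x Sx; congr ((_ - _) ^+ 2).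
have E k : \sum_(n < k.*2) Q n F x = \sum_(p < k) Q (2 * p + 1) F x.
  elim: k => [|k IH]; first by rewrite !big_ord0.
  rewrite doubleS !big_ord_recr/= IH.
  rewrite (Q_odd_even hd x bmf_Rext_half ae_Rext_halfN); last by rewrite odd_double.
  by rewrite addr0 mul2n addn1.
by rewrite -E doubleS.
Qed.

End odd_part.

End hemisphere.

(** * Expectations as projections, and convergence of the series *)

Section main.
Variables (R : realType) (d : nat).
Hypothesis hd : (2 <= d)%N.
Local Notation T := (d.-tuple R).
Local Notation S := (@sphere R d).
Local Notation mu := (smu R d).
Local Notation I := (Bint mu S).
Local Notation mS := (@measurable_sphere R d).
Local Notation Z m := (gegq R m d).
Local Notation area := (sphere_area R d).

Variables (dO : measure_display) (Omega : measurableType dO) (P : probability Omega R).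
Variables (beta X : Omega -> T) (fX r : T -> R).
Hypotheses (mbeta : measurable_fun [set: Omega] beta) (mX : measurable_fun [set: Omega] X).
Hypothesis SX : forall u, S (X u).
Hypotheses (mfX : measurable_fun [set: T] fX) (fX0 : forall x, 0 <= fX x).
Hypothesis lawX : forall A : set T, measurable A ->
  P (X @^-1` A) = sphere_int (fun x => (\1_A x * fX x)%:E).
Hypothesis fX_pos : sphere_int (fun x => (\1_[set y | Hplus y /\ fX y <= 0] x)%:E) = 0%E.
Hypothesis fX_out : forall x, S x -> coord1 x < 0 -> fX x = 0.
Hypothesis mr : measurable_fun [set: T] r.
Hypothesis condr : forall B : set T, measurable B ->
  P ([set u | Yind beta X u = 1] `&` X @^-1` B) = (\int[P]_(u in X @^-1` B) (r (X u))%:E)%E.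

Let d_gt0 : (0 < d)%N. Proof. exact: ltn_trans hd. Qed.
Let area0 : 0 < area. Proof. exact: sphere_area_gt0. Qed.
Let Y := [set u | Yind beta X u = 1].

Let mY : measurable Y.
Proof.
have mD : measurable_fun [set: Omega] (fun u => dotp (X u) (beta u)) by exact: measurable_dotp2.
have := mD measurableT _ (measurable_itv `[0, +oo[); rewrite setTI.
congr measurable; apply/seteqP; split => u /=; rewrite in_itv/= andbT /Y /= /Yind.
  by move=> ->.
by case: ifP => // _ /eqP; rewrite eq_sym oner_eq0.
Qed.

(** The density of [X] for [smu]. The factor [area] is the one by which [qker] divides, so
    [qker / fX] becomes [Z n / w]. *)
Let w x := area * fX x.
Let mw : measurable_fun [set: T] w. Proof. exact: measurable_funM. Qed.
Let w0 x : 0 <= w x. Proof. by rewrite mulr_ge0// ltW. Qed.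

Let lawE A : measurable A -> P (X @^-1` A) = (\int[mu]_(x in A) (w x)%:E)%E.
Proof.
move=> mA; rewrite lawX// sphere_intE//; first last.
- by move=> x; rewrite lee_fin mulr_ge0// indicE.
- by apply/measurable_EFinP; apply: measurable_funM => //; exact: measurable_indic.
rewrite -ge0_integralZl_EFin//; first last.
- exact: ltW.
- by apply/measurable_EFinP; apply: measurable_funM => //; exact: measurable_indic.
- by move=> x _; rewrite lee_fin mulr_ge0// indicE.
rewrite [RHS]integral_mkcond; apply: eq_integral => x _.
by rewrite patchE indicE; case: ifP => _; rewrite -EFinM ?mul1r ?mul0r ?mulr0.
Qed.

Let ae_pos : {ae mu, forall x, Hplus x -> 0 < fX x}.
Proof.
have mN : measurable [set y : T | Hplus y /\ fX y <= 0].
  have -> : [set y : T | Hplus y /\ fX y <= 0] = @Hplus R d `&` [set y | fX y <= 0] by [].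
  apply: measurableI; first exact: measurable_Hplus.
  have := mfX measurableT (measurable_itv `]-oo, 0]); rewrite setTI.
  by congr measurable; apply/seteqP; split => x /=; rewrite in_itv.
exists [set y | Hplus y /\ fX y <= 0]; split => //.
  have := fX_pos; rewrite sphere_intE//; last first.
    by apply/measurable_EFinP; exact: measurable_indic.
  rewrite integral_indic// setIT => /eqP; rewrite mule_eq0 eqe gt_eqF//= => /eqP //.
move=> x /= /not_implyP[Hx /negP]; rewrite -leNgt => fx; by split.
Qed.

Let ae_support : {ae mu, forall x, S x -> (w x != 0) = (0 <= coord1 x)}.
Proof.
apply: filterS ae_pos => x hx Sx; have [x0|x0] := leP 0 (coord1 x).
  by rewrite mulf_neq0 ?lt0r_neq0// hx//; split.
by rewrite /w fX_out// mulr0 eqxx.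
Qed.

(** [cond_prob_bounds] concerns the law of [X]; its density is positive almost everywhere on
    [Hplus], so its null sets there are null for [smu]. *)
Let ae_r01 : {ae mu, forall x, Hplus x -> 0 <= r x <= 1}.
Proof.
have [P1 P2] := cond_prob_bounds mX mY mr condr.
have aux (D : set T) : measurable D -> P (X @^-1` D) = 0%E -> {ae mu, forall x, D x -> w x = 0}.
  move=> mD; rewrite lawE// => D0.
  have [+ _] := ae_eq_integral_abs mu mD (measurable_funTS (measurableT_comp (@EFin_measurable R setT) mw)).
  have -> : (\int[mu]_(x in D) `|(w x)%:E|)%E = 0%E.
    by rewrite -D0; apply: eq_integral => x _; rewrite gee0_abs// lee_fin.
  by move=> /(_ erefl); apply: filterS => x h /h [].
have m1 := measurable_lt_cst 0 mr; have m2 := measurable_gt_cst 1 mr.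
apply: filterS3 ae_pos (aux _ m1 P1) (aux _ m2 P2) => x h1 h2 h3 Hx.
have wx : w x != 0 by rewrite lt0r_neq0// mulr_gt0// h1.
apply/andP; split; rewrite leNgt; apply/negP.
  by move=> /h2 w0'; rewrite w0' eqxx in wx.
by move=> /h3 w0'; rewrite w0' eqxx in wx.
Qed.

(** Clipping leaves a version of the conditional probability, by [condrt], and makes [Rext rt]
    bounded everywhere. *)
Let rt x := Num.min 1 (Num.max 0 (r x)).

Let rt01 x : 0 <= rt x <= 1.
Proof. by rewrite /rt ge_min lexx le_min ler01 le_max lexx. Qed.

Let rtE x : 0 <= r x <= 1 -> rt x = r x.
Proof. by move=> /andP[a b]; rewrite /rt (max_idPr a) (min_idPr b). Qed.

Let mrt : measurable_fun [set: T] rt.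
Proof. by apply: measurable_minr => //; exact: measurable_maxr. Qed.

Let brt : bmf S rt.
Proof. by split => //; exists 1 => x _; have /andP[a b] := rt01 x; rewrite ger0_norm. Qed.

Let condrt B : measurable B -> P (Y `&` X @^-1` B) = (\int[P]_(u in X @^-1` B) (rt (X u))%:E)%E.
Proof.
move=> mB; rewrite condr//; apply: ae_eq_integral.
- by rewrite -[X in measurable X]setTI; exact: mX.
- by apply: measurable_funTS; apply/measurable_EFinP; exact: measurableT_comp.
- by apply: measurable_funTS; apply/measurable_EFinP; exact: measurableT_comp.
have [P1 P2] := cond_prob_bounds mX mY mr condr.
have aux (D : set T) : measurable D -> P (X @^-1` D) = 0%E -> {ae P, forall u, ~ D (X u)}.
  move=> mD D0; exists (X @^-1` D); split => //.
    by rewrite -[X in measurable X]setTI; exact: mX.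
  by move=> u /= /contrapT.
have m1 := measurable_lt_cst 0 mr; have m2 := measurable_gt_cst 1 mr.
apply: filterS2 (aux _ m1 P1) (aux _ m2 P2) => u /= /negP h1 /negP h2 _.
by rewrite rtE// !leNgt h1 h2.
Qed.

(** Below the equator [Rext] reads [r] at [-x], so the exceptional null set is used together with
    its reflection. *)
Let ae_Rext : {ae mu, forall x, S x -> Rext r x = Rext rt x}.
Proof.
apply: filterS2 ae_r01 (ae_oppt ae_r01) => x h1 h2 Sx; rewrite /Rext.
have [x0|x0] := leP 0 (coord1 x); first by rewrite rtE// h1//; split.
by rewrite rtE// h2//; split; [exact/sphere_oppt|rewrite (coord1N hd) oppr_ge0 ltW].
Qed.

(** Inverse weighting: division by the density cancels the law of [X] and leaves the uniform measure
    on the hemisphere. *)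
Let integral_X (z : T -> R) : bmf S z -> (forall x, 0 <= z x) ->
  (\int[P]_u (z (X u) / w (X u))%:E = (I (fun x => z x * hemi x))%:E)%E /\
  (\int[P]_u (z (X u) / w (X u) * \1_Y u)%:E = (I (fun x => z x * (hemi x * rt x)))%:E)%E.
Proof.
move=> bz z0; have [mz _] := bz.
have mg : measurable_fun setT (fun x => (z x / w x)%:E).
  by apply/measurable_EFinP; apply: measurable_funM => //; exact: measurable_funV.
have g0 x : (0 <= (z x / w x)%:E)%E by rewrite lee_fin divr_ge0.
have bh := @bmf_hemi R d hd.
have toI (k h : T -> R) : measurable_fun setT k -> (forall x, 0 <= k x) -> bmf S h ->
    {ae mu, forall x, S x -> k x = h x} -> (\int[mu]_x (k x)%:E = (I h)%:E)%E.
  move=> mk k0 bh' kh; rewrite integral_smu_sphere//; last exact/measurable_EFinP.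
  rewrite /Bint /Rintegral fineK; last exact: (integrable_fin_num mS (bmf_integrable mu mS bh')).
  apply: ae_eq_integral; first exact: mS.
  - by apply: measurable_funTS; exact/measurable_EFinP.
  - by apply: measurable_funTS; apply/measurable_EFinP; exact: bh'.1.
  by apply: filterS kh => x h' Sx; rewrite h'.
(* Where [w] vanishes the quotient is 0 by convention, in agreement with the indicator of the
   hemisphere. *)
have wE x : S x -> (w x != 0) = (0 <= coord1 x) -> z x / w x * w x = z x * hemi x.
  move=> Sx; rewrite /hemi => <-; have [->|wx] := eqVneq (w x) 0; first by rewrite !mulr0.
  by rewrite divfK// mulr1.
split.
- rewrite (ge0_integral_law mX mw w0 lawE mg g0) -(toI (fun x => z x / w x * w x))//.
  + by apply: measurable_funM => //; exact/measurable_EFinP.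
  + by move=> x; rewrite mulr_ge0// -lee_fin.
  + exact: bmfM.
  + by apply: filterS ae_support => x h Sx; rewrite wE// h.
rewrite -(toI (fun x => z x / w x * (rt x * w x))).
- rewrite -(ge0_integral_cond mX mY mw w0 lawE mrt _ condrt mg g0) => [|x]; last by have /andP[] := rt01 x.
  by apply: eq_integral => u _; rewrite EFinM.
- by apply: measurable_funM; [exact/measurable_EFinP|exact: measurable_funM].
- move=> x; have /andP[h _] := rt01 x.
  by apply: mulr_ge0; [exact: divr_ge0|exact: mulr_ge0].
- by apply: bmfM => //; exact: bmfM.
- apply: filterS ae_support => x h Sx; have e := wE x Sx (h Sx).
  by rewrite mulrCA e; ring.
Qed.

Let F x := Rext rt x - 1 / 2.

Lemma projcoef_Q n x : odd n -> S x -> projcoef P beta X fX n x = (Q n F x)%:E.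
Proof.
move=> on Sx; have bZ : bmf S (fun y => (Z n).[dotp x y]) by exact: bmf_hdotp.
(* [integral_X] is for nonnegative functions, so the kernel is split into its positive and negative
   parts. *)
pose zp y := Num.max (Z n).[dotp x y] 0; pose zm y := Num.max (- (Z n).[dotp x y]) 0.
have bp : bmf S zp by exact: bmf_max0.
have bm : bmf S zm by exact/bmf_max0/bmfN.
have p0 y : 0 <= zp y by rewrite le_max lexx orbT.
have m0 y : 0 <= zm y by rewrite le_max lexx orbT.
have ZE y : (Z n).[dotp x y] = zp y - zm y by exact: max0_split.
have [p1 p2] := integral_X bp p0; have [m1 m2] := integral_X bm m0.
have mq z : bmf S z -> measurable_fun [set: Omega] (fun u => z (X u) / w (X u)).
  move=> [mz _]; apply: measurable_funM; first exact: measurableT_comp.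
  by apply: measurable_funV; exact: measurableT_comp.
have mqY z : bmf S z -> measurable_fun [set: Omega] (fun u => z (X u) / w (X u) * \1_Y u).
  by move=> bz; apply: measurable_funM; [exact: mq|exact: measurable_indic].
have intg (k : Omega -> R) c : measurable_fun [set: Omega] k -> (forall u, 0 <= k u) ->
    (\int[P]_u (k u)%:E = c%:E)%E ->
    P.-integrable [set: Omega] (EFin \o k) /\ \int[P]_u k u = c.
  move=> mk k0 kc; split; last by rewrite /Rintegral kc.
  apply/integrableP; split; first exact/measurable_EFinP.
  under eq_integral => u _ do rewrite /= ger0_norm//.
  by rewrite kc ltry.
have q0 z u : (forall y, 0 <= z y) -> 0 <= z (X u) / w (X u) by move=> z0; rewrite divr_ge0.
have q1 z u : (forall y, 0 <= z y) -> 0 <= z (X u) / w (X u) * \1_Y u.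
  by move=> z0; rewrite mulr_ge0 ?q0// indicE.
have [ip1 {}p1] := intg _ _ (mq _ bp) (fun u => q0 _ u p0) p1.
have [ip2 {}p2] := intg _ _ (mqY _ bp) (fun u => q1 _ u p0) p2.
have [im1 {}m1] := intg _ _ (mq _ bm) (fun u => q0 _ u m0) m1.
have [im2 {}m2] := intg _ _ (mqY _ bm) (fun u => q1 _ u m0) m2.
(* The factor [2 Y - 1] is distributed over both parts of the kernel, which leaves a combination of
   four integrable nonnegative functions. *)
pose k u := (2 * (zp (X u) / w (X u) * \1_Y u) - zp (X u) / w (X u)) -
            (2 * (zm (X u) / w (X u) * \1_Y u) - zm (X u) / w (X u)).
have i2 (g : Omega -> R) : P.-integrable [set: Omega] (EFin \o g) ->
    P.-integrable [set: Omega] (EFin \o (fun u => 2 * g u)).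
  by move=> ig; have := integrableZl measurableT 2 ig; congr (P.-integrable _ _); apply/funext.
have iB (g h : Omega -> R) : P.-integrable [set: Omega] (EFin \o g) ->
    P.-integrable [set: Omega] (EFin \o h) -> P.-integrable [set: Omega] (EFin \o (fun u => g u - h u)).
  by move=> ig ih; have := integrableB measurableT ig ih; congr (P.-integrable _ _); apply/funext.
have iP := iB _ _ (i2 _ ip2) ip1; have iM := iB _ _ (i2 _ im2) im1.
have ik : P.-integrable [set: Omega] (EFin \o k) := iB _ _ iP iM.
have -> : projcoef P beta X fX n x = (\int[P]_u k u)%:E.
  rewrite /Rintegral fineK; last exact: (integrable_fin_num measurableT ik).
  apply: eq_integral => u _; congr (_%:E).
  rewrite qkerE//; last exact: dotp_le1.
  rewrite dotpC ZE /k /w (invfM area (fX (X u))).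
  have -> : Yind beta X u = \1_Y u.
    rewrite indicE; case: (boolP (u \in Y)) => [/set_mem //|/negP uY].
    rewrite /Yind; case: ifPn => // h; exfalso; apply: uY; apply/mem_set.
    by rewrite /Y /= /Yind h.
  ring.
congr (_%:E); rewrite (RintegralB measurableT iP iM) (RintegralB measurableT (i2 _ ip2) ip1).
rewrite (RintegralB measurableT (i2 _ im2) im1).
rewrite !RintegralZl// p1 p2 m1 m2 (Q_Rext_odd hd mrt rt01 x on).
have bh := @bmf_hemi R d hd; have bhr := bmfM bh brt.
rewrite -!(BintZ mu mS); [|exact: bmfM|exact: bmfM].
rewrite -(BintB mu mS); [|by apply: bmfZ; exact: bmfM|exact: bmfM].
rewrite -(BintB mu mS); [|by apply: bmfZ; exact: bmfM|exact: bmfM].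
rewrite -(BintB mu mS); last 2 first.
- by apply: bmfB; [apply: bmfZ; exact: bmfM|exact: bmfM].
- by apply: bmfB; [apply: bmfZ; exact: bmfM|exact: bmfM].
by apply: eq_Bint => y _; rewrite ZE; ring.
Qed.

Lemma Qproj_Q n x : odd n -> S x -> Qproj n d (Rext r) x = Q n F x.
Proof.
move=> on Sx; rewrite -(Q_Rext_half hd mrt rt01 x on).
have bZ : bmf S (fun y => (Z n).[dotp x y]) by exact: bmf_hdotp.
have bR := @bmf_Rext R d hd _ mrt rt01.
rewrite /Qproj (@eq_sphere_intR R d _ (fun y => (Z n).[dotp x y] / area * Rext r y)); last first.
  by move=> y Sy; rewrite qkerE//; exact: dotp_le1.
rewrite (@sphere_intR_Bint R d hd _ (fun y => area^-1 * ((Z n).[dotp x y] * Rext rt y))).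
- by rewrite (BintZ mu mS) ?mulrA ?divff ?mul1r ?lt0r_neq0//; exact: bmfM.
- apply: measurable_funM; last exact: measurable_Rext.
  by apply: measurable_funM => //; exact: bZ.1.
- by apply: bmfZ; exact: bmfM.
by apply: filterS ae_Rext => y h Sy; rewrite h//; ring.
Qed.

Lemma sphere_int_residual_cvg :
  (fun N : nat => sphere_int (fun x =>
      ((Rext r x - 1 / 2 - \sum_(p < N) fine (projcoef P beta X fX (2 * p + 1) x)) ^+ 2)%:E))
     @ \oo --> 0%E.
Proof.
have bF := @bmf_Rext_half R d hd _ mrt rt01.
have bS N : bmf S (fun x => \sum_(p < N) Q (2 * p + 1) F x).
  by apply: bmf_sum => p; exact: bmf_Q.
have od p : odd (2 * p + 1) by rewrite oddD mul2n odd_double.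
have E N : sphere_int (fun x =>
      ((Rext r x - 1 / 2 - \sum_(p < N) fine (projcoef P beta X fX (2 * p + 1) x)) ^+ 2)%:E) =
    (area * I (fun x => (F x - \sum_(p < N) Q (2 * p + 1) F x) ^+ 2))%:E.
  rewrite (@eq_sphere_int R d _ (fun x =>
      ((Rext r x - 1 / 2 - \sum_(p < N) Q (2 * p + 1) F x) ^+ 2)%:E)); last first.
    move=> x Sx; congr ((_ - _) ^+ 2)%:E; apply: eq_bigr => p _.
    by rewrite projcoef_Q.
  apply: (sphere_int_Bint hd).
  - apply: measurable_funX; apply: measurable_funB; last exact: (bS N).1.
    by apply: measurable_funB => //; exact: measurable_Rext.
  - by move=> x; rewrite sqr_ge0.
  - by apply: bmfX; exact: bmfB.
  - by apply: filterS ae_Rext => x h Sx; rewrite h.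
under eq_fun do rewrite E.
apply: cvg_EFin; first exact: nearW.
apply/cvgrPdist_le => e e0.
have [N hN] := Rext_half_residual hd mrt rt01 (divr_gt0 e0 area0).
exists N => // m /= Nm; rewrite sub0r normrN ger0_norm; last first.
  by apply: mulr_ge0; [exact: ltW|apply: Bint_ge0 => y _; rewrite sqr_ge0].
by rewrite mulrC -ler_pdivlMr//; exact: hN.
Qed.

End main.

Theorem theorem4p1 (R : realType) (d : nat) (hd : (2 <= d)%N)
  (dO : measure_display) (Omega : measurableType dO) (P : probability Omega R)
  (beta X : Omega -> d.-tuple R) (fbeta fX : d.-tuple R -> R)
  (r : d.-tuple R -> R) :
  (* beta and X are random vectors in S^{d-1} *)
  measurable_fun [set: Omega] beta -> measurable_fun [set: Omega] X ->
  (forall w, sphere (beta w)) -> (forall w, sphere (X w)) ->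
  (* independence *)
  (forall A B : set (d.-tuple R), measurable A -> measurable B ->
     P (beta @^-1` A `&` X @^-1` B) = (P (beta @^-1` A) * P (X @^-1` B))%E) ->
  (* beta has a probability density fbeta in L^2(S^{d-1}) w.r.t. sigma *)
  measurable_fun [set: d.-tuple R] fbeta -> (forall x, 0 <= fbeta x) ->
  (forall A : set (d.-tuple R), measurable A ->
     P (beta @^-1` A) = sphere_int (fun x => (\1_A x * fbeta x)%:E)) ->
  (sphere_int (fun x => (fbeta x ^+ 2)%:E) < +oo)%E ->
  (* X has a density fX w.r.t. sigma, positive sigma-a.e. on H^+, zero outside H^+ *)
  measurable_fun [set: d.-tuple R] fX -> (forall x, 0 <= fX x) ->
  (forall A : set (d.-tuple R), measurable A ->
     P (X @^-1` A) = sphere_int (fun x => (\1_A x * fX x)%:E)) ->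
  sphere_int (fun x => (\1_[set y | Hplus y /\ fX y <= 0] x)%:E) = 0%E ->
  (forall x, sphere x -> coord1 x < 0 -> fX x = 0) ->
  (* r(x) = P(Y = 1 | X = x) (any version of the conditional probability) *)
  measurable_fun [set: d.-tuple R] r ->
  (forall B : set (d.-tuple R), measurable B ->
     P ([set w | Yind beta X w = 1] `&` X @^-1` B) =
     (\int[P]_(w in X @^-1` B) (r (X w))%:E)%E) ->
  (forall (p : nat) (x : d.-tuple R), sphere x ->
     projcoef P beta X fX (2 * p + 1) x = (Qproj (2 * p + 1) d (Rext r) x)%:E) /\
  ((fun N : nat => sphere_int (fun x =>
      ((Rext r x - 1 / 2 - \sum_(p < N) fine (projcoef P beta X fX (2 * p + 1) x)) ^+ 2)%:E))
     @ \oo --> 0%E).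
Proof.
move=> mbeta mX _ SX _ _ _ _ _ mfX fX0 lawX fX_pos fX_out mr condr; split.
  move=> p x Sx; have od : odd (2 * p + 1) by rewrite oddD mul2n odd_double.
  by rewrite (projcoef_Q hd mbeta mX SX mfX fX0 lawX fX_pos fX_out mr condr od Sx)
             (Qproj_Q hd mbeta mX mfX fX0 lawX fX_pos mr condr od Sx).
exact: (sphere_int_residual_cvg hd mbeta mX SX mfX fX0 lawX fX_pos fX_out mr condr).
Qed.
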